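(* Let $\Lambda$ be an algebra which admits an $\mathcal{H}$-strongly co-stratifying $n$-chain. Then $\Lambda$ verifies Han's conjecture.
   Context: Throughout, ''algebra'' means a finite dimensional associative unital algebra over a fixed field $k$. For an algebra $\Lambda$, $HH_*(\Lambda)=\mathrm{Tor}_*^{\Lambda\otimes_k\Lambda^{\mathrm{op}}}(\Lambda,\Lambda)$ is its Hochschild homology; it is called finite if there is $N$ with $HH_m(\Lambda)=0$ for all $m>N$. An algebra $\Lambda$ verifies Han's conjecture (equivalently, Han's conjecture holds, or is true, for $\Lambda$) if the following implication holds: if $HH_*(\Lambda)$ is finite, then $\Lambda$ has finite global dimension. For an algebra $\Gamma$ with unit $1_\Gamma$ and an idempotent $e\in\Gamma$, put $f=1_\Gamma-e$. The ideal $\Gamma e\Gamma$ is strongly stratifying if: (1) $\mathrm{Tor}_m^{e\Gamma e}(\Gamma e,e\Gamma)=0$ for $m>0$; (2) $f\Gamma e\otimes_{e\Gamma e}e\Gamma f=0$; (3) $\mathrm{Tor}_m^{f\Gamma f}(\Gamma f,f\Gamma)=0$ for $m>0$. Let $\{e_1,\dots,e_n\}$ be an ordered complete set of orthogonal idempotents of $\Lambda$ (pairwise orthogonal idempotents with sum $1$, not necessarily primitive), and for $0\le i\le n-1$ let $f_i=e_{i+1}+\dots+e_n$, so $f_0=1$ and $f_{n-1}=e_n$; the algebra $f_i\Lambda f_i$ has unit $f_i$ and contains $f_{i+1}$. The set is a strongly co-stratifying $n$-chain of $\Lambda$ if, for each $0\le i\le n-2$, the two-sided ideal of $f_i\Lambda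 f_i$ generated by the idempotent $f_{i+1}$ is strongly stratifying in $f_i\Lambda f_i$ (with respect to the idempotent $f_{i+1}$). It is an $\mathcal{H}$-strongly co-stratifying $n$-chain if moreover $e_i\Lambda e_i$ verifies Han's conjecture for all $i$. *)

(* Defs.v *)
From HB Require Import structures.
From mathcomp Require Import all_boot all_algebra.
From mathcomp Require Import boolp classical_sets functions.

Set Implicit Arguments.
Unset Strict Implicit.
Unset Printing Implicit Defensive.

Import GRing.Theory.
Local Open Scope ring_scope.
Local Open Scope quotient_scope.

(* Left modules over a ring R are [lmodType R]; right modules over R are left
   modules over the converse ring, [lmodType R^c], so that [r *: m] stands for
   m r.  Rings are [pzRingType]s because corner rings e R e may be zero. *)

Definition trivial_group (G : zmodType) : Prop := forall x : G, x = 0.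

Section Tensor.
Variables (R : pzRingType) (M : lmodType R^c) (N : lmodType R).

Definition balanced (G : zmodType) (b : M -> N -> G) : Prop :=
  [/\ forall n, {morph b^~ n : x y / x + y},
      forall m, {morph b m : x y / x + y}
    & forall (r : R) m n, b ((r : R^c) *: m) n = b m (r *: n)].

Definition tens_eval (G : zmodType) (b : M -> N -> G) (s : seq (M * N)) : G :=
  \sum_(p <- s) b p.1 p.2.

(* Two finite formal sums of symbols (m, n) represent the same tensor when no
   balanced map separates them: this is the universal property of M (x)_R N. *)
Definition tens_equiv (s t : seq (M * N)) : bool :=
  `[< forall (G : zmodType) (b : M -> N -> G),
        balanced b -> tens_eval b s = tens_eval b t >].

Lemma tens_equivP s t :
  reflect (forall (G : zmodType) (b : M -> N -> G),
             balanced b -> tens_eval b s = tens_eval b t) (tens_equiv s t).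
Proof. exact: asboolP. Qed.

Lemma tens_equiv_class : equiv_class_of tens_equiv.
Proof.
split=> [s|s t|t s u].
- exact/tens_equivP.
- by apply/tens_equivP/tens_equivP => h G b /h.
- move=> /tens_equivP h1 /tens_equivP h2; apply/tens_equivP => G b bb.
  by rewrite h1 ?h2.
Qed.

Canonical tens_equiv_rel := EquivRelPack tens_equiv_class.
Canonical tens_enc := defaultEncModRel tens_equiv.

Definition tensor := {eq_quot tens_equiv}.
HB.instance Definition _ := Choice.on tensor.
HB.instance Definition _ := EqQuotient.on tensor.

Definition tens_lift (G : zmodType) (b : M -> N -> G) (x : tensor) : G :=
  tens_eval b (repr x).

Lemma tens_lift_pi (G : zmodType) (b : M -> N -> G) s :
  balanced b -> tens_lift b (\pi_tensor s) = tens_eval b s.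
Proof.
move=> bb; have /eqmodP/tens_equivP := reprK (\pi_tensor s); exact.
Qed.

Lemma tens_sep (x y : tensor) :
  (forall (G : zmodType) (b : M -> N -> G),
     balanced b -> tens_lift b x = tens_lift b y) -> x = y.
Proof. by move=> h; rewrite -[x]reprK -[y]reprK; apply/eqmodP/tens_equivP. Qed.

Definition tens_add (x y : tensor) : tensor := \pi_tensor (repr x ++ repr y).
Definition tens_zero : tensor := \pi_tensor [::].
Definition tens_opp (x : tensor) : tensor :=
  \pi_tensor [seq (- p.1, p.2) | p <- repr x].

Section LiftOps.
Variables (G : zmodType) (b : M -> N -> G).
Hypothesis bb : balanced b.

Lemma balanced0l n : b 0 n = 0.
Proof. by case: bb => h _ _; apply: (addIr (b 0 n)); rewrite -h !add0r. Qed.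
Lemma balanced0r m : b m 0 = 0.
Proof. by case: bb => _ h _; apply: (addIr (b m 0)); rewrite -h !add0r. Qed.
Lemma balancedNl m n : b (- m) n = - b m n.
Proof.
case: (bb) => h _ _; apply: (addIr (b m n)).
by rewrite -h !addNr balanced0l.
Qed.

Lemma tens_lift_add x y :
  tens_lift b (tens_add x y) = tens_lift b x + tens_lift b y.
Proof. by rewrite tens_lift_pi // /tens_eval big_cat. Qed.
Lemma tens_lift_zero : tens_lift b tens_zero = 0.
Proof. by rewrite tens_lift_pi // /tens_eval big_nil. Qed.
Lemma tens_lift_opp x : tens_lift b (tens_opp x) = - tens_lift b x.
Proof.
rewrite tens_lift_pi // /tens_lift /tens_eval big_map -sumrN.
by apply: eq_bigr => p _; rewrite balancedNl.
Qed.
End LiftOps.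

Fact tens_addA : associative tens_add.
Proof. by move=> x y z; apply: tens_sep => G b bb; rewrite !tens_lift_add ?addrA. Qed.
Fact tens_addC : commutative tens_add.
Proof. by move=> x y; apply: tens_sep => G b bb; rewrite !tens_lift_add ?(addrC (tens_lift b x)). Qed.
Fact tens_add0 : left_id tens_zero tens_add.
Proof. by move=> x; apply: tens_sep => G b bb; rewrite !tens_lift_add ?tens_lift_zero ?add0r. Qed.
Fact tens_addN : left_inverse tens_zero tens_opp tens_add.
Proof.
move=> x; apply: tens_sep => G b bb.
by rewrite !tens_lift_add ?tens_lift_zero ?tens_lift_opp ?addNr.
Qed.

HB.instance Definition _ :=
  GRing.isZmodule.Build tensor tens_addA tens_addC tens_add0 tens_addN.

Definition tens (m : M) (n : N) : tensor := \pi_tensor [:: (m, n)].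

Lemma tens_liftE (G : zmodType) (b : M -> N -> G) m n :
  balanced b -> tens_lift b (tens m n) = b m n.
Proof. by move=> bb; rewrite tens_lift_pi // /tens_eval big_seq1. Qed.

Lemma tens_liftD (G : zmodType) (b : M -> N -> G) x y :
  balanced b -> tens_lift b (x + y) = tens_lift b x + tens_lift b y.
Proof. by move=> bb; exact: tens_lift_add. Qed.

Lemma tens_lift_is_additive (G : zmodType) (b : M -> N -> G) :
  balanced b -> zmod_morphism (tens_lift b).
Proof. by move=> bb x y; rewrite (tens_lift_add bb) (tens_lift_opp bb). Qed.

Lemma tens_balanced : balanced tens.
Proof.
split=> [n x y|m x y|r m n]; apply: tens_sep => G b bb;
  rewrite ?(tens_liftD _ _ bb) !(tens_liftE _ _ bb); case: (bb) => h1 h2 h3; [exact: h1|exact: h2|exact: h3].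
Qed.

Lemma tens_sum (x : tensor) : x = \sum_(p <- repr x) tens p.1 p.2.
Proof.
apply: tens_sep => G b bb; rewrite {1}/tens_lift /tens_eval.
elim: (repr x) => [|p s IH]; first by rewrite !big_nil (tens_lift_zero bb).
by rewrite !big_cons tens_liftD // tens_liftE // IH.
Qed.

Lemma tens_ind (P : tensor -> Prop) :
  P 0 -> (forall x y, P x -> P y -> P (x + y)) -> (forall m n, P (tens m n)) ->
  forall x, P x.
Proof.
by move=> P0 PD Pt x; rewrite [x]tens_sum; elim/big_ind: _ => // p _; exact: Pt.
Qed.
End Tensor.

Section TensorMap.
Variables (R : pzRingType) (M M' : lmodType R^c) (N : lmodType R).
Variable f : {linear M -> M'}.

Definition tens_map : tensor M N -> tensor M' N :=
  tens_lift (fun m n => tens (f m) n).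

Lemma tens_map_balanced : balanced (fun m (n : N) => tens (f m) n).
Proof.
by case: (tens_balanced M' N) => h1 h2 h3; split=> [n x y|m x y|r m n];
  rewrite ?linearD ?linearZ ?h1 ?h2 ?h3.
Qed.

HB.instance Definition _ := GRing.isZmodMorphism.Build _ _ tens_map
  (tens_lift_is_additive tens_map_balanced).
End TensorMap.

Section Kernel.
Variables (U V : zmodType) (f : {additive U -> V}).
Definition in_ker : pred U := fun x => f x == 0.
Record zker := ZKer { zker_val :> U; _ : in_ker zker_val }.
HB.instance Definition _ := [isSub for zker_val].
HB.instance Definition _ := [Choice of zker by <:].
Fact in_ker_closed : zmod_closed in_ker.
Proof.
split=> [|x y]; rewrite !unfold_in /in_ker ?raddf0 // => /eqP fx /eqP fy.
by rewrite raddfB fx fy subrr.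
Qed.
HB.instance Definition _ :=
  GRing.SubChoice_isSubZmodule.Build _ _ zker in_ker_closed.
End Kernel.

Section LKernel.
Variables (R : pzRingType) (U V : lmodType R) (f : {linear U -> V}).
Definition in_lker : pred U := fun x => f x == 0.
Record lker := LKer { lker_val :> U; _ : in_lker lker_val }.
HB.instance Definition _ := [isSub for lker_val].
HB.instance Definition _ := [Choice of lker by <:].
Fact in_lker_closed : subsemimod_closed in_lker.
Proof.
split=> [|a x]; last by rewrite !unfold_in /in_lker => /eqP fx; rewrite linearZ /= fx scaler0.
split=> [|x y]; rewrite !unfold_in /in_lker ?linear0 // => /eqP fx /eqP fy.
by rewrite linearD /= fx fy addr0.
Qed.
HB.instance Definition _ :=
  GRing.SubChoice_isSubLmodule.Build R U _ lker in_lker_closed.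
End LKernel.
(* The free left module R^(X): finitely supported functions X -> R. *)
Section FreeModule.
Variables (R : pzRingType) (X : choiceType).

Definition fin_supp : pred (X -> R^o) :=
  fun f => `[< exists s : seq X, forall x, f x != 0 -> x \in s >].
Record free_module :=
  FreeModule { free_val :> X -> R^o; _ : fin_supp free_val }.
HB.instance Definition _ := [isSub for free_val].
HB.instance Definition _ := [Choice of free_module by <:].
Fact fin_supp_closed : subsemimod_closed fin_supp.
Proof.
split=> [|a f]; last first.
  rewrite !unfold_in => /asboolP[s hs]; apply/asboolP; exists s => x.
  rewrite scalrfctE => h; apply: hs; apply: contraNneq h => ->.
  by rewrite scaler0.
split=> [|f g]; rewrite !unfold_in.
  by apply/asboolP; exists [::] => x; rewrite /= eqxx.
move=> /asboolP[s hs] /asboolP[t ht]; apply/asboolP; exists (s ++ t) => x.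
rewrite mem_cat addrfctE; case: (eqVneq (f x) 0) => [->|/hs ->] //.
by rewrite add0r => /ht ->; rewrite orbT.
Qed.
HB.instance Definition _ :=
  GRing.SubChoice_isSubLmodule.Build R (X -> R^o) _ free_module fin_supp_closed.

Definition supp (f : free_module) : seq X :=
  undup (projT1 (cid (asboolW (valP f)))).

Lemma supp_uniq f : uniq (supp f). Proof. exact: undup_uniq. Qed.
Lemma mem_supp (f : free_module) x : f x != 0 -> x \in supp f.
Proof. by rewrite mem_undup; case: cid => s /= hs; exact: hs. Qed.

Section Lift.
Variables (V : lmodType R) (u : X -> V).

Definition free_lift (f : free_module) : V := \sum_(x <- supp f) (f x : R) *: u x.

Lemma free_liftE (f : free_module) (s : seq X) :
  uniq s -> (forall x, f x != 0 -> x \in s) ->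
  free_lift f = \sum_(x <- s) (f x : R) *: u x.
Proof.
move=> us hs; rewrite /free_lift.
have red t : uniq t -> (forall x, f x != 0 -> x \in t) ->
    \sum_(x <- t) (f x : R) *: u x =
    \sum_(x <- [seq y <- t | f y != 0]) (f x : R) *: u x.
  move=> ut ht; rewrite big_filter [LHS](bigID (fun y => f y != 0)) /=.
  rewrite [X in _ + X]big1 ?addr0 // => x; rewrite negbK => /eqP ->.
  by rewrite scale0r.
rewrite (red _ us hs) (red _ (supp_uniq f) (@mem_supp f)).
apply/perm_big/uniq_perm; rewrite ?filter_uniq ?supp_uniq // => x.
by rewrite !mem_filter; case: eqP => //= /eqP h; rewrite hs // mem_supp.
Qed.

Lemma free_lift_is_linear : linear free_lift.
Proof.
move=> a f g; set h := a *: f + g.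
set s := undup (supp h ++ supp f ++ supp g).
have us : uniq s by exact: undup_uniq.
rewrite !(@free_liftE _ s us); first last.
- by move=> x /mem_supp xs; rewrite mem_undup !mem_cat xs.
- by move=> x /mem_supp xs; rewrite mem_undup !mem_cat xs orbT.
- by move=> x /mem_supp xs; rewrite mem_undup !mem_cat xs !orbT.
rewrite scaler_sumr -big_split /=; apply: eq_bigr => x _.
by rewrite scalerA -scalerDl; congr (_ *: _).
Qed.
HB.instance Definition _ :=
  GRing.isLinear.Build R free_module V *:%R free_lift free_lift_is_linear.
End Lift.

Fact delta_fin_supp (x : X) : fin_supp (fun y => (y == x)%:R).
Proof.
apply/asboolP; exists [:: x] => y; rewrite inE.
by case: (y == x); rewrite ?eqxx.
Qed.
Definition free_gen (x : X) : free_module := FreeModule (delta_fin_supp x).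

Lemma free_lift_gen (V : lmodType R) (u : X -> V) x :
  free_lift u (free_gen x) = u x.
Proof.
rewrite (@free_liftE _ _ _ [:: x]) //= => [|y].
  by rewrite big_seq1 eqxx scale1r.
by rewrite inE; case: (y == x); rewrite ?eqxx.
Qed.

Lemma free_genE (f : free_module) : f = free_lift free_gen f.
Proof.
apply: val_inj; apply/funext => y; rewrite /free_lift.
have -> : \val (\sum_(x <- supp f) (f x : R) *: free_gen x) y =
    \sum_(x <- supp f) f x * (y == x)%:R.
  by elim/big_rec2: _ => // x g1 g2 _ /= <-.
have [fy|fy] := boolP (f y == 0).
  rewrite (eqP fy : \val f y = 0) big1 // => x _.
  by case: eqVneq => [<-|]; rewrite ?(eqP fy) ?mul0r ?mulr0.
rewrite (bigD1_seq y) ?mem_supp ?supp_uniq //= eqxx mulr1 big1 ?addr0 //.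
by move=> x; rewrite eq_sym => /negPf ->; rewrite mulr0.
Qed.
End FreeModule.

Section Resolutions.
Variable R : pzRingType.

Definition projective (P : lmodType R) : Prop :=
  forall (U V : lmodType R) (g : {linear U -> V}) (h : {linear P -> V}),
    (forall v, exists u, g u = v) ->
    exists h' : {linear P -> U}, forall x, g (h' x) = h x.

Lemma free_projective (X : choiceType) : projective (free_module R X).
Proof.
move=> U V g h /choice[s sK].
exists (free_lift (fun x => s (h (free_gen R x)))) => f.
rewrite [in RHS](free_genE f) /free_lift !linear_sum /=.
by apply: eq_bigr => x _; rewrite !linearZ /= sK.
Qed.

Record proj_resolution (M : lmodType R) := ProjResolution {
  res_obj :> nat -> lmodType R;
  res_d : forall n, {linear res_obj n.+1 -> res_obj n};
  res_aug : {linear res_obj 0%N -> M};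
  res_proj : forall n, projective (res_obj n);
  res_aug_surj : forall x, exists y, res_aug y = x;
  res_exact0 : forall x, res_aug x = 0 <-> exists y, res_d 0 y = x;
  res_exact : forall n x, res_d n x = 0 <-> exists y, res_d n.+1 y = x
}.

(* The standard free resolution: F(K_n) -> K_n, where K_0 = M and K_{n+1} is
   the kernel of the previous surjection. *)
Section FreeResolution.
Variable M : lmodType R.

Definition cover (K : lmodType R) : {linear free_module R K -> K} :=
  free_lift (fun x : K => x).

Fixpoint syzygy (n : nat) : lmodType R :=
  if n is m.+1 then lker (cover (syzygy m)) else M.

Definition free_res_obj (n : nat) : lmodType R := free_module R (syzygy n).

Definition free_res_d (n : nat) (x : free_res_obj n.+1) : free_res_obj n :=
  \val (cover (syzygy n.+1) x).

Fact free_res_d_is_linear n : linear (@free_res_d n).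
Proof. by move=> a x y; rewrite /free_res_d !linearP. Qed.
HB.instance Definition _ n :=
  GRing.isLinear.Build R (free_res_obj n.+1) (free_res_obj n) *:%R
    (@free_res_d n) (@free_res_d_is_linear n).

Lemma cover_surj (K : lmodType R) (x : K) : exists y, cover K y = x.
Proof. by exists (free_gen R x); exact: free_lift_gen. Qed.

Lemma free_res_exact_at n (x : free_res_obj n) :
  cover (syzygy n) x = 0 <-> exists y, free_res_d y = x.
Proof.
split=> [/eqP x0|[y <-]].
  have [y yE] := cover_surj (LKer x0 : syzygy n.+1).
  by exists y; rewrite /free_res_d yE.
by rewrite /free_res_d; case: (cover _ y) => z /= /eqP.
Qed.

Lemma free_res_d0 n (x : free_res_obj n.+1) :
  free_res_d x = 0 <-> cover (syzygy n.+1) x = 0.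
Proof.
split=> [h|h]; first by apply: val_inj; rewrite [LHS]h.
by rewrite /free_res_d h.
Qed.

Definition free_resolution : proj_resolution M :=
  @ProjResolution M free_res_obj (fun n => @free_res_d n) (cover M)
    (fun n => @free_projective (syzygy n)) (@cover_surj M)
    (@free_res_exact_at 0)
    (fun n x => iff_trans (free_res_d0 x) (@free_res_exact_at n.+1 x)).

End FreeResolution.
End Resolutions.

Section Tor.
Variables (R : pzRingType) (M : lmodType R^c) (N : lmodType R).
Local Notation P := (free_resolution M).

Definition tor_chain (n : nat) : zmodType := tensor (P n) N.

(* The differential of P (x)_R N leaving degree n; it is zero for n = 0. *)
Definition tor_d (n : nat) : {additive tor_chain n -> tor_chain n.-1} :=
  match n return {additive tor_chain n -> tor_chain n.-1} with
  | 0%N => \0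
  | m.+1 => @tens_map R _ _ N (res_d P m)
  end.

Definition tor_cycles (n : nat) : zmodType := zker (tor_d n).

Definition tor_boundaries (n : nat) : pred (tor_cycles n) :=
  fun z => `[< exists y : tor_chain n.+1, tor_d n.+1 y = \val z >].

Fact tor_boundaries_closed n : zmod_closed (@tor_boundaries n).
Proof.
split=> [|x y]; rewrite !unfold_in.
  by apply/asboolP; exists 0; rewrite raddf0.
move=> /asboolP[u uE] /asboolP[v vE]; apply/asboolP; exists (u - v).
by rewrite raddfB uE vE.
Qed.
HB.instance Definition _ n :=
  GRing.isZmodClosed.Build (tor_cycles n) (@tor_boundaries n)
    (@tor_boundaries_closed n).

Definition Tor (n : nat) : zmodType := 
  Quotient.quot (GRing.ZmodClosed.clone _ (@tor_boundaries n) _).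
End Tor.

(* Left modules suffice: left and right global dimensions agree for finite
   dimensional algebras, the only ones this is used for. *)
Definition global_dim_le (R : pzRingType) (d : nat) : Prop :=
  forall M : lmodType R, exists P : proj_resolution M,
    forall n, (d < n)%N -> trivial_group (P n).

Definition finite_global_dim (R : pzRingType) : Prop :=
  exists d, global_dim_le R d.

(* A k-algebra is a unital ring with a ring morphism from k to its center.
   MathComp's [algType] and [falgType] exclude the zero algebra, which can occur
   as a corner e A e. *)
Record algebra (k : comPzRingType) := Algebra {
  alg_ring :> pzRingType;
  alg_scalar : {rmorphism k -> alg_ring};
  alg_central : forall a x, alg_scalar a * x = x * alg_scalar a
}.

Fact in_alg_central (k : comNzRingType) (A : algType k) (a : k) (x : A) :
  in_alg A a * x = x * in_alg A a.
Proof. by rewrite /= mulr_algl mulr_algr. Qed.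
Definition algebra_of_algType (k : comNzRingType) (A : algType k) : algebra k :=
  @Algebra k A (in_alg A) (@in_alg_central k A).

Section Enveloping.
Variables (k : comPzRingType) (A : algebra k).
Local Notation "a %:S" := (alg_scalar A a) (at level 2, format "a %:S").

(* A as a left and as a right k-module. *)
Definition kleft : Type := A.
HB.instance Definition _ := GRing.Zmodule.on kleft.
Definition kleft_scale (a : k) (x : kleft) : kleft := a%:S * (x : A).
Fact kleft_scalerA a b x : kleft_scale a (kleft_scale b x) = kleft_scale (a * b) x.
Proof. by rewrite /kleft_scale rmorphM mulrA. Qed.
Fact kleft_scale1 : left_id 1 kleft_scale.
Proof. by move=> x; rewrite /kleft_scale rmorph1 mul1r. Qed.
Fact kleft_scaleDr : right_distributive kleft_scale +%R.
Proof. by move=> a x y; exact: mulrDr. Qed.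
Fact kleft_scaleDl x : {morph kleft_scale^~ x : a b / a + b}.
Proof. by move=> a b; rewrite /kleft_scale rmorphD mulrDl. Qed.
HB.instance Definition _ := GRing.Zmodule_isLmodule.Build k kleft
  kleft_scalerA kleft_scale1 kleft_scaleDr kleft_scaleDl.

Definition kright : Type := A.
HB.instance Definition _ := GRing.Zmodule.on kright.
Definition kright_scale (a : k^c) (x : kright) : kright := (x : A) * (a : k)%:S.
Fact kright_scalerA (a b : k^c) x :
  kright_scale a (kright_scale b x) = kright_scale (a * b) x.
Proof. by rewrite /kright_scale rmorphM mulrA. Qed.
Fact kright_scale1 : left_id (1 : k^c) kright_scale.
Proof. by move=> x; rewrite /kright_scale rmorph1 mulr1. Qed.
Fact kright_scaleDr : right_distributive kright_scale +%R.
Proof. by move=> a x y; exact: mulrDl. Qed.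
Fact kright_scaleDl x : {morph kright_scale^~ x : a b / a + b}.
Proof. by move=> a b; rewrite /kright_scale rmorphD mulrDr. Qed.
HB.instance Definition _ := GRing.Zmodule_isLmodule.Build k^c kright
  kright_scalerA kright_scale1 kright_scaleDr kright_scaleDl.

(* A (x)_k A^op, with (a (x) b) (c (x) d) = a c (x) d b. *)
Definition env : Type := tensor (kright : lmodType k^c) (kleft : lmodType k).
HB.instance Definition _ := GRing.Zmodule.on env.

Definition etens (a b : A) : env := tens (a : kright) (b : kleft).

Lemma etens_balanced : @balanced k kright kleft env etens.
Proof. exact: tens_balanced. Qed.

Lemma env_ind (P : env -> Prop) :
  P 0 -> (forall x y, P x -> P y -> P (x + y)) -> (forall a b, P (etens a b)) ->
  forall x, P x.
Proof. by move=> P0 PD Pt; apply: tens_ind. Qed.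

Definition env_mul_pure (a b : A) : env -> env :=
  @tens_lift k kright kleft env (fun (c : kright) (d : kleft) => etens (a * (c : A)) ((d : A) * b)).

Lemma env_mul_pure_balanced a b :
  @balanced k kright kleft env (fun c d => etens (a * (c : A)) ((d : A) * b)).
Proof.
case: etens_balanced => h1 h2 h3; split=> [n x y|m x y|r m n].
- by rewrite -h1; congr (etens _ _); exact: mulrDr.
- by rewrite -h2; congr (etens _ _); exact: mulrDl.
- have -> : ((r *: n : kleft) : A) * b = (r *: (((n : A) * b : A) : kleft) : kleft).
    exact/esym/mulrA.
  by rewrite -h3; congr (etens _ _); exact: mulrA.
Qed.

Lemma env_mul_pureE a b c d :
  env_mul_pure a b (etens c d) = etens (a * c) (d * b).
Proof. exact: tens_liftE (env_mul_pure_balanced a b). Qed.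

Lemma env_mul_pureD a b : {morph env_mul_pure a b : x y / x + y}.
Proof. by move=> x y; apply: tens_liftD; exact: env_mul_pure_balanced. Qed.

Lemma env_mul_pure0 a b : env_mul_pure a b 0 = 0.
Proof. by apply: (addIr (env_mul_pure a b 0)); rewrite -env_mul_pureD !add0r. Qed.

Lemma env_mul_balanced : @balanced k kright kleft (env -> env) env_mul_pure.
Proof.
case: etens_balanced => h1 h2 h3.
split=> [n x y|m x y|r m n]; apply/funext; elim/env_ind => [|u v IHu IHv|c d];
  rewrite ?addrfctE ?env_mul_pure0 ?addr0 //.
- by rewrite !env_mul_pureD IHu IHv !addrfctE addrACA.
- by rewrite !env_mul_pureE -h1; congr (etens _ _); exact: mulrDl.
- by rewrite !env_mul_pureD IHu IHv !addrfctE addrACA.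
- by rewrite !env_mul_pureE -h2; congr (etens _ _); exact: mulrDr.
- by rewrite !env_mul_pureD IHu IHv.
- rewrite !env_mul_pureE; transitivity (etens ((r : k^c) *: (((m : A) * (c : A) : A) : kright)) ((d : A) * (n : A))).
    congr (etens _ _); rewrite /GRing.scale /= /kright_scale.
    by rewrite -!mulrA alg_central.
  rewrite h3; congr (etens _ _); rewrite /GRing.scale /= /kleft_scale.
  by rewrite !mulrA alg_central.
Qed.

Definition env_mul (x y : env) : env := @tens_lift k kright kleft (env -> env) env_mul_pure x y.

Lemma env_mulE a b c d :
  env_mul (etens a b) (etens c d) = etens (a * c) (d * b).
Proof.
by rewrite /env_mul (tens_liftE _ _ env_mul_balanced) env_mul_pureE.
Qed.

Fact env_mulDl : left_distributive env_mul +%R.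
Proof.
by move=> x y z; rewrite /env_mul (tens_liftD x y env_mul_balanced) addrfctE.
Qed.

Fact env_mulDr : right_distributive env_mul +%R.
Proof.
move=> x y z; elim/env_ind: x => [|u v IHu IHv|c d].
- by rewrite /env_mul (tens_lift_zero env_mul_balanced) /= addr0.
- by rewrite !env_mulDl IHu IHv addrACA.
- by rewrite /env_mul (tens_liftE _ _ env_mul_balanced) env_mul_pureD.
Qed.

Lemma env_mul0l x : env_mul 0 x = 0.
Proof. by apply: (addIr (env_mul 0 x)); rewrite -env_mulDl !add0r. Qed.
Lemma env_mul0r x : env_mul x 0 = 0.
Proof. by apply: (addIr (env_mul x 0)); rewrite -env_mulDr !add0r. Qed.

Fact env_mulA : associative env_mul.
Proof.
move=> x y z; elim/env_ind: x => [|u v IHu IHv|a b].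
- by rewrite !env_mul0l.
- by rewrite !env_mulDl IHu IHv.
elim/env_ind: y => [|u v IHu IHv|c d].
- by rewrite !(env_mul0l, env_mul0r).
- by rewrite !(env_mulDl, env_mulDr) IHu IHv.
elim/env_ind: z => [|u v IHu IHv|e f].
- by rewrite !env_mul0r.
- by rewrite !env_mulDr IHu IHv.
by rewrite !env_mulE !mulrA.
Qed.

Fact env_mul1l : left_id (etens 1 1) env_mul.
Proof.
elim/env_ind => [|u v IHu IHv|e f]; first exact: env_mul0r.
- by rewrite env_mulDr IHu IHv.
- by rewrite env_mulE mul1r mulr1.
Qed.
Fact env_mul1r : right_id (etens 1 1) env_mul.
Proof.
elim/env_ind => [|u v IHu IHv|e f]; first exact: env_mul0l.
- by rewrite env_mulDl IHu IHv.
- by rewrite env_mulE mul1r mulr1.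
Qed.

HB.instance Definition _ := GRing.Zmodule_isPzRing.Build env
  env_mulA env_mul1l env_mul1r env_mulDl env_mulDr.

(* A as a left A^e-module, (a (x) b) x = a x b. *)
Definition env_left : Type := A.
HB.instance Definition _ := GRing.Zmodule.on env_left.

Definition env_lact (u : env) (x : env_left) : env_left :=
  @tens_lift k kright kleft (A -> A) (fun (a : kright) (b : kleft) (x : A) => (a : A) * x * (b : A)) u x.

(* A as a right A^e-module, x (a (x) b) = b x a. *)
Definition env_right : Type := A.
HB.instance Definition _ := GRing.Zmodule.on env_right.

Definition env_ract (u : env^c) (x : env_right) : env_right :=
  @tens_lift k kright kleft (A -> A) (fun (a : kright) (b : kleft) (x : A) => (b : A) * x * (a : A)) (u : env) x.

Lemma env_lact_balanced :
  @balanced k kright kleft (A -> A) (fun a b (x : A) => (a : A) * x * (b : A)).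
Proof.
split=> [n x y|m x y|r m n]; apply/funext => z; rewrite ?addrfctE.
- by rewrite !mulrDl.
- by rewrite mulrDr.
- rewrite /GRing.scale /= /kright_scale /kleft_scale.
  by rewrite -!mulrA; congr (_ * _); rewrite !mulrA alg_central.
Qed.

Lemma env_ract_balanced :
  @balanced k kright kleft (A -> A) (fun a b (x : A) => (b : A) * x * (a : A)).
Proof.
split=> [n x y|m x y|r m n]; apply/funext => z; rewrite ?addrfctE.
- by rewrite mulrDr.
- by rewrite !mulrDl.
- rewrite /GRing.scale /= /kright_scale /kleft_scale.
  by rewrite -!mulrA alg_central !mulrA.
Qed.

Lemma env_lactE a b x : env_lact (etens a b) x = a * (x : A) * b.
Proof. by rewrite /env_lact (tens_liftE _ _ env_lact_balanced). Qed.
Lemma env_ractE a b x : env_ract (etens a b) x = b * (x : A) * a.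
Proof. by rewrite /env_ract (tens_liftE _ _ env_ract_balanced). Qed.

Fact env_lactDl x : {morph env_lact^~ x : u v / u + v}.
Proof. by move=> u v; rewrite /env_lact (tens_liftD _ _ env_lact_balanced). Qed.
Fact env_ractDl x : {morph env_ract^~ x : u v / u + v}.
Proof. by move=> u v; rewrite /env_ract (tens_liftD _ _ env_ract_balanced). Qed.
Lemma env_lact0 x : env_lact 0 x = 0.
Proof. by rewrite /env_lact (tens_lift_zero env_lact_balanced). Qed.
Lemma env_ract0 x : env_ract 0 x = 0.
Proof. by rewrite /env_ract (tens_lift_zero env_ract_balanced). Qed.

Fact env_lactDr : right_distributive env_lact +%R.
Proof.
move=> u x y; elim/env_ind: u => [|u v IHu IHv|a b].
- by rewrite !env_lact0 addr0.
- by rewrite !env_lactDl IHu IHv addrACA.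
- by rewrite !env_lactE mulrDr mulrDl.
Qed.
Fact env_ractDr : right_distributive env_ract +%R.
Proof.
move=> u x y; elim/env_ind: u => [|u v IHu IHv|a b].
- by rewrite !env_ract0 addr0.
- by rewrite !env_ractDl IHu IHv addrACA.
- by rewrite !env_ractE mulrDr mulrDl.
Qed.

Fact env_lactA (u v : env) x : env_lact u (env_lact v x) = env_lact (u * v) x.
Proof.
have l0 w : env_lact w 0 = 0.
  by apply: (addIr (env_lact w 0)); rewrite -env_lactDr !add0r.
elim/env_ind: u => [|u u' IHu IHv|a b].
- by rewrite mul0r !env_lact0.
- by rewrite mulrDl !env_lactDl IHu IHv.
elim/env_ind: v => [|v v' IHu IHv|c d].
- by rewrite mulr0 !env_lact0 l0.
- by rewrite mulrDr !env_lactDl env_lactDr IHu IHv.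
by rewrite [_ * _]env_mulE !env_lactE !mulrA.
Qed.
Fact env_ractA (u v : env^c) x : env_ract u (env_ract v x) = env_ract (u * v) x.
Proof.
have l0 w : env_ract w 0 = 0.
  by apply: (addIr (env_ract w 0)); rewrite -env_ractDr !add0r.
change (u * v) with ((v : env) * (u : env)).
elim/env_ind: u => [|u u' IHu IHv|a b].
- by rewrite mulr0 !env_ract0.
- by rewrite mulrDr !env_ractDl IHu IHv.
elim/env_ind: v => [|v v' IHu IHv|c d].
- by rewrite mul0r !env_ract0 l0.
- by rewrite mulrDl !env_ractDl env_ractDr IHu IHv.
by rewrite [_ * _]env_mulE !env_ractE !mulrA.
Qed.
Fact env_lact1 : left_id 1 env_lact.
Proof. by move=> x; rewrite env_lactE mul1r mulr1. Qed.
Fact env_ract1 : left_id (1 : env^c) env_ract.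
Proof. by move=> x; rewrite env_ractE mul1r mulr1. Qed.

HB.instance Definition _ := GRing.Zmodule_isLmodule.Build env env_left
  env_lactA env_lact1 env_lactDr env_lactDl.
HB.instance Definition _ := GRing.Zmodule_isLmodule.Build env^c env_right
  env_ractA env_ract1 env_ractDr env_ractDl.

Definition HH (n : nat) : zmodType :=
  @Tor env (env_right : lmodType env^c) (env_left : lmodType env) n.

Definition HH_finite : Prop :=
  exists N, forall m, (N < m)%N -> trivial_group (HH m).

Definition verifies_Han : Prop := HH_finite -> finite_global_dim A.
End Enveloping.

Record idem (R : pzRingType) := Idem {
  idem_val :> R;
  idemP : idem_val * idem_val = idem_val
}.

Definition idem1 (R : pzRingType) : idem R := Idem (mulr1 (1 : R)).

Fact idem_compl_subproof (R : pzRingType) (e : idem R) :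
  (1 - idem_val e) * (1 - idem_val e) = 1 - idem_val e.
Proof. by rewrite mulrBl mul1r mulrBr mulr1 idemP subrr subr0. Qed.
Definition idem_compl (R : pzRingType) (e : idem R) : idem R :=
  Idem (idem_compl_subproof e).

(* The additive group e R f. *)
Section Peirce.
Variables (R : pzRingType) (e f : idem R).

Definition in_peirce : pred R := fun x => idem_val e * x * idem_val f == x.
Record peirce := Peirce { peirce_val :> R; _ : in_peirce peirce_val }.
HB.instance Definition _ := [isSub for peirce_val].
HB.instance Definition _ := [Choice of peirce by <:].
Fact in_peirce_closed : zmod_closed in_peirce.
Proof.
split=> [|x y]; rewrite !unfold_in /in_peirce; first by rewrite mulr0 mul0r.
by move=> /eqP xE /eqP yE; rewrite mulrBr mulrBl xE yE.
Qed.
HB.instance Definition _ :=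
  GRing.SubChoice_isSubZmodule.Build _ _ peirce in_peirce_closed.

Lemma peirce_mull (x : peirce) : idem_val e * peirce_val x = peirce_val x.
Proof. by case: x => x /= /eqP <-; rewrite !mulrA idemP. Qed.
Lemma peirce_mulr (x : peirce) : peirce_val x * idem_val f = peirce_val x.
Proof. by case: x => x /= /eqP <-; rewrite -!mulrA idemP. Qed.
End Peirce.

Section PeirceMul.
Variables (R : pzRingType) (e f g : idem R).
Fact peirce_mul_subproof (x : peirce e f) (y : peirce f g) :
  in_peirce e g (peirce_val x * peirce_val y).
Proof. by rewrite /in_peirce mulrA peirce_mull -mulrA peirce_mulr. Qed.
Definition peirce_mul (x : peirce e f) (y : peirce f g) : peirce e g :=
  Peirce (peirce_mul_subproof x y).
End PeirceMul.

(* The corner ring e R e, with unit e. *)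
Section Corner.
Variables (R : pzRingType) (e : idem R).

Definition corner : Type := peirce e e.
HB.instance Definition _ := GRing.Zmodule.on corner.
HB.instance Definition _ := [isSub of corner for @peirce_val R e e].

Fact corner_one_subproof : in_peirce e e e.
Proof. by rewrite /in_peirce !idemP. Qed.
Definition corner_one : corner := Peirce corner_one_subproof.
Definition corner_mul : corner -> corner -> corner := @peirce_mul R e e e.

Fact corner_mulA : associative corner_mul.
Proof. by move=> x y z; apply/val_inj/mulrA. Qed.
Fact corner_mul1 : left_id corner_one corner_mul.
Proof. by move=> x; apply/val_inj/peirce_mull. Qed.
Fact corner_mulr1 : right_id corner_one corner_mul.
Proof. by move=> x; apply/val_inj/peirce_mulr. Qed.
Fact corner_mulDl : left_distributive corner_mul +%R.
Proof. by move=> x y z; apply/val_inj/mulrDl. Qed.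
Fact corner_mulDr : right_distributive corner_mul +%R.
Proof. by move=> x y z; apply/val_inj/mulrDr. Qed.
HB.instance Definition _ := GRing.Zmodule_isPzRing.Build corner
  corner_mulA corner_mul1 corner_mulr1 corner_mulDl corner_mulDr.
End Corner.

(* e R f as a left (e R e)-module and as a right (f R f)-module. *)
Section PeirceModules.
Variables (R : pzRingType) (e f : idem R).

Definition lpeirce : Type := peirce e f.
HB.instance Definition _ := GRing.Zmodule.on lpeirce.
Definition lpeirce_scale (a : corner e) (x : lpeirce) : lpeirce :=
  peirce_mul a x.
Fact lpeirce_scaleA a b x :
  lpeirce_scale a (lpeirce_scale b x) = lpeirce_scale (a * b) x.
Proof. by apply/val_inj/mulrA. Qed.
Fact lpeirce_scale1 : left_id 1 lpeirce_scale.
Proof. by move=> x; apply/val_inj/peirce_mull. Qed.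
Fact lpeirce_scaleDr : right_distributive lpeirce_scale +%R.
Proof. by move=> a x y; apply/val_inj/mulrDr. Qed.
Fact lpeirce_scaleDl x : {morph lpeirce_scale^~ x : a b / a + b}.
Proof. by move=> a b; apply/val_inj/mulrDl. Qed.
HB.instance Definition _ := GRing.Zmodule_isLmodule.Build (corner e) lpeirce
  lpeirce_scaleA lpeirce_scale1 lpeirce_scaleDr lpeirce_scaleDl.

Definition rpeirce : Type := peirce e f.
HB.instance Definition _ := GRing.Zmodule.on rpeirce.
Definition rpeirce_scale (a : (corner f)^c) (x : rpeirce) : rpeirce :=
  peirce_mul x (a : corner f).
Fact rpeirce_scaleA (a b : (corner f)^c) x :
  rpeirce_scale a (rpeirce_scale b x) = rpeirce_scale (a * b) x.
Proof. by apply/val_inj/esym/mulrA. Qed.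
Fact rpeirce_scale1 : left_id (1 : (corner f)^c) rpeirce_scale.
Proof. by move=> x; apply/val_inj/peirce_mulr. Qed.
Fact rpeirce_scaleDr : right_distributive rpeirce_scale +%R.
Proof. by move=> a x y; apply/val_inj/mulrDl. Qed.
Fact rpeirce_scaleDl x : {morph rpeirce_scale^~ x : a b / a + b}.
Proof. by move=> a b; apply/val_inj/mulrDr. Qed.
HB.instance Definition _ := GRing.Zmodule_isLmodule.Build (corner f)^c rpeirce
  rpeirce_scaleA rpeirce_scale1 rpeirce_scaleDr rpeirce_scaleDl.
End PeirceModules.

Definition Tor_corner (R : pzRingType) (g e h : idem R) (m : nat) : zmodType :=
  @Tor (corner e) (rpeirce g e : lmodType (corner e)^c)
       (lpeirce e h : lmodType (corner e)) m.

Definition tensor_corner (R : pzRingType) (g e h : idem R) : zmodType :=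
  @tensor (corner e) (rpeirce g e : lmodType (corner e)^c)
       (lpeirce e h : lmodType (corner e)).

Definition strongly_stratifying (R : pzRingType) (e : idem R) : Prop :=
  let f := idem_compl e in
  [/\ forall m, (0 < m)%N -> trivial_group (Tor_corner (idem1 R) e (idem1 R) m),
      trivial_group (tensor_corner f e f)
    & forall m, (0 < m)%N -> trivial_group (Tor_corner (idem1 R) f (idem1 R) m)].

Section CornerAlgebra.
Variables (k : comPzRingType) (A : algebra k) (e : idem A).

Fact corner_scalar_subproof (a : k) : in_peirce e e (alg_scalar A a * idem_val e).
Proof. by rewrite /in_peirce mulrA -alg_central -!mulrA !idemP. Qed.
Definition corner_scalar (a : k) : corner e := Peirce (corner_scalar_subproof a).

Fact corner_scalar_zmod : zmod_morphism corner_scalar.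
Proof. by move=> a b; apply: val_inj; rewrite /= rmorphB mulrBl. Qed.
Fact corner_scalar_monoid : monoid_morphism corner_scalar.
Proof.
split=> [|a b]; apply: val_inj; first by rewrite /= rmorph1 mul1r.
by rewrite /= rmorphM -!mulrA (mulrA (idem_val e)) -alg_central -mulrA idemP.
Qed.
HB.instance Definition _ :=
  GRing.isZmodMorphism.Build k (corner e) corner_scalar corner_scalar_zmod.
HB.instance Definition _ :=
  GRing.isMonoidMorphism.Build k (corner e) corner_scalar corner_scalar_monoid.

Fact corner_central (a : k) (x : corner e) :
  corner_scalar a * x = x * corner_scalar a.
Proof.
apply: val_inj => /=.
by rewrite -mulrA peirce_mull mulrA -alg_central -mulrA peirce_mulr.
Qed.
Definition corner_algebra : algebra k :=
  @Algebra k (corner e) corner_scalar corner_central.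
End CornerAlgebra.

Record complete_idems (R : pzRingType) (n : nat) := CompleteIdems {
  cidem :> 'I_n -> R;
  cidem_orth : forall i j, cidem i * cidem j = if i == j then cidem i else 0;
  cidem_sum : \sum_i cidem i = 1
}.

Section Chain.
Variables (R : pzRingType) (n : nat) (E : complete_idems R n).

Fact cidem_idem_subproof i : E i * E i = E i.
Proof. by rewrite cidem_orth eqxx. Qed.
Definition cidem_idem i : idem R := Idem (cidem_idem_subproof i).

(* With indices shifted to 0, ..., n-1, tail i is the idempotent f_i. *)
Definition tail_sum (i : nat) : R := \sum_(j < n | (i <= j)%N) E j.

Lemma tail_sumM i j : tail_sum i * tail_sum j = tail_sum (maxn i j).
Proof.
rewrite /tail_sum mulr_suml big_mkcond [RHS]big_mkcond /=.
apply: eq_bigr => a _; rewrite geq_max; case: leqP => //= _.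
rewrite mulr_sumr big_mkcond /= (bigD1 a) //= big1 => [|b ba].
  by rewrite cidem_orth eqxx addr0.
by rewrite cidem_orth eq_sym (negPf ba) if_same.
Qed.

Definition tail (i : nat) : idem R :=
  @Idem R (tail_sum i) (etrans (tail_sumM i i) (congr1 tail_sum (maxnn i))).

Fact tail_corner_subproof i : in_peirce (tail i) (tail i) (tail i.+1).
Proof.
by rewrite /in_peirce /= !tail_sumM (maxn_idPr (leqnSn i)) (maxn_idPl (leqnSn i)).
Qed.
Definition tail_in_corner (i : nat) : corner (tail i) :=
  Peirce (tail_corner_subproof i).
Fact tail_in_corner_idem i : tail_in_corner i * tail_in_corner i = tail_in_corner i.
Proof. by apply/val_inj/(idemP (tail i.+1)). Qed.

(* f_{i+1} as an idempotent of the ring f_i R f_i. *)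
Definition tail_corner (i : nat) : idem (corner (tail i)) :=
  Idem (tail_in_corner_idem i).

Definition strongly_costratifying_chain : Prop :=
  forall i, (i.+1 < n)%N -> strongly_stratifying (tail_corner i).
End Chain.

Definition H_strongly_costratifying_chain (k : comPzRingType) (A : algebra k)
    (n : nat) (E : complete_idems A n) : Prop :=
  strongly_costratifying_chain E /\
  forall i : 'I_n, verifies_Han (corner_algebra (cidem_idem E i)).

Definition finite_dim (k : fieldType) (A : algebra k) : Prop :=
  exists (d : nat) (b : 'I_d -> A),
    forall x, exists c : 'I_d -> k, x = \sum_i alg_scalar A (c i) * b i.

(* Main.v *)
(* Let e be a strongly stratifying idempotent of L, f = 1 - e, A = eLe, B = fLf.
   Since fLe (x)_A eLf = 0, the product fLeLf vanishes, so x |-> fxf is an algebra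
   map pi : L -> B with a non-unital section.

   Hochschild homology: B is a retract of L, hence HH(B) is a summand of HH(L).
   Moreover Le (x)_A eL -> L is injective with cokernel B, and the Tor conditions
   give Tor^{L^e}(L, Le (x)_A eL) = HH(A) and Tor^{L^e}(L, B) = HH(B).  So if HH(L)
   is finite then so is HH(B), and the long exact sequence of Tor^{L^e}(L, -)
   yields the finiteness of HH(A).

   Global dimension: if X is a high enough syzygy of an L-module, then
   0 -> Le (x)_A eX -> X -> B (x)_L X -> 0 is exact, the first term has finite
   projective dimension because A does, and the last one because B-projective
   modules have finite projective dimension over L.

   Hence Han's conjecture passes from A and B to L; for a chain, apply this to
   L = f_i Lambda f_i with A = f_{i+1} Lambda f_{i+1} and B = e_{i+1} Lambda e_{i+1},
   by descending induction on i.

   All the homological statements are of the form "Tor_n vanishes", and are proved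
   by dimension shifting, without connecting homomorphisms. *)

From HB Require Import structures.
From mathcomp Require Import all_boot all_algebra.
From mathcomp Require Import boolp classical_sets functions.
Require Import Defs.

Set Implicit Arguments.
Unset Strict Implicit.
Unset Printing Implicit Defensive.

Import GRing.Theory.
Local Open Scope ring_scope.
Local Open Scope quotient_scope.

(** * Additive maps and exactness of the tensor product *)

(** The inclusion of eLe into L does not preserve 1, so changes of rings run along maps [nuhom], and
    restriction keeps only the part phi(1) X of a module. The two Tor identifications are base
    change: A, as a right A^e-module, is the restriction of L along A^e -> L^e, and the induced
    module L^e (e (x) e) (x)_{A^e} A is Le (x)_A eL. Hence Tor^{A^e}(A, A) is Tor^{L^e}(L, Le (x)_A
    eL) as soon as free L^e-modules restrict to modules acyclic for A. Over a field this acyclicity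
    amounts to Tor^A(Le, eL) = 0, because Tor^{A^e}(A, U (x)_k V) is Tor^A(V, U). The argument for
    pi rests in the same way on Tor^L(B, B) = 0 in positive degrees, which follows from 0 -> Le
    (x)_A eL -> L -> B -> 0 and Be = 0. For global dimensions, syzygies enter because injectivity of
    Le (x)_A eX -> X is inherited from a free module containing X, provided that Tor_1(Le, -)
    vanishes on the e-part of the quotient. *)

Section Additive.
Variables U V W : zmodType.

Definition additive_fun (f : U -> V) := forall x y, f (x + y) = f x + f y.

Variable f : U -> V.
Hypothesis fD : additive_fun f.

Lemma additive_fun0 : f 0 = 0.
Proof. by apply: (addIr (f 0)); rewrite -fD !add0r. Qed.
Lemma additive_funN x : f (- x) = - f x.
Proof. by apply: (addIr (f x)); rewrite -fD !addNr additive_fun0. Qed.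
Lemma additive_funB x y : f (x - y) = f x - f y.
Proof. by rewrite fD additive_funN. Qed.
Lemma additive_fun_sum I (r : seq I) (g : I -> U) :
  f (\sum_(i <- r) g i) = \sum_(i <- r) f (g i).
Proof. by apply: (big_morph f fD additive_fun0). Qed.
End Additive.

Section ZmodQuotient.
Variables (U : zmodType) (P : U -> Prop).
Hypotheses (P0 : P 0) (PB : forall x y, P x -> P y -> P (x - y)).

Let Pb : pred U := fun x => `[< P x >].
Let Pb_closed : zmod_closed Pb.
Proof.
split=> [|x y]; rewrite !unfold_in; first exact/asboolP.
by move=> /asboolP Px /asboolP Py; apply/asboolP/PB.
Qed.
HB.instance Definition _ := GRing.isZmodClosed.Build U Pb Pb_closed.

(** Exactness is proved below by mapping into the quotient by the expected kernel; an additive map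
    with kernel exactly [P] is all that this takes. *)
Lemma zmod_quotient :
  exists (Q : zmodType) (q : U -> Q), additive_fun q /\ forall u, q u = 0 <-> P u.
Proof.
pose I : zmodClosed U := GRing.ZmodClosed.clone _ Pb _.
exists (Quotient.quot I), (\pi_(Quotient.quot I)).
split=> [x y|u]; first by rewrite raddfD.
rewrite -(raddf0 (\pi_(Quotient.quot I))) (rwP eqP) -Quotient.idealrBE subr0.
by rewrite unfold_in; split=> [/asboolP|?] //; apply/asboolP.
Qed.
End ZmodQuotient.

(** Unbundled, and over a bare function [phi], so that one map can be read over several module
    structures on its carrier and [phi] may fail to preserve 1. *)
Definition semilinear_fun (S R : pzRingType) (phi : S -> R) (U : lmodType S)
    (V : lmodType R) (f : U -> V) : Prop :=
  additive_fun f /\ forall a x, f (a *: x) = phi a *: f x.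

Notation rsemilinear_fun phi f := (@semilinear_fun _^c _^c phi _ _ f).
Notation linear_fun f := (@semilinear_fun _ _ id _ _ f).

Section LinearFun.
Variable R : pzRingType.

Lemma linear_fun_linear (U V : lmodType R) (f : {linear U -> V}) : linear_fun f.
Proof. by split=> [x y|a x]; [exact: linearD|exact: linearZ_LR]. Qed.

Lemma linear_fun_id (U : lmodType R) : linear_fun (@id U).
Proof. by split. Qed.

Lemma linear_fun_bundle (U V : lmodType R) (f : U -> V) :
  linear_fun f -> exists g : {linear U -> V}, g =1 f.
Proof.
case=> fD fZ.
have fl : linear f by move=> a x y; rewrite fD fZ.
pose m := GRing.isLinear.Build R U V *:%R f fl.
by pose g : {linear U -> V} := HB.pack f m; exists g.
Qed.

Lemma linear_fun_comp (U V W : lmodType R) (f : U -> V) (g : V -> W) :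
  linear_fun f -> linear_fun g -> linear_fun (g \o f).
Proof. by move=> [fD fZ] [gD gZ]; split=> [x y|a x] /=; rewrite ?fD ?fZ ?gD ?gZ. Qed.
End LinearFun.

Section Tmap.
Variables (S R : pzRingType) (phi : S -> R).
Variables (X : lmodType S^c) (Y : lmodType S) (X' : lmodType R^c) (Y' : lmodType R).

Definition tmap (f : X -> X') (g : Y -> Y') : tensor X Y -> tensor X' Y' :=
  tens_lift (fun x y => tens (f x) (g y)).

Variables (f : X -> X') (g : Y -> Y').
Hypotheses (fP : rsemilinear_fun phi f) (gP : semilinear_fun phi g).

Lemma tmap_balanced : balanced (fun x y => tens (f x) (g y)).
Proof.
case: fP gP => [fD fZ] [gD gZ]; case: (tens_balanced X' Y') => h1 h2 h3.
by split=> [n x y|m x y|r m n]; rewrite ?fD ?gD ?fZ ?gZ ?h1 ?h2 ?h3.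
Qed.

Lemma tmapE x y : tmap f g (tens x y) = tens (f x) (g y).
Proof. exact: (tens_liftE _ _ tmap_balanced). Qed.
Lemma tmapD : additive_fun (tmap f g).
Proof. by move=> x y; exact: (tens_liftD _ _ tmap_balanced). Qed.
End Tmap.

Section TensFacts.
Variables (R : pzRingType) (X : lmodType R^c) (Y : lmodType R).

Lemma tensDl (y : Y) (x x' : X) : tens (x + x') y = tens x y + tens x' y.
Proof. by case: (tens_balanced X Y) => h _ _; exact: h. Qed.
Lemma tensDr (x : X) (y y' : Y) : tens x (y + y') = tens x y + tens x y'.
Proof. by case: (tens_balanced X Y) => _ h _; exact: h. Qed.
Lemma tensZ (r : R) (x : X) (y : Y) : tens ((r : R^c) *: x) y = tens x (r *: y).
Proof. by case: (tens_balanced X Y) => _ _ h; exact: h. Qed.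
Lemma tens0l (y : Y) : tens (0 : X) y = 0.
Proof. exact: (balanced0l (tens_balanced X Y)). Qed.
Lemma tens0r (x : X) : tens x (0 : Y) = 0.
Proof. exact: (balanced0r (tens_balanced X Y)). Qed.

Lemma tens_lift_additive (G : zmodType) (b : X -> Y -> G) :
  balanced b -> additive_fun (tens_lift b).
Proof. by move=> bb x y; rewrite (tens_liftD _ _ bb). Qed.

Lemma tens_ext (G : zmodType) (F H : tensor X Y -> G) :
  additive_fun F -> additive_fun H ->
  (forall x y, F (tens x y) = H (tens x y)) -> F =1 H.
Proof.
move=> FD HD FH; apply: tens_ind => [|u v Fu Fv|x y]; last exact: FH.
- by rewrite !additive_fun0.
- by rewrite FD HD Fu Fv.
Qed.

Lemma tmap_id : tmap (@id X) (@id Y) =1 id.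
Proof.
apply: tens_ext => [|//|x y]; first exact: (@tmapD _ _ id).
by rewrite (@tmapE _ _ id).
Qed.
End TensFacts.

Section TmapComp.
Variables (S R T : pzRingType) (phi : S -> R) (psi : R -> T).
Variables (X : lmodType S^c) (Y : lmodType S) (X' : lmodType R^c) (Y' : lmodType R).
Variables (X'' : lmodType T^c) (Y'' : lmodType T).
Variables (f : X -> X') (g : Y -> Y') (f' : X' -> X'') (g' : Y' -> Y'').
Hypotheses (fP : rsemilinear_fun phi f) (gP : semilinear_fun phi g).
Hypotheses (fP' : rsemilinear_fun psi f') (gP' : semilinear_fun psi g').

Lemma semilinear_fun_comp : semilinear_fun (psi \o phi) (g' \o g).
Proof.
case: gP gP' => [gD gZ] [gD' gZ'].
by split=> [x y|a x] /=; rewrite ?gD ?gD' ?gZ ?gZ'.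
Qed.

Lemma rsemilinear_fun_comp : rsemilinear_fun (psi \o phi) (f' \o f).
Proof.
case: fP fP' => [fD fZ] [fD' fZ'].
by split=> [x y|a x] /=; rewrite ?fD ?fD' ?fZ ?fZ'.
Qed.

Lemma tmap_comp z : tmap f' g' (tmap f g z) = tmap (f' \o f) (g' \o g) z.
Proof.
have cf := rsemilinear_fun_comp; have cg := semilinear_fun_comp.
move: z; apply: tens_ext => [u v|u v|x y].
- by rewrite (tmapD fP gP) (tmapD fP' gP').
- by rewrite (tmapD cf cg).
- by rewrite (tmapE fP gP) (tmapE fP' gP') (tmapE cf cg).
Qed.
End TmapComp.

Lemma eq_tmap (S R : pzRingType) (X : lmodType S^c) (Y : lmodType S)
    (X' : lmodType R^c) (Y' : lmodType R) (f f' : X -> X') (g g' : Y -> Y') :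
  f =1 f' -> g =1 g' -> tmap f g =1 tmap f' g'.
Proof. by move=> /funext -> /funext ->. Qed.

Definition mono (U V : zmodType) (f : U -> V) := forall x, f x = 0 -> x = 0.

Lemma mono_injective (U V : zmodType) (f : U -> V) :
  additive_fun f -> mono f -> injective f.
Proof.
move=> fD fm x y fxy; apply/eqP; rewrite -subr_eq0; apply/eqP/fm.
by rewrite additive_funB // fxy subrr.
Qed.

Record ses (R : pzRingType) (U V W : lmodType R) (i : U -> V) (p : V -> W) : Prop :=
  Ses {
    ses_i : linear_fun i;
    ses_p : linear_fun p;
    ses_mono : mono i;
    ses_pi : forall u, p (i u) = 0;
    ses_ker : forall v, p v = 0 -> exists u, i u = v;
    ses_surj : forall w, exists v, p v = w }.

(** * Right exactness of the tensor product in each variable *)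

Section TensorExact.
Variable R : pzRingType.

Section Right.
Variables (X : lmodType R^c) (U V W : lmodType R) (i : U -> V) (p : V -> W).
Hypothesis e : ses i p.

Lemma tensr_surj (z : tensor X W) : exists t, tmap (@id X) p t = z.
Proof.
elim/tens_ind: z => [|u v [a <-] [b <-]|x w].
- by exists 0; rewrite (additive_fun0 (tmapD (linear_fun_id X) (ses_p e))).
- by exists (a + b); rewrite (tmapD (linear_fun_id X) (ses_p e)).
- have [v <-] := ses_surj e w; exists (tens x v).
  by rewrite (tmapE (linear_fun_id X) (ses_p e)).
Qed.

Lemma tensr_pi (z : tensor X U) : tmap (@id X) p (tmap (@id X) i z) = 0.
Proof.
rewrite (tmap_comp (linear_fun_id X) (ses_i e) (linear_fun_id X) (ses_p e)).
move: z; apply: tens_ext => [|u v|x y]; rewrite ?addr0 //.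
- apply: (@tmapD _ _ id); first exact: linear_fun_id.
  exact: (linear_fun_comp (ses_i e) (ses_p e)).
- rewrite (@tmapE _ _ id); [|exact: linear_fun_id|].
    by rewrite /= (ses_pi e) tens0r.
  exact: (linear_fun_comp (ses_i e) (ses_p e)).
Qed.

(** Any set-theoretic section [s] of [p] suffices: two lifts of an element of W differ by the image
    of some u, so x (x) s(w) is well defined modulo the image of X (x) U. The resulting balanced map
    factors the quotient map [q] through X (x) W, so whatever dies there lies in that image. *)
Lemma tensr_ker (z : tensor X V) :
  tmap (@id X) p z = 0 -> exists t, tmap (@id X) i t = z.
Proof.
have iD := tmapD (linear_fun_id X) (ses_i e).
pose P (z : tensor X V) := exists t, tmap (@id X) i t = z.
have [||Q [q [qD qP]]] := @zmod_quotient _ P.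
- by exists 0; rewrite (additive_fun0 iD).
- by move=> _ _ [a <-] [b <-]; exists (a - b); rewrite (additive_funB iD).
have [s sK] := choice (ses_surj e).
have qeq x v v' : p v = p v' -> q (tens x v) = q (tens x v').
  move=> pv; apply/eqP; rewrite -subr_eq0 -(additive_funB qD).
  have [pD _] := ses_p e.
  have [u iu] : exists u, i u = v - v'.
    by apply: (ses_ker e); rewrite (additive_funB pD) pv subrr.
  apply/eqP/qP; exists (tens x u).
  rewrite (tmapE (linear_fun_id X) (ses_i e)) iu.
  by rewrite (additive_funB (fun v v' => tensDr x v v')).
have bb : balanced (fun x w => q (tens x (s w))).
  have [pD pZ] := ses_p e.
  split=> [n x y|m x y|r m n].
  - by rewrite tensDl qD.
  - by rewrite -qD -tensDr; apply: qeq; rewrite pD !sK.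
  - by rewrite tensZ; apply: qeq; rewrite pZ !sK.
have qE : (fun z => tens_lift (fun x w => q (tens x (s w))) (tmap (@id X) p z)) =1 q.
  apply: tens_ext => [u v|//|x v].
    by rewrite (tmapD (linear_fun_id X) (ses_p e)) (tens_liftD _ _ bb).
  rewrite (tmapE (linear_fun_id X) (ses_p e)) (tens_liftE _ _ bb).
  by apply: qeq; rewrite sK.
by move=> pz; apply/qP; rewrite -qE pz (tens_lift_zero bb).
Qed.
End Right.

Section Left.
Variables (Y : lmodType R) (U V W : lmodType R^c) (i : U -> V) (p : V -> W).
Hypothesis e : ses i p.

Lemma tensl_surj (z : tensor W Y) : exists t, tmap p (@id Y) t = z.
Proof.
have pD := @tmapD R R id _ _ _ _ p id (ses_p e) (linear_fun_id Y).
elim/tens_ind: z => [|u v [a <-] [b <-]|w y].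
- by exists 0; rewrite (additive_fun0 pD).
- by exists (a + b); rewrite pD.
- have [v <-] := ses_surj e w; exists (tens v y).
  by rewrite (@tmapE R R id _ _ _ _ p id (ses_p e) (linear_fun_id Y)).
Qed.

Lemma tensl_pi (z : tensor U Y) : tmap p (@id Y) (tmap i (@id Y) z) = 0.
Proof.
rewrite (@tmap_comp R R R id id _ _ _ _ _ _ i id p id) //;
  [|exact: (ses_i e)|exact: (ses_p e)].
have pi0 : rsemilinear_fun (id : R -> R) (p \o i).
  exact: (linear_fun_comp (ses_i e) (ses_p e)).
move: z; apply: tens_ext => [|u v|x y]; rewrite ?addr0 //.
  exact: (@tmapD R R id).
by rewrite (@tmapE R R id) //= (ses_pi e) tens0l.
Qed.

Lemma tensl_ker (z : tensor V Y) :
  tmap p (@id Y) z = 0 -> exists t, tmap i (@id Y) t = z.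
Proof.
have iD := @tmapD R R id _ _ _ _ i id (ses_i e) (linear_fun_id Y).
have [iE pE] := (@tmapE R R id _ _ _ _ i id (ses_i e) (linear_fun_id Y),
           @tmapE R R id _ _ _ _ p id (ses_p e) (linear_fun_id Y)).
pose P (z : tensor V Y) := exists t, tmap i (@id Y) t = z.
have [||Q [q [qD qP]]] := @zmod_quotient _ P.
- by exists 0; rewrite (additive_fun0 iD).
- by move=> _ _ [a <-] [b <-]; exists (a - b); rewrite (additive_funB iD).
have [s sK] := choice (ses_surj e).
have qeq y v v' : p v = p v' -> q (tens v y) = q (tens v' y).
  move=> pv; apply/eqP; rewrite -subr_eq0 -(additive_funB qD).
  have [pD _] := ses_p e.
  have [u iu] : exists u, i u = v - v'.
    by apply: (ses_ker e); rewrite (additive_funB pD) pv subrr.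
  apply/eqP/qP; exists (tens u y).
  by rewrite iE iu (additive_funB (fun v v' => tensDl y v v')).
have bb : balanced (fun w y => q (tens (s w) y)).
  have [pD pZ] := ses_p e.
  split=> [n x y|m x y|r m n].
  - by rewrite -qD -tensDl; apply: qeq; rewrite pD !sK.
  - by rewrite tensDr qD.
  - by rewrite -tensZ; apply: qeq; rewrite pZ !sK.
have qE : (fun z => tens_lift (fun w y => q (tens (s w) y)) (tmap p (@id Y) z)) =1 q.
  apply: tens_ext => [u v|//|x v].
    rewrite (@tmapD R R id _ _ _ _ p id (ses_p e) (linear_fun_id Y)).
    by rewrite (tens_liftD _ _ bb).
  by rewrite pE (tens_liftE _ _ bb); apply: qeq; rewrite sK.
by move=> pz; apply/qP; rewrite -qE pz (tens_lift_zero bb).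
Qed.
End Left.
End TensorExact.

Section OneSided.
Variable R : pzRingType.

Section Maps.
Variables (X X' : lmodType R^c) (Y Y' : lmodType R) (f : X -> X') (g : Y -> Y').
Hypotheses (fP : rsemilinear_fun id f) (gP : linear_fun g).

Lemma tmaprE x y : tmap (@id X) g (tens x y) = tens x (g y).
Proof. exact: (tmapE (linear_fun_id X) gP). Qed.
Lemma tmaprD : additive_fun (tmap (@id X) g).
Proof. exact: (tmapD (linear_fun_id X) gP). Qed.
Lemma tmaplE x y : tmap f (@id Y) (tens x y) = tens (f x) y.
Proof. exact: (@tmapE R R id _ _ _ _ f id fP (linear_fun_id Y)). Qed.
Lemma tmaplD : additive_fun (tmap f (@id Y)).
Proof. exact: (@tmapD R R id _ _ _ _ f id fP (linear_fun_id Y)). Qed.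
End Maps.

Lemma tmapC (X X' : lmodType R^c) (Y Y' : lmodType R) (f : X -> X') (g : Y -> Y') :
  rsemilinear_fun id f -> linear_fun g -> forall z,
  tmap (@id X') g (tmap f (@id Y) z) = tmap f (@id Y') (tmap (@id X) g z).
Proof.
move=> fP gP; apply: tens_ext => [u v|u v|x y].
- by rewrite (tmaplD fP) (tmaprD gP).
- by rewrite (tmaprD gP) (tmaplD fP).
- by rewrite (tmaplE fP) !(tmaprE gP) (tmaplE fP).
Qed.

Lemma tmapr_comp (X : lmodType R^c) (Y Y' Y'' : lmodType R) (g : Y -> Y')
    (g' : Y' -> Y'') : linear_fun g -> linear_fun g' -> forall z,
  tmap (@id X) g' (tmap (@id X) g z) = tmap (@id X) (g' \o g) z.
Proof.
move=> gP gP' z.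
by rewrite (tmap_comp (linear_fun_id X) gP (linear_fun_id X) gP').
Qed.

Lemma tmapl_comp (Y : lmodType R) (X X' X'' : lmodType R^c) (f : X -> X')
    (f' : X' -> X'') : rsemilinear_fun id f -> rsemilinear_fun id f' -> forall z,
  tmap f' (@id Y) (tmap f (@id Y) z) = tmap (f' \o f) (@id Y) z.
Proof.
move=> fP fP' z; rewrite (@tmap_comp R R R id id _ _ _ _ _ _ f id f' id) //.
Qed.
End OneSided.

Lemma mono_factor (U V V' W : zmodType) (f : U -> V) (g : V -> W)
    (f' : U -> V') (g' : V' -> W) :
  additive_fun g -> (forall x, g (f x) = g' (f' x)) -> mono f' -> mono g' -> mono f.
Proof.
by move=> gD fg fm gm x fx; apply/fm/gm; rewrite -fg fx (additive_fun0 gD).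
Qed.

(** * Exchanging injectivity between the two tensor variables *)

Section NineLemma.
Variable R : pzRingType.
Variables (K E Z : lmodType R^c) (a : K -> E) (b : E -> Z) (ab : ses a b).
Variables (U V W : lmodType R) (i : U -> V) (p : V -> W) (ip : ses i p).

Let aP : rsemilinear_fun (id : R -> R) a := ses_i ab.
Let bP : rsemilinear_fun (id : R -> R) b := ses_p ab.
Let iP := ses_i ip.
Let pP := ses_p ip.

(** Diagram chases in the three by three square of tensor products. With [nine_left] they trade
    injectivity of Z (x) i for injectivity of a (x) W, which is the symmetry of Tor_1(Z, W) when E
    and V are flat enough. *)
Lemma nine_right : mono (tmap (@id E) i) -> mono (tmap a (@id W)) ->
  mono (tmap (@id Z) i).
Proof.
move=> m1 m2 z0; have [z <-] := tensl_surj ab z0.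
rewrite (tmapC bP iP) => /(tensl_ker ab)[w wE].
have : tmap (@id K) p w = 0.
  by apply: m2; rewrite -(tmapC aP pP) wE (tensr_pi ip).
move=> /(tensr_ker ip)[w' wE'].
have -> : z = tmap a (@id U) w'.
  have inj := mono_injective (tmaprD iP) m1.
  apply: inj.
  by rewrite (tmapC aP iP) wE' wE.
by rewrite (tensl_pi ab).
Qed.

Lemma nine_left : mono (tmap a (@id V)) -> mono (tmap (@id Z) i) ->
  mono (tmap a (@id W)).
Proof.
move=> m1 m2 z0; have [z <-] := tensr_surj ip z0.
rewrite -(tmapC aP pP) => /(tensr_ker ip)[w wE].
have : tmap b (@id U) w = 0.
  by apply: m2; rewrite (tmapC bP iP) wE (tensl_pi ab).
move=> /(tensl_ker ab)[w' wE'].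
have -> : z = tmap (@id K) i w'.
  have inj := mono_injective (tmaplD aP) m1; apply: inj.
  by rewrite -(tmapC aP iP) wE' wE.
by rewrite (tensr_pi ip).
Qed.
End NineLemma.

(* A form of "U' is a summand of a direct sum of copies of U" that is preserved by
   every additive functor used below. *)
Definition local_retract (R : pzRingType) (U' U : lmodType R) : Prop :=
  exists (I : choiceType) (j : I -> U -> U') (q : I -> U' -> U),
    [/\ forall i, linear_fun (j i), forall i, linear_fun (q i)
      & forall y, exists s : seq I, forall t, uniq t -> {subset s <= t} ->
          y = \sum_(i <- t) j i (q i y)].

Lemma retract_local (R : pzRingType) (U' U : lmodType R) (j : U -> U') (q : U' -> U) :
  linear_fun j -> linear_fun q -> cancel q j -> local_retract U' U.
Proof.
move=> jP qP jqK; exists unit, (fun=> j), (fun=> q); split=> // y.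
exists [:: tt] => t ut /(_ tt (mem_head _ _)) tt_t.
by rewrite (bigD1_seq tt) //= jqK big1 ?addr0 // => -[].
Qed.

Lemma free_local (R : pzRingType) (I : choiceType) :
  local_retract (free_module R I) R^o.
Proof.
exists I, (fun i (r : R^o) => (r : R) *: free_gen R i), (fun i (f : free_module R I) => f i).
split=> [i|i|f].
- by split=> [x y|a x]; rewrite ?scalerDl ?scalerA.
- by split.
exists (supp f) => t ut st; rewrite {1}(free_genE f).
by apply: free_liftE => // x /mem_supp/st.
Qed.

Section LocalMono.
Variable R : pzRingType.

Lemma local_mono_left (X' X : lmodType R^c) (Y' Y : lmodType R) (g : Y' -> Y) :
  local_retract X' X -> linear_fun g -> mono (tmap (@id X) g) ->
  mono (tmap (@id X') g).
Proof.
move=> [I [j [q [jP qP jqE]]]] gP gm z gz0.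
have jqP i : rsemilinear_fun (id : R -> R) (j i \o q i).
  exact: linear_fun_comp (qP i) (jP i).
(* A sum of tensors is recovered on the union of the lists that serve its terms; this is why
   [local_retract] admits every larger duplicate-free list. *)
have [s sP] : exists s : seq I, forall t, uniq t -> {subset s <= t} ->
    z = \sum_(i <- t) tmap (j i \o q i) (@id Y') z.
  elim/tens_ind: z {gz0} => [|u v [s1 E1] [s2 E2]|x y].
  - by exists [::] => t _ _; rewrite big1 // => i _; exact: (additive_fun0 (tmaplD (jqP i))).
  - exists (s1 ++ s2) => t ut st.
    have h1 : {subset s1 <= t} by move=> x xs; apply: st; rewrite mem_cat xs.
    have h2 : {subset s2 <= t} by move=> x xs; apply: st; rewrite mem_cat xs orbT.
    rewrite {1}(E1 t ut h1) {1}(E2 t ut h2).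
    by rewrite -big_split; apply: eq_bigr => i _; rewrite (tmaplD (jqP i)).
  - have [s sE] := jqE x; exists s => t ut st; rewrite {1}(sE t ut st).
    rewrite (additive_fun_sum (fun a b => tensDl y a b)).
    by apply: eq_bigr => i _; rewrite (tmaplE (jqP i)).
rewrite (sP (undup s)) ?undup_uniq // => [|x]; last by rewrite mem_undup.
rewrite big1 // => i _.
rewrite -(tmapl_comp (qP i) (jP i)).
have -> : tmap (q i) (@id Y') z = 0.
  by apply: gm; rewrite (tmapC (qP i) gP) gz0 (additive_fun0 (tmaplD (qP i))).
exact: (additive_fun0 (tmaplD (jP i))).
Qed.

Lemma local_mono_right (X' X : lmodType R^c) (Y' Y : lmodType R) (f : X' -> X) :
  local_retract Y' Y -> rsemilinear_fun id f -> mono (tmap f (@id Y)) ->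
  mono (tmap f (@id Y')).
Proof.
move=> [I [j [q [jP qP jqE]]]] fP fm z fz0.
have jqP i : linear_fun (j i \o q i) by exact: linear_fun_comp (qP i) (jP i).
have [s sP] : exists s : seq I, forall t, uniq t -> {subset s <= t} ->
    z = \sum_(i <- t) tmap (@id X') (j i \o q i) z.
  elim/tens_ind: z {fz0} => [|u v [s1 E1] [s2 E2]|x y].
  - by exists [::] => t _ _; rewrite big1 // => i _; exact: (additive_fun0 (tmaprD (jqP i))).
  - exists (s1 ++ s2) => t ut st.
    have h1 : {subset s1 <= t} by move=> x xs; apply: st; rewrite mem_cat xs.
    have h2 : {subset s2 <= t} by move=> x xs; apply: st; rewrite mem_cat xs orbT.
    rewrite {1}(E1 t ut h1) {1}(E2 t ut h2).
    by rewrite -big_split; apply: eq_bigr => i _; rewrite (tmaprD (jqP i)).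
  - have [s sE] := jqE y; exists s => t ut st; rewrite {1}(sE t ut st).
    rewrite (additive_fun_sum (fun a b => tensDr x a b)).
    by apply: eq_bigr => i _; rewrite (tmaprE (jqP i)).
rewrite (sP (undup s)) ?undup_uniq // => [|x]; last by rewrite mem_undup.
rewrite big1 // => i _; rewrite -(tmapr_comp (qP i) (jP i)).
have -> : tmap (@id X') (q i) z = 0.
  by apply: fm; rewrite -(tmapC fP (qP i)) fz0 (additive_fun0 (tmaprD (qP i))).
exact: (additive_fun0 (tmaprD (jP i))).
Qed.

Lemma regular_mono_left (Y' Y : lmodType R) (g : Y' -> Y) :
  linear_fun g -> mono g -> mono (tmap (@id (R^c)^o) g).
Proof.
move=> gP gm z gz0.
have bal (V : lmodType R) : balanced (fun (r : (R^c)^o) (y : V) => (r : R) *: y).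
  by split=> [n x y|m x y|r m n]; rewrite ?scalerDl ?scalerDr ?scalerA.
pose mu (V : lmodType R) := tens_lift (fun (r : (R^c)^o) (y : V) => (r : R) *: y).
have muK : (fun z => tens (1 : (R^c)^o) (mu Y' z)) =1 id.
  apply: tens_ext => [u v|//|r y]; first by rewrite /mu (tens_liftD _ _ (bal _)) tensDr.
  rewrite /mu (tens_liftE _ _ (bal _)) -tensZ; congr tens.
  exact: (@mulr1 R^c).
have muC : (fun z => mu Y (tmap (@id _) g z)) =1 (fun z => g (mu Y' z)).
  have [gD gZ] := gP.
  apply: tens_ext => [u v|u v|r y].
  - by rewrite (tmaprD gP) /mu (tens_liftD _ _ (bal _)).
  - by rewrite /mu (tens_liftD _ _ (bal _)) gD.
  - by rewrite (tmaprE gP) /mu !(tens_liftE _ _ (bal _)) gZ.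
have : mu Y' z = 0.
  by apply: gm; rewrite -muC gz0 /mu (additive_fun0 (tens_lift_additive (bal _))).
by move=> mz; have := muK z; rewrite /= mz tens0r => <-.
Qed.

Lemma regular_mono_right (X' X : lmodType R^c) (f : X' -> X) :
  rsemilinear_fun id f -> mono f -> mono (tmap f (@id R^o)).
Proof.
move=> fP fm z fz0.
have bal (V : lmodType R^c) : balanced (fun (x : V) (r : R^o) => (r : R^c) *: x).
  split=> [n x y|m x y|r m n]; rewrite ?scalerDl ?scalerDr ?scalerA //.
pose mu (V : lmodType R^c) := tens_lift (fun (x : V) (r : R^o) => (r : R^c) *: x).
have muK : (fun z => tens (mu X' z) (1 : R^o)) =1 id.
  apply: tens_ext => [u v|//|y r]; first by rewrite /mu (tens_liftD _ _ (bal _)) tensDl.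
  rewrite /mu (tens_liftE _ _ (bal _)) tensZ; congr tens.
  exact: (@mulr1 R).
have muC : (fun z => mu X (tmap f (@id _) z)) =1 (fun z => f (mu X' z)).
  have [fD fZ] := fP.
  apply: tens_ext => [u v|u v|y r].
  - by rewrite (tmaplD fP) /mu (tens_liftD _ _ (bal _)).
  - by rewrite /mu (tens_liftD _ _ (bal _)) fD.
  - by rewrite (tmaplE fP) /mu !(tens_liftE _ _ (bal _)) fZ.
have : mu X' z = 0.
  by apply: fm; rewrite -muC fz0 /mu (additive_fun0 (tens_lift_additive (bal _))).
by move=> mz; have := muK z; rewrite /= mz tens0l => <-.
Qed.

Lemma free_mono_left (I : choiceType) (Y' Y : lmodType R) (g : Y' -> Y) :
  linear_fun g -> mono g -> mono (tmap (@id (free_module R^c I)) g).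
Proof.
move=> gP gm; apply: (local_mono_left (free_local _ _) gP).
exact: (regular_mono_left gP gm).
Qed.

Lemma free_mono_right (I : choiceType) (X' X : lmodType R^c) (f : X' -> X) :
  rsemilinear_fun id f -> mono f -> mono (tmap f (@id (free_module R I))).
Proof.
move=> fP fm; apply: (local_mono_right (free_local _ _) fP).
exact: (regular_mono_right fP fm).
Qed.
End LocalMono.

(** * Vanishing of Tor *)

Definition Omega (R : pzRingType) (X : lmodType R) : lmodType R := lker (cover X).
Definition Omega_incl (R : pzRingType) (X : lmodType R) :
  Omega X -> free_module R X := @lker_val _ _ _ (cover X).

Lemma ses_lker (R : pzRingType) (U V : lmodType R) (f : {linear U -> V}) :
  (forall v, exists u, f u = v) -> ses (@lker_val _ _ _ f) f.
Proof.
move=> fs; split=> //.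
- exact: linear_fun_linear.
- by move=> x x0; apply: val_inj.
- by case=> x /= /eqP.
- by move=> v /eqP v0; exists (LKer v0).
Qed.

Lemma ses_cover (R : pzRingType) (X : lmodType R) : ses (@Omega_incl R X) (cover X).
Proof. by apply: ses_lker; exact: cover_surj. Qed.

(* [TorV n X Y] says that Tor_{n+1}(X, Y) vanishes. *)
Fixpoint TorV (R : pzRingType) (n : nat) (X : lmodType R^c) (Y : lmodType R) : Prop :=
  if n is m.+1 then TorV m (Omega X) Y
  else mono (tmap (@Omega_incl _ X) (@id Y)).

Section TorVanishing.
Variable R : pzRingType.
Implicit Types (X : lmodType R^c) (Y : lmodType R).

Let inclP X : rsemilinear_fun (id : R -> R) (@Omega_incl _ X).
Proof. exact: (ses_i (ses_cover X)). Qed.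

Lemma TorV_free_right n X (I : choiceType) : TorV n X (free_module R I).
Proof.
elim: n X => [|n IH] X; last exact: (IH (Omega X)).
by apply: free_mono_right (inclP X) _; exact: (ses_mono (ses_cover X)).
Qed.

Section SecondVariable.
Variables (U V W : lmodType R) (i : U -> V) (p : V -> W) (e : ses i p).
Let iP := ses_i e.
Let im := ses_mono e.

(** The piece Tor_1(X, W) -> X (x) U -> X (x) V of the long exact sequence, available because the
    free cover of X is flat. *)
Lemma TorV0_mono_right X : TorV 0 X W -> mono (tmap (@id X) i).
Proof.
move=> h; apply: (nine_right (ses_cover X) e) => //.
exact: free_mono_left.
Qed.

Lemma mono_TorV0_right X : mono (tmap (@id X) i) -> TorV 0 X V -> TorV 0 X W.
Proof. by move=> h1 h2; exact: (nine_left (ses_cover X) e). Qed.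

(** Vanishing form of the exactness of Tor_{n+2}(X, V) -> Tor_{n+2}(X, W) -> Tor_{n+1}(X, U).
    Replacing X by its syzygy lowers every degree, so only n = 0 needs an argument. *)
Lemma TorV_ses_right n X : TorV n.+1 X V -> TorV n X U -> TorV n.+1 X W.
Proof.
elim: n X => [|n IH] X; last exact: (IH (Omega X)).
move=> hV hU; apply: (@mono_TorV0_right (Omega X)) => //.
have iX := inclP X.
apply: (mono_factor (tmaplD iX) _ hU (free_mono_left iP im)) => x.
by rewrite (tmapC iX iP).
Qed.

(** Likewise for Tor_{n+2}(X, W) -> Tor_{n+1}(X, U) -> Tor_{n+1}(X, V). *)
Lemma TorV_ses_left n X : TorV n X V -> TorV n.+1 X W -> TorV n X U.
Proof.
elim: n X => [|n IH] X; last exact: (IH (Omega X)).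
move=> hV /(@TorV0_mono_right (Omega X)) hU.
apply: (mono_factor (tmaprD iP) _ hU hV) => x.
by rewrite (tmapC (inclP X) iP).
Qed.
End SecondVariable.

(** [TorV] resolves its first argument; that syzygies may equally be taken in the second replaces
    the comparison of two resolutions. *)
Lemma TorV_shift n X Y : TorV n.+1 X Y <-> TorV n X (Omega Y).
Proof.
split=> h; first exact: (TorV_ses_left (ses_cover Y) (TorV_free_right _ _ _) h).
exact: (TorV_ses_right (ses_cover Y) (TorV_free_right _ _ _) h).
Qed.

Section FirstVariable.
Variables (K E Z : lmodType R^c) (a : K -> E) (b : E -> Z) (e : ses a b).
Let aP : rsemilinear_fun (id : R -> R) a := ses_i e.
Let am := ses_mono e.

Lemma TorV0_mono_left Y : TorV 0 Z Y -> mono (tmap a (@id Y)).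
Proof.
move=> /(TorV0_mono_right (ses_cover Y)) h.
apply: (nine_left e (ses_cover Y)) h; exact: free_mono_right.
Qed.

Lemma mono_TorV0_left Y : mono (tmap a (@id Y)) -> TorV 0 E Y -> TorV 0 Z Y.
Proof.
move=> h /(TorV0_mono_right (ses_cover Y)) hE.
apply: (mono_TorV0_right (ses_cover Y)) (TorV_free_right _ _ _).
exact: (nine_right e (ses_cover Y)).
Qed.

(** Dimension shifting along a sequence whose middle term is only Tor-acyclic; restrictions of free
    modules will be of this kind. The induction takes syzygies of Y, which leaves the given sequence
    untouched. *)
Lemma TorV_acyclic_shift n Y :
  (forall j, TorV j E Y) -> (TorV n.+1 Z Y <-> TorV n K Y).
Proof.
elim: n Y => [|n IH] Y hE; last first.
  rewrite TorV_shift (TorV_shift n K); apply: IH => j.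
  by apply/TorV_shift.
have hEY : mono (tmap (@id E) (@Omega_incl _ Y)).
  exact: (TorV0_mono_right (ses_cover Y)).
have iP : linear_fun (@Omega_incl _ Y) := ses_i (ses_cover Y).
rewrite TorV_shift; split=> [/TorV0_mono_left h|].
  apply: (mono_TorV0_right (ses_cover Y)) (TorV_free_right _ _ _).
  apply: (mono_factor (tmaplD aP) _ h hEY) => x.
  by rewrite (tmapC aP iP).
move=> /(TorV0_mono_right (ses_cover Y)) h.
apply: mono_TorV0_left; last exact/TorV_shift/hE.
apply: (mono_factor (tmaprD iP) _ h); last first.
  exact: (free_mono_right (I := Y) aP am).
by move=> x; rewrite (tmapC aP iP).
Qed.
End FirstVariable.

Lemma TorV_local_right n X Y' Y : local_retract Y' Y -> TorV n X Y -> TorV n X Y'.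
Proof.
move=> lr; elim: n X => [|n IH] X; last exact: (IH (Omega X)).
exact: (local_mono_right lr (inclP X)).
Qed.

Lemma TorV_local_left n X' X Y : local_retract X' X -> TorV n X Y -> TorV n X' Y.
Proof.
move=> lr; elim: n Y => [|n IH] Y; last by rewrite !TorV_shift; exact: IH.
move=> /(TorV0_mono_right (ses_cover Y)) h.
apply: (mono_TorV0_right (ses_cover Y)) (TorV_free_right _ _ _).
by apply: local_mono_left lr _ h; exact: (ses_i (ses_cover Y)).
Qed.

Lemma TorV_regular_left n Y : TorV n (R^c)^o Y.
Proof.
elim: n Y => [|n IH] Y; last by rewrite TorV_shift.
apply: (mono_TorV0_right (ses_cover Y)) (TorV_free_right _ _ _).
exact: (regular_mono_left (ses_i (ses_cover Y)) (ses_mono (ses_cover Y))).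
Qed.

Lemma TorV_regular_right n X : TorV n X R^o.
Proof.
elim: n X => [|n IH] X; last exact: (IH (Omega X)).
by apply: regular_mono_right (inclP X) _; exact: (ses_mono (ses_cover X)).
Qed.
End TorVanishing.

(** * Tor and change of rings *)

Section TorLink.
Variables (R : pzRingType) (X : lmodType R^c) (Y : lmodType R).

Lemma trivial_Tor n :
  trivial_group (Tor X Y n) <-> forall z : tor_cycles X Y n, tor_boundaries z.
Proof.
pose I := GRing.ZmodClosed.clone _ (@tor_boundaries R X Y n) _.
have piP z : \pi_(Quotient.quot I) z = 0 <-> tor_boundaries z.
  by rewrite -(raddf0 (\pi_(Quotient.quot I))) (rwP eqP) -Quotient.idealrBE subr0.
split=> [h z|h x]; first exact/piP/h.
by rewrite -[x]reprK; exact/piP/h.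
Qed.

Lemma syzygy_Omega (M : lmodType R^c) n : syzygy (Omega M) n = Omega (syzygy M n).
Proof. by elim: n => //= n ->. Qed.

Lemma TorV_syzygy n (M : lmodType R^c) : TorV n M Y <-> TorV 0 (syzygy M n) Y.
Proof.
elim: n M => [|n IH] M //; have := IH (Omega M).
by rewrite syzygy_Omega.
Qed.

Let cov n : {linear free_module R^c (syzygy X n) -> syzygy X n} := cover (syzygy X n).
Let inc n : syzygy X n.+1 -> free_module R^c (syzygy X n) := @Omega_incl _ (syzygy X n).
Let tcov n : tensor (free_module R^c (syzygy X n)) Y -> tensor (syzygy X n) Y :=
  tmap (cov n) (@id Y).
Let tinc n : tensor (syzygy X n.+1) Y -> tensor (free_module R^c (syzygy X n)) Y :=
  tmap (@inc n) (@id Y).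

Let e n : ses (@inc n) (cov n). Proof. exact: ses_cover. Qed.

Let tor_dE n z : tor_d X Y n.+1 z = tinc (tcov z).
Proof. exact: (esym (tmapl_comp (ses_p (e n.+1)) (ses_i (e n)) z)). Qed.

Let tcov_tinc n z : tcov (@tinc n z) = 0. Proof. exact: tensl_pi (e n) z. Qed.
Let tcov_ker n (z : tensor (free_module R^c (syzygy X n)) Y) :
  tcov z = 0 -> exists w, tinc w = z.
Proof. exact: tensl_ker (e n) z. Qed.
Let tcov_surj n (w : tensor (syzygy X n) Y) : exists z, tcov z = w.
Proof. exact: tensl_surj (e n) w. Qed.

(** The differential leaving degree n + 1 factors through the syzygy of index n + 1. After
    tensoring, the first factor [tcov] is surjective with kernel the boundaries, so the homology in
    degree n + 1 is the kernel of the second factor [tinc]. *)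
Let Tor_mono n : trivial_group (Tor X Y n.+1) <-> mono (@tinc n).
Proof.
rewrite trivial_Tor; split=> [h w w0|h [z z0]].
  have [z zE] := tcov_surj w.
  have z0 : in_ker (tor_d X Y n.+1) z by apply/eqP; rewrite tor_dE zE.
  have /asboolP[y yE] := h (ZKer z0).
  by rewrite -zE -[z]/(zker_val (ZKer z0)) -[zker_val _]yE tor_dE tcov_tinc.
have := eqP z0; rewrite tor_dE => /h /tcov_ker[w wE].
have [y yE] := tcov_surj w.
by apply/asboolP; exists y; rewrite tor_dE yE.
Qed.

Lemma Tor_TorV n : trivial_group (Tor X Y n.+1) <-> TorV n X Y.
Proof. by rewrite Tor_mono TorV_syzygy. Qed.
End TorLink.

(** Ring morphisms that may send 1 to a proper idempotent, as the inclusion of a corner does. *)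
Record nuhom (S R : pzRingType) := NuHom {
  nu_fun :> S -> R;
  nuD : additive_fun nu_fun;
  nuM : forall x y, nu_fun (x * y) = nu_fun x * nu_fun y
}.

Definition nu_conv (S R : pzRingType) (phi : nuhom S R) : nuhom S^c R^c :=
  @NuHom S^c R^c phi (nuD phi) (fun x y => nuM phi y x).

(* Restriction along a ring homomorphism phi that need not preserve 1: the
   module phi(1) X. *)
Section Restriction.
Variables (S R : pzRingType) (phi : nuhom S R) (X : lmodType R).

Definition in_res : pred X := fun x => phi 1 *: x == x.
Record res := Res { res_val :> X; _ : in_res res_val }.
HB.instance Definition _ := [isSub for res_val].
HB.instance Definition _ := [Choice of res by <:].
Fact in_res_closed : zmod_closed in_res.
Proof.
split=> [|x y]; rewrite !unfold_in /in_res ?scaler0 // => /eqP xE /eqP yE.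
by rewrite scalerBr xE yE.
Qed.
HB.instance Definition _ :=
  GRing.SubChoice_isSubZmodule.Build _ _ res in_res_closed.

Lemma res_valP (x : res) : phi 1 *: (res_val x) = res_val x.
Proof. by case: x => x /= /eqP. Qed.

Fact res_scale_subproof (a : S) (x : res) : in_res (phi a *: res_val x).
Proof. by rewrite /in_res scalerA -nuM mul1r. Qed.
Definition res_scale (a : S) (x : res) : res := Res (res_scale_subproof a x).
Fact res_scaleA a b x : res_scale a (res_scale b x) = res_scale (a * b) x.
Proof. by apply: val_inj; rewrite /= scalerA nuM. Qed.
Fact res_scale1 : left_id 1 res_scale.
Proof. by move=> x; apply: val_inj; exact: res_valP. Qed.
Fact res_scaleDr : right_distributive res_scale +%R.
Proof. by move=> a x y; apply: val_inj; exact: scalerDr. Qed.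
Fact res_scaleDl x : {morph res_scale^~ x : a b / a + b}.
Proof. by move=> a b; apply: val_inj; rewrite /= nuD scalerDl. Qed.
HB.instance Definition _ := GRing.Zmodule_isLmodule.Build S res
  res_scaleA res_scale1 res_scaleDr res_scaleDl.

Lemma res_val_semilinear : semilinear_fun phi res_val.
Proof. by split. Qed.

Fact to_res_subproof (x : X) : in_res (phi 1 *: x).
Proof. by rewrite /in_res scalerA -nuM mul1r. Qed.
Definition to_res (x : X) : res := Res (to_res_subproof x).

Lemma to_resK (x : res) : to_res (res_val x) = x.
Proof. by apply: val_inj; exact: res_valP. Qed.
Lemma to_resD : additive_fun to_res.
Proof. by move=> x y; apply: val_inj; exact: scalerDr. Qed.
Lemma to_resZ a x : to_res (phi a *: x) = a *: to_res x.
Proof. by apply: val_inj; rewrite /= !scalerA -!nuM mul1r mulr1. Qed.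
End Restriction.

Section ResMap.
Variables (S R : pzRingType) (phi : nuhom S R).

Definition res_map (X Y : lmodType R) (f : X -> Y) (x : res phi X) : res phi Y :=
  to_res phi (f (res_val x)).

Lemma res_mapE (X Y : lmodType R) (f : X -> Y) (x : res phi X) :
  linear_fun f -> res_val (res_map f x) = f (res_val x).
Proof. by case=> _ fZ; rewrite /= -fZ res_valP. Qed.

Lemma res_map_linear (X Y : lmodType R) (f : X -> Y) :
  linear_fun f -> linear_fun (res_map f).
Proof.
move=> [fD fZ]; split=> [x y|a x]; rewrite /res_map -?to_resD -?fD //.
by rewrite -to_resZ -fZ.
Qed.

Lemma res_ses (X Y Z : lmodType R) (i : X -> Y) (p : Y -> Z) :
  ses i p -> ses (res_map i) (res_map p).
Proof.
move=> e; have [iP pP] := (ses_i e, ses_p e); split.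
- exact: res_map_linear.
- exact: res_map_linear.
- move=> x /(congr1 (@res_val _ _ phi _)); rewrite res_mapE // => /(ses_mono e) x0.
  exact: val_inj.
- by move=> x; apply: val_inj; rewrite [LHS]res_mapE // res_mapE // (ses_pi e).
- move=> y /(congr1 (@res_val _ _ phi _)); rewrite res_mapE // => /(ses_ker e)[x xE].
  exists (to_res phi x); apply: val_inj; rewrite [LHS]res_mapE //=.
  by have [_ iZ] := iP; rewrite iZ xE res_valP.
- move=> z; have [y yE] := ses_surj e z.
  exists (to_res phi y); apply: val_inj; rewrite [LHS]res_mapE //=.
  by have [_ pZ] := pP; rewrite pZ yE res_valP.
Qed.

Lemma res_local (X Y : lmodType R) :
  local_retract X Y -> local_retract (res phi X) (res phi Y).
Proof.
move=> [I [j [q [jP qP jqE]]]].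
exists I, (fun i => res_map (j i)), (fun i => res_map (q i)).
split=> [i|i|y]; try exact: res_map_linear.
have [s sE] := jqE (res_val y); exists s => t ut st; apply: val_inj.
have [vD _] := res_val_semilinear phi X.
rewrite [LHS](sE t ut st) [RHS](additive_fun_sum vD).
by apply: eq_bigr => i _; rewrite [RHS]res_mapE // res_mapE.
Qed.
End ResMap.

Lemma free_ext (S R : pzRingType) (phi : S -> R) (I : choiceType) (V : lmodType R)
    (f g : free_module S I -> V) :
  semilinear_fun phi f -> semilinear_fun phi g ->
  (forall i, f (free_gen S i) = g (free_gen S i)) -> f =1 g.
Proof.
move=> [fD fZ] [gD gZ] fg x; rewrite (free_genE x) /free_lift.
rewrite (additive_fun_sum fD) (additive_fun_sum gD).
by apply: eq_bigr => i _; rewrite fZ gZ fg.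
Qed.

Lemma cover_gen (R : pzRingType) (K : lmodType R) (x : K) :
  cover K (free_gen R x) = x.
Proof. exact: free_lift_gen. Qed.

Section FreeFunctor.
Variables (S R : pzRingType) (phi : nuhom S R).
Variables (X : lmodType S) (X' : lmodType R) (s : X -> X').
Hypothesis sP : semilinear_fun phi s.

(** A free S-module only lifts maps into S-modules, so the target is phi(1) times the free R-module,
    and a generator x goes to phi(1) [s x]. *)
Definition free_map (f : free_module S X) : free_module R X' :=
  res_val (free_lift (fun x : X => to_res phi (free_gen R (s x))) f).

Lemma free_map_semilinear : semilinear_fun phi free_map.
Proof. by split=> [x y|a x]; rewrite /free_map ?linearD ?linearZ. Qed.

Lemma free_map_gen x : free_map (free_gen S x) = phi 1 *: free_gen R (s x).
Proof. by rewrite /free_map free_lift_gen. Qed.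

Lemma cover_free_map f : cover X' (free_map f) = s (cover X f).
Proof.
have [cD cZ] := linear_fun_linear (cover X).
have [cD' cZ'] := linear_fun_linear (cover X').
have [fD fZ] := free_map_semilinear; have [sD sZ] := sP.
move: f; apply: (free_ext (phi := phi)) => [||x].
- by split=> [x y|a x]; rewrite ?fD ?cD' ?fZ ?cZ'.
- by split=> [x y|a x]; rewrite ?cD ?sD ?cZ ?sZ.
- by rewrite free_map_gen cZ' !cover_gen -sZ scale1r.
Qed.

Fact Omega_map_subproof (f : Omega X) : in_lker (cover X') (free_map (Omega_incl f)).
Proof.
case: f => f /= /eqP f0; rewrite /in_lker cover_free_map f0.
by rewrite (additive_fun0 (proj1 sP)).
Qed.
Definition Omega_map (f : Omega X) : Omega X' := LKer (Omega_map_subproof f).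

Lemma Omega_map_semilinear : semilinear_fun phi Omega_map.
Proof.
have [fD fZ] := free_map_semilinear.
by split=> [x y|a x]; apply: val_inj; rewrite /= ?fD ?fZ.
Qed.
End FreeFunctor.

Section Retract.
Variables (S R : pzRingType) (phi : nuhom S R) (psi : nuhom R S).
Hypothesis psi_phi : cancel phi psi.

Lemma free_map_retract (X : lmodType S) (X' : lmodType R) (s : X -> X') (r : X' -> X) :
  cancel s r -> cancel (free_map phi s) (free_map psi r).
Proof.
move=> rs; have [fD fZ] := free_map_semilinear phi s.
have [gD gZ] := free_map_semilinear psi r.
apply: (free_ext (phi := id)) => [||x].
- by split=> [x y|a x]; rewrite ?fD ?gD ?fZ ?gZ ?psi_phi.
- exact: linear_fun_id.
- by rewrite free_map_gen gZ free_map_gen rs scalerA -nuM mulr1 psi_phi scale1r.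
Qed.
End Retract.

(* The canonical free resolution is functorial on the nose, so a retraction of
   the coefficients retracts the whole complex computing Tor. *)
Lemma TorV_retract (S R : pzRingType) (phi : nuhom S R) (psi : nuhom R S)
    (X : lmodType S^c) (Y : lmodType S) (X' : lmodType R^c) (Y' : lmodType R)
    (s : X -> X') (r : X' -> X) (t : Y -> Y') (u : Y' -> Y) n :
  cancel phi psi -> cancel s r -> cancel t u ->
  rsemilinear_fun phi s -> rsemilinear_fun psi r ->
  semilinear_fun phi t -> semilinear_fun psi u ->
  TorV n X' Y' -> TorV n X Y.
Proof.
move=> psi_phi + tu + + tP uP.
have sfP (Z : lmodType S^c) (Z' : lmodType R^c) (g : Z -> Z') :
    rsemilinear_fun phi (free_map (nu_conv phi) g).
  exact: free_map_semilinear.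
elim: n X X' s r => [|n IH] X X' s r rs sP rP.
  move=> h z z0.
  have iP := ses_i (ses_cover X); have iP' := ses_i (ses_cover X').
  have oP : rsemilinear_fun phi (Omega_map (phi := nu_conv phi) sP).
    exact: Omega_map_semilinear.
  have oP' : rsemilinear_fun psi (Omega_map (phi := nu_conv psi) rP).
    exact: Omega_map_semilinear.
  (* The image of [z] over R dies in the free cover, hence vanishes by hypothesis, and the
     retraction brings it back to [z]. *)
  pose z' := tmap (Omega_map (phi := nu_conv phi) sP) t z.
  have z'0 : z' = 0.
    apply: h; rewrite /z'.
    rewrite (@tmap_comp S R R phi id _ _ _ _ _ _ _ _ _ _ oP tP iP' (linear_fun_id _)).
    have <- : tmap (free_map (nu_conv phi) s) t (tmap (@Omega_incl _ X) (@id Y) z) = 0.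
      by rewrite z0 (additive_fun0 (tmapD (sfP _ _ s) tP)).
    by rewrite (@tmap_comp S S R id phi _ _ _ _ _ _ _ _ _ _ iP (linear_fun_id _) (sfP _ _ s) tP).
  have <- : tmap (Omega_map (phi := nu_conv psi) rP) u z' = 0.
    by rewrite z'0 (additive_fun0 (tmapD oP' uP)).
  rewrite (tmap_comp oP tP oP' uP) (@eq_tmap S S _ _ _ _ _ id _ id) ?tmap_id //.
  by move=> f; apply: val_inj; exact: (@free_map_retract _ _ (nu_conv phi) (nu_conv psi)).
apply: (IH (Omega X) (Omega X') (Omega_map (phi := nu_conv phi) sP)
          (Omega_map (phi := nu_conv psi) rP)).
- by move=> f; apply: val_inj; exact: (@free_map_retract _ _ (nu_conv phi) (nu_conv psi)).
- exact: Omega_map_semilinear.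
- exact: Omega_map_semilinear.
Qed.

(* Induction along phi: the left R-module R phi(1) (x)_S Y. *)
Section Induction.
Variables (S R : pzRingType) (phi : nuhom S R).

Definition ind_ring : lmodType S^c := res (nu_conv phi) (R^c)^o.

Fact ind_mul_subproof (r : R) (x : ind_ring) :
  in_res (nu_conv phi) (X := (R^c)^o) (r * (res_val x : R)).
Proof.
by have := congr1 ( *%R r) (res_valP x); rewrite mulrA => /eqP.
Qed.
Definition ind_mul (r : R) (x : ind_ring) : ind_ring := Res (ind_mul_subproof r x).

Lemma ind_mul_linear r : rsemilinear_fun (id : S -> S) (ind_mul r).
Proof.
split=> [x y|a x]; apply: val_inj; first exact: (@mulrDr R).
exact: (@mulrA R).
Qed.

Variable Y : lmodType S.

Definition ind_mod : Type := tensor ind_ring Y.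
HB.instance Definition _ := GRing.Zmodule.on ind_mod.

Definition ind_scale (r : R) : ind_mod -> ind_mod := tmap (ind_mul r) (@id Y).

Lemma ind_scaleE r x y : ind_scale r (tens x y) = tens (ind_mul r x) y.
Proof. exact: (tmaplE (ind_mul_linear r)). Qed.
Lemma ind_scaleDr r : additive_fun (ind_scale r).
Proof. exact: (tmaplD (ind_mul_linear r)). Qed.

Fact ind_scaleDl z : {morph ind_scale^~ z : a b / a + b}.
Proof.
move=> a b; move: z; apply: tens_ext => [||x y].
- exact: ind_scaleDr.
- by move=> u v; rewrite !ind_scaleDr addrACA.
- rewrite !ind_scaleE -tensDl; congr tens; apply: val_inj; exact: (@mulrDl R).
Qed.
Fact ind_scaleA a b z : ind_scale a (ind_scale b z) = ind_scale (a * b) z.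
Proof.
move: z; apply: tens_ext => [u v|u v|x y]; rewrite ?ind_scaleDr //.
rewrite !ind_scaleE; congr tens; apply: val_inj; exact: (@mulrA R).
Qed.
Fact ind_scale1 : left_id 1 ind_scale.
Proof.
apply: tens_ext => [|//|x y]; first exact: ind_scaleDr.
rewrite ind_scaleE; congr tens; apply: val_inj; exact: (@mul1r R).
Qed.
HB.instance Definition _ := GRing.Zmodule_isLmodule.Build R ind_mod
  ind_scaleA ind_scale1 ind_scaleDr ind_scaleDl.

Definition ind_one : ind_ring := to_res (nu_conv phi) (1 : (R^c)^o).

Definition ind_gen (y : Y) : ind_mod := tens ind_one y.

Lemma ind_mul_one (x : ind_ring) : ind_mul (res_val x : R) ind_one = x.
Proof.
apply: val_inj; change ((res_val x : R) * (1 * phi 1) = res_val x :> R).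
by rewrite mul1r; exact: (res_valP x).
Qed.

Lemma ind_gen_semilinear : semilinear_fun phi ind_gen.
Proof.
split=> [x y|a y]; first exact: tensDr.
rewrite /ind_gen -tensZ [RHS]ind_scaleE; congr tens; apply: val_inj => /=.
change ((1 * phi 1) * phi a = phi a * (1 * phi 1)).
by rewrite !mul1r -!nuM mulr1 mul1r.
Qed.

Lemma ind_modE (r : ind_ring) (y : Y) :
  tens r y = ((res_val r : R) *: ind_gen y : ind_mod).
Proof. by rewrite [RHS]ind_scaleE ind_mul_one. Qed.

Section Lift.
Variables (X : lmodType R) (u : Y -> X).
Hypothesis uP : semilinear_fun phi u.

(** One half of the adjunction between induction and restriction: a semilinear map Y -> X is an
    S-linear map from Y to phi(1) X. *)
Definition ind_lift : ind_mod -> X :=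
  tens_lift (fun (r : ind_ring) y => (res_val r : R) *: u y).

Lemma ind_lift_balanced : balanced (fun (r : ind_ring) y => (res_val r : R) *: u y).
Proof.
have [uD uZ] := uP; split=> [n x y|m x y|r m n].
- exact: scalerDl.
- by rewrite uD scalerDr.
- by rewrite uZ scalerA.
Qed.

Lemma ind_liftE r y : ind_lift (tens r y) = (res_val r : R) *: u y.
Proof. exact: (tens_liftE _ _ ind_lift_balanced). Qed.

Lemma ind_lift_linear : linear_fun ind_lift.
Proof.
have lD := tens_lift_additive ind_lift_balanced.
split=> // a z; move: z; apply: tens_ext => [x y|x y|r y].
- by rewrite scalerDr; exact: lD.
- by rewrite [ind_lift _]lD scalerDr.
- by rewrite [a *: _]ind_scaleE !ind_liftE scalerA.
Qed.

Lemma ind_lift_gen y : ind_lift (ind_gen y) = u y.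
Proof.
rewrite ind_liftE.
change ((1 * phi 1) *: u y = u y).
by have [_ uZ] := uP; rewrite mul1r -uZ scale1r.
Qed.
End Lift.
End Induction.

Lemma ind_ext (S R : pzRingType) (phi : nuhom S R) (Y : lmodType S) (G : zmodType)
    (F H : ind_mod phi Y -> G) :
  additive_fun F -> additive_fun H ->
  (forall r y, F (tens r y) = H (tens r y)) -> F =1 H.
Proof. exact: tens_ext. Qed.

Section IndMap.
Variables (S R : pzRingType) (phi : nuhom S R) (Y Y' Y'' : lmodType S).

Definition ind_map (V W : lmodType S) (g : V -> W) : ind_mod phi V -> ind_mod phi W :=
  tmap (@id (ind_ring phi)) g.

Lemma ind_map_linear (V W : lmodType S) (g : V -> W) :
  linear_fun g -> linear_fun (ind_map g).
Proof.
move=> gP; split=> [|r z]; first exact: (tmaprD gP).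
exact: (tmapC (ind_mul_linear phi r) gP).
Qed.

Lemma ind_ses (g : Y -> Y') (h : Y' -> Y'') : ses g h ->
  TorV 0 (ind_ring phi) Y'' -> ses (ind_map g) (ind_map h).
Proof.
move=> e t0; split.
- exact/ind_map_linear/(ses_i e).
- exact/ind_map_linear/(ses_p e).
- exact: TorV0_mono_right e _ t0.
- exact: (tensr_pi e).
- exact: (tensr_ker e).
- exact: (tensr_surj e).
Qed.
End IndMap.
Arguments ind_map {S R} phi {V W}.

(** * Base change of Tor along a corner inclusion *)

Section CornerTransfer.
Variables (S R : pzRingType) (phi : nuhom S R) (Y : lmodType S).
Local Notation resc := (res (nu_conv phi)).

Section Iso.
Variable X : lmodType R^c.

(** With e = phi(1), this is the isomorphism Xe (x)_S Y -> X (x)_R (Re (x)_S Y). Its inverse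
    [corner_of] sends x (x) (r (x) y) to xr (x) y. *)
Definition corner_to (z : tensor (resc X) Y) : tensor X (ind_mod phi Y) :=
  tmap (@res_val _ _ (nu_conv phi) X) (@ind_gen _ _ phi Y) z.

Lemma corner_toE x y : corner_to (tens x y) = tens (res_val x) (ind_gen phi y).
Proof. exact: (tmapE (res_val_semilinear (nu_conv phi) X) (ind_gen_semilinear _ _)). Qed.
Lemma corner_toD : additive_fun corner_to.
Proof. exact: (tmapD (res_val_semilinear (nu_conv phi) X) (ind_gen_semilinear _ _)). Qed.

Fact corner_act_subproof (x : X) (r : ind_ring phi) :
  in_res (nu_conv phi) (X := X) ((res_val r : R^c) *: x).
Proof.
apply/eqP; rewrite scalerA; congr (_ *: _).
exact: (res_valP r).
Qed.
Definition corner_act (x : X) (r : ind_ring phi) : resc X :=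
  Res (corner_act_subproof x r).

Lemma corner_act_linear x : rsemilinear_fun (id : S -> S) (corner_act x).
Proof.
split=> [r r'|a r]; apply: val_inj; first exact: scalerDl.
by rewrite /= scalerA.
Qed.

Let actE x := tmaplE (Y := Y) (corner_act_linear x).
Let actD x := tmaplD (Y := Y) (corner_act_linear x).

Lemma corner_of_balanced :
  balanced (fun (x : X) (t : ind_mod phi Y) => tmap (corner_act x) (@id Y) t).
Proof.
split=> [t x y|x|r x t]; last first.
- move: t; apply: tens_ext => [||a y].
  + exact: actD.
  + by move=> u v; rewrite scalerDr actD.
  rewrite [r *: _]ind_scaleE !actE; congr tens; apply: val_inj.
  by rewrite /= scalerA.
- exact: actD.
move: t; apply: tens_ext => [||r z].
- exact: actD.
- by move=> u v; rewrite !actD addrACA.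
by rewrite !actE -tensDl; congr tens; apply: val_inj; exact: scalerDr.
Qed.

Definition corner_of (z : tensor X (ind_mod phi Y)) : tensor (resc X) Y :=
  tens_lift (fun (x : X) (t : ind_mod phi Y) => tmap (corner_act x) (@id Y) t) z.

Lemma corner_ofD : additive_fun corner_of.
Proof. exact: tens_lift_additive corner_of_balanced. Qed.

Lemma corner_toK : cancel corner_to corner_of.
Proof.
apply: tens_ext => [u v|//|x y]; first by rewrite corner_toD corner_ofD.
rewrite corner_toE /corner_of (tens_liftE _ _ corner_of_balanced) actE.
congr tens; apply: val_inj.
have one : (1 * phi 1 : R) = phi 1 by rewrite mul1r.
change (((1 * phi 1 : R) : R^c) *: res_val x = res_val x).
by rewrite one; exact: (res_valP x).
Qed.

Lemma corner_ofK : cancel corner_of corner_to.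
Proof.
apply: tens_ext => [u v|//|x t]; first by rewrite corner_ofD corner_toD.
rewrite /corner_of (tens_liftE _ _ corner_of_balanced).
move: t; apply: tens_ext => [u v|u v|r y].
- by rewrite actD corner_toD.
- exact: tensDr.
- by rewrite actE corner_toE /= tensZ ind_modE.
Qed.
End Iso.

Lemma corner_to_nat (X X' : lmodType R^c) (f : X -> X') : rsemilinear_fun id f ->
  forall z, corner_to (tmap (res_map f : resc X -> resc X') (@id Y) z) =
            tmap f (@id (ind_mod phi Y)) (corner_to z).
Proof.
move=> fP; have rP := @res_map_linear _ _ (nu_conv phi) _ _ _ fP.
apply: tens_ext => [u v|u v|x y].
- by rewrite (tmaplD rP) corner_toD.
- by rewrite corner_toD (tmaplD fP).
- by rewrite (tmaplE rP) !corner_toE (tmaplE fP) res_mapE.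
Qed.

Lemma corner_mono (X X' : lmodType R^c) (f : X -> X') : rsemilinear_fun id f ->
  mono (tmap (res_map f : resc X -> resc X') (@id Y)) <->
  mono (tmap f (@id (ind_mod phi Y))).
Proof.
move=> fP; have toI := can_inj (@corner_toK X').
split=> m z z0.
  rewrite -(corner_ofK z) [corner_of z]m ?(additive_fun0 (@corner_toD _)) //.
  apply: toI; rewrite corner_to_nat // corner_ofK z0.
  by rewrite (additive_fun0 (@corner_toD _)).
apply: (can_inj (@corner_toK X)).
rewrite (additive_fun0 (@corner_toD _)); apply: m.
by rewrite -corner_to_nat // z0 (additive_fun0 (@corner_toD _)).
Qed.

(** Restricting a free resolution of X to S gives a resolution of the restriction that need not be
    free, but by hypothesis it is acyclic for Y and so computes Tor over S. By [corner_to],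
    tensoring it with Y gives the complex of the induced module over R. *)
Lemma TorV_corner n (X : lmodType R^c) :
  (forall I j, TorV j (resc (free_module R^c I)) Y) ->
  TorV n (resc X) Y <-> TorV n X (ind_mod phi Y).
Proof.
move=> acyc; elim: n X => [|n IH] X; last first.
  have e := res_ses (nu_conv phi) (ses_cover X).
  rewrite (TorV_acyclic_shift e n (acyc X)); exact: (IH (Omega X)).
have e := res_ses (nu_conv phi) (ses_cover X).
have iP := ses_i (ses_cover X).
split=> h; first exact/(corner_mono iP)/(TorV0_mono_left e).
by apply: (mono_TorV0_left e) (acyc X 0%N); exact/(corner_mono iP).
Qed.
End CornerTransfer.

(** * Base change of Tor along a split surjection of rings *)

Section EpiTransfer.
Variables (R Q : pzRingType) (pi : nuhom R Q) (iota : nuhom Q R).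
Hypothesis iotaK : cancel iota pi.
Variables (X : lmodType R^c) (Z : lmodType Q^c) (p : X -> Z) (j : Z -> X).
Hypotheses (pP : rsemilinear_fun pi p) (jP : rsemilinear_fun iota j).
Hypothesis jp : forall x, j (p x) = (iota 1 : R^c) *: x.

(** [Z] stands for X (x)_R Q and is known only through [p] and [j]. Since free Q-modules are acyclic
    for X, syzygies over Q reduce the claim to Tor_1, where injectivity over R is deduced from
    injectivity over Q. *)
Lemma TorV_epi n (Y : lmodType Q) :
  (forall I m, TorV m X (res pi (free_module Q I))) ->
  TorV n Z Y -> TorV n X (res pi Y).
Proof.
move=> acyc; elim: n Y => [|n IH] Y; last first.
  move=> /TorV_shift/IH h.
  exact: (TorV_ses_right (res_ses pi (ses_cover Y)) (acyc _ _) h).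
move=> /(TorV0_mono_right (ses_cover Y)) m.
have iP := ses_i (ses_cover Y).
apply: (mono_TorV0_right (res_ses pi (ses_cover Y))) (acyc _ _).
pose al (V : lmodType Q) := tmap p (@res_val _ _ pi V).
have vP V : semilinear_fun pi (@res_val _ _ pi V) := res_val_semilinear pi V.
have tP V : semilinear_fun iota (@to_res _ _ pi V).
  split=> [x y|a x]; first exact: to_resD.
  by rewrite -{1}[a]iotaK to_resZ.
apply: (mono_factor (tmapD pP (vP _)) _ _ m (f' := al _)).
  have riP := res_map_linear pi iP.
  apply: tens_ext => [u v|u v|x y].
  - by rewrite (tmaprD riP) (tmapD pP (vP _)).
  - by rewrite /al (tmapD pP (vP _)) (tmaprD iP).
  - by rewrite (tmaprE riP) /al !(tmapE pP (vP _)) (tmaprE iP) res_mapE.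
(* [j] and [to_res] retract the comparison map: x (x) y returns as x iota(1) (x) y = x (x) iota(1)
   y, and iota(1) acts on [res pi Y] as pi(iota(1)) = 1. *)
move=> z z0; have : tmap j (@to_res _ _ pi _) (al _ z) = 0.
  by rewrite z0 (additive_fun0 (tmapD jP (tP _))).
suff -> : tmap j (@to_res _ _ pi _) (al _ z) = z by [].
move: {z0} z; apply: tens_ext => [u v|//|x y].
  by rewrite /al (tmapD pP (vP _)) (tmapD jP (tP _)).
rewrite /al (tmapE pP (vP _)) (tmapE jP (tP _)) jp to_resK tensZ.
by congr tens; apply: val_inj; rewrite /= iotaK scale1r.
Qed.
End EpiTransfer.

(* An anti-involution exchanges left and right modules, hence the two
   arguments of Tor. *)
Section Swap.
Variables (R : pzRingType) (sg : nuhom R R^c).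
Hypothesis sgK : forall x : R, sg (sg x : R) = x.

Definition sg_conv : nuhom R^c R := @NuHom R^c R sg (nuD sg) (fun x y => nuM sg y x).

Lemma sg1 : sg 1 = 1 :> R.
Proof.
have e : sg ((sg 1 : R) * 1) = (sg 1 : R) * (sg (sg 1 : R) : R) :> R.
  exact: (nuM sg (sg 1 : R) 1).
by move: e; rewrite mulr1 sgK mulr1.
Qed.

Lemma sw_regular n Z : TorV n (res sg_conv R^o) Z.
Proof.
apply: TorV_local_left (TorV_regular_left n Z).
apply: (@retract_local _ (res sg_conv R^o) (R^c)^o
          (fun r => to_res sg_conv (sg r : R^o)) (fun x => sg (res_val x : R))).
- split=> [x y|a x]; first by rewrite nuD to_resD.
  by rewrite -to_resZ; congr to_res; exact: (nuM sg).
- split=> [x y|a x]; first exact: nuD.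
  have e := nuM sg (sg a : R) (res_val x : R).
  by move: e; rewrite sgK => e; exact: e.
- by move=> x; rewrite sgK to_resK.
Qed.

Lemma TorV_swap n (X : lmodType R^c) (Y : lmodType R) :
  TorV n (res sg_conv Y) (res sg X) -> TorV n X Y.
Proof.
elim: n Y => [|n IH] Y h; last first.
  apply/TorV_shift/IH.
  (* The twist of the free cover of Y is not the canonical free cover of the twisted module, so the
     shift goes through acyclicity. *)
  have acyc j : TorV j (res sg_conv (free_module R Y)) (res sg X).
    exact: (TorV_local_left (res_local sg_conv (free_local R Y)) (sw_regular j _)).
  exact: (proj1 (TorV_acyclic_shift (res_ses sg_conv (ses_cover Y)) n acyc) h).
have iP := ses_i (ses_cover Y).
apply: (mono_TorV0_right (ses_cover Y)) (TorV_free_right _ _ _).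
have m := TorV0_mono_left (res_ses sg_conv (ses_cover Y)) h.
pose tau (V : lmodType R) : tensor X V -> tensor (res sg_conv V) (res sg X) :=
  tens_lift (fun x y => tens (to_res sg_conv y) (to_res sg x)).
pose tau' (V : lmodType R) : tensor (res sg_conv V) (res sg X) -> tensor X V :=
  tens_lift (fun (y : res sg_conv V) (x : res sg X) => tens (res_val x) (res_val y)).
have tb (V : lmodType R) : balanced (fun (x : X) (y : V) => tens (to_res sg_conv y) (to_res sg x)).
  split=> [y x x'|x y y'|r x y].
  - by rewrite to_resD tensDr.
  - by rewrite to_resD tensDl.
  - have -> : to_res sg ((r : R^c) *: x) = (sg r : R) *: to_res sg x.
      by rewrite -to_resZ sgK.
    have -> : to_res sg_conv (r *: y) = (sg r : R^c) *: to_res sg_conv y.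
      by rewrite -to_resZ /= sgK.
    by rewrite tensZ.
have tb' (V : lmodType R) : balanced (fun (y : res sg_conv V) (x : res sg X) => tens (res_val x) (res_val y)).
  split=> [y x x'|x y y'|r x y].
  - exact: tensDr.
  - exact: tensDl.
  - by rewrite /= -tensZ.
have tauD V : additive_fun (@tau V) := tens_lift_additive (tb V).
have tauD' V : additive_fun (@tau' V) := tens_lift_additive (tb' V).
have tauK V : cancel (@tau V) (@tau' V).
  apply: tens_ext => [u v|//|x y]; first by rewrite tauD tauD'.
  rewrite /tau /tau' (tens_liftE _ _ (tb _)) (tens_liftE _ _ (tb' _)) /=.
  by rewrite /= sg1 !scale1r.
apply: (mono_factor (tauD _) _ _ m (f' := @tau _)); last first.
  by move=> z z0; rewrite -[z]tauK z0 (additive_fun0 (tauD' _)).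
have riP := res_map_linear sg_conv iP.
apply: tens_ext => [u v|u v|x y].
- by rewrite (tmaprD iP) tauD.
- by rewrite tauD (tmaplD riP).
rewrite (tmaprE iP) /tau !(tens_liftE _ _ (tb _)) (tmaplE riP); congr tens.
by apply: val_inj; rewrite [RHS]res_mapE.
Qed.
End Swap.

(** * Bimodules over an algebra over a field *)

Section Splitting.
Variables (R : pzRingType) (divR : forall a : R, a != 0 -> exists b, b * a = 1).
Variables (U V : lmodType R) (i : U -> V) (iP : linear_fun i) (im : mono i).

Let good (C : set V) :=
  (forall a x y, C x -> C y -> C (a *: x + y)) /\ forall u, C (i u) -> u = 0.

(** Zorn's lemma gives a maximal complement [C] of the image, and [r] is the projection along it.
    The empty set counts as good, because the union of the empty chain must; hence membership is
    always stated as [C c \/ c = 0]. *)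
Lemma split_mono : exists r : V -> U, linear_fun r /\ cancel i r.
Proof.
have [iD iZ] := iP; have iI := mono_injective iD im.
have [F Fgood Ftot|C [[Clin C0] Cmax]] := @Zorn_bigcup V good.
  split=> [a x y [X FX Xx] [Y FY Yy]|u [X FX Xu]]; last exact: (proj2 (Fgood _ FX)).
  have [XY|YX] := Ftot _ _ FX FY.
    by exists Y => //; apply: (proj1 (Fgood _ FY)) => //; exact: XY.
  by exists X => //; apply: (proj1 (Fgood _ FX)) => //; exact: YX.
have lin0 a c c' : C c \/ c = 0 -> C c' \/ c' = 0 -> C (a *: c + c') \/ a *: c + c' = 0.
  case=> [Cc|->] [Cc'|->].
  - by left; apply: Clin.
  - left; have := Clin (a - 1) _ _ Cc Cc.
    by rewrite scalerBl scale1r subrK addr0.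
  - by left; rewrite scaler0 add0r.
  - by right; rewrite scaler0 addr0.
(* Otherwise the span [B] of C and v would be a larger good set: from a v + c = i u with a
   invertible, v itself would decompose. *)
have dec v : exists u, C (v - i u) \/ v = i u.
  apply: contrapT => /forallNP h.
  pose B : set V := fun w => exists a c, (C c \/ c = 0) /\ w = a *: v + c.
  have CB : (C `<=` B)%classic.
    by move=> w Cw; exists 0, w; split; [left|rewrite scale0r add0r].
  apply: (Cmax B).
    split=> // BC; apply: (h 0); left; rewrite (additive_fun0 iD) subr0.
    by apply: BC; exists 1, 0; split; [right|rewrite scale1r addr0].
  split=> [a x y [b [c [cC ->]]] [b' [c' [cC' ->]]]|u [a [c [cC iu]]]].
    exists (a * b + b'), (a *: c + c'); split; first exact: lin0.
    by rewrite scalerDr scalerDl scalerA addrACA.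
  have [a0|/divR[b ba]] := eqVneq a 0.
    move: iu; rewrite a0 scale0r add0r => iu; case: cC => [|c0].
      by rewrite -iu; exact: C0.
    by apply: iI; rewrite iu c0 (additive_fun0 iD).
  have vE : v = i (b *: u) - b *: c.
    by rewrite iZ iu scalerDr addrK scalerA ba scale1r.
  case: (h (b *: u)); rewrite vE.
  have [|E] := lin0 (- b) c 0 cC (or_intror erefl).
    by rewrite addr0 scaleNr; left; rewrite addrAC subrr sub0r.
  by right; move: E; rewrite addr0 scaleNr => ->; rewrite addr0.
have dec0 v : exists u, C (v - i u) \/ v - i u = 0.
  by have [u [h|->]] := dec v; exists u; [left|right; rewrite subrr].
have uniq0 u c : (C c \/ c = 0) -> i u = c -> u = 0.
  case=> [Cc ic|-> iu]; first by apply: C0; rewrite ic.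
  exact: im.
have [r rP] := choice dec0.
have rE v u : C (v - i u) \/ v - i u = 0 -> r v = u.
  move=> h; apply/eqP; rewrite -subr_eq0; apply/eqP.
  apply: (uniq0 _ (-1 *: (v - i (r v)) + (v - i u))); first exact: lin0.
  by rewrite scaleN1r opprB addrA subrK additive_funB.
exists r; split; last by move=> u; apply: rE; right; rewrite subrr.
split=> [x y|a x]; apply: rE.
  rewrite iD opprD addrACA -[x - _]scale1r; exact: lin0.
by rewrite iZ -scalerBr -[a *: _]addr0; apply: lin0 => //; right.
Qed.
End Splitting.

Lemma eq_retract_mono (U V : zmodType) (f : U -> V) (g : V -> U) :
  additive_fun g -> cancel f g -> mono f.
Proof. by move=> gD fg x fx; rewrite -(fg x) fx (additive_fun0 gD). Qed.

Section Bimodule.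
Variables (k : fieldType) (A : algebra k).

Section Scalars.
Variables (U : lmodType A) (V : lmodType A^c).

(** [tensor] expects a right module first. Scalars are central, so the left module U is read over
    [k^c] and the right module V over [k]; [bimod] is then U (x)_k V with a (x) b acting by au (x)
    vb. *)
Definition kmodr : Type := U.
HB.instance Definition _ := GRing.Zmodule.on kmodr.
Definition kmodr_scale (a : k^c) (x : kmodr) : kmodr := alg_scalar A (a : k) *: (x : U).
Fact kmodr_scalerA (a b : k^c) x :
  kmodr_scale a (kmodr_scale b x) = kmodr_scale (a * b) x.
Proof.
rewrite /kmodr_scale scalerA -rmorphM; congr (alg_scalar A _ *: _).
exact: (@mulrC k).
Qed.
Fact kmodr_scale1 : left_id (1 : k^c) kmodr_scale.
Proof. by move=> x; rewrite /kmodr_scale rmorph1 scale1r. Qed.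
Fact kmodr_scaleDr : right_distributive kmodr_scale +%R.
Proof. by move=> a x y; exact: scalerDr. Qed.
Fact kmodr_scaleDl x : {morph kmodr_scale^~ x : a b / a + b}.
Proof. by move=> a b; rewrite /kmodr_scale rmorphD scalerDl. Qed.
HB.instance Definition _ := GRing.Zmodule_isLmodule.Build k^c kmodr
  kmodr_scalerA kmodr_scale1 kmodr_scaleDr kmodr_scaleDl.

Definition kmodl : Type := V.
HB.instance Definition _ := GRing.Zmodule.on kmodl.
Definition kmodl_scale (a : k) (x : kmodl) : kmodl := (alg_scalar A a : A^c) *: (x : V).
Fact kmodl_scalerA a b x :
  kmodl_scale a (kmodl_scale b x) = kmodl_scale (a * b) x.
Proof.
rewrite /kmodl_scale scalerA mulrC; congr (_ *: _).
exact: (esym (rmorphM (alg_scalar A) b a)).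
Qed.
Fact kmodl_scale1 : left_id 1 kmodl_scale.
Proof. by move=> x; rewrite /kmodl_scale rmorph1 scale1r. Qed.
Fact kmodl_scaleDr : right_distributive kmodl_scale +%R.
Proof. by move=> a x y; exact: scalerDr. Qed.
Fact kmodl_scaleDl x : {morph kmodl_scale^~ x : a b / a + b}.
Proof. by move=> a b; rewrite /kmodl_scale rmorphD scalerDl. Qed.
HB.instance Definition _ := GRing.Zmodule_isLmodule.Build k kmodl
  kmodl_scalerA kmodl_scale1 kmodl_scaleDr kmodl_scaleDl.

Definition bimod : Type := tensor (kmodr : lmodType k^c) (kmodl : lmodType k).
HB.instance Definition _ := GRing.Zmodule.on bimod.

Definition bitens (u : U) (v : V) : bimod := tens (u : kmodr) (v : kmodl).

Lemma bitensDl v u u' : bitens (u + u') v = bitens u v + bitens u' v.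
Proof. exact: tensDl. Qed.
Lemma bitensDr u v v' : bitens u (v + v') = bitens u v + bitens u v'.
Proof. exact: tensDr. Qed.
Lemma bitensZ c u v :
  bitens (alg_scalar A c *: u) v = bitens u ((alg_scalar A c : A^c) *: v).
Proof. exact: (@tensZ k kmodr kmodl c u v). Qed.

Lemma bimod_ext (G : zmodType) (F H : bimod -> G) :
  additive_fun F -> additive_fun H ->
  (forall u v, F (bitens u v) = H (bitens u v)) -> F =1 H.
Proof. exact: tens_ext. Qed.

Section BiLift.
Variables (G : zmodType) (b : U -> V -> G).
Hypotheses (bDl : forall v, additive_fun (b^~ v)) (bDr : forall u, additive_fun (b u)).
Hypothesis bZ : forall c u v,
  b (alg_scalar A c *: u) v = b u ((alg_scalar A c : A^c) *: v).

Definition bilift : bimod -> G := @tens_lift k kmodr kmodl G b.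

Lemma bilift_balanced : @balanced k kmodr kmodl G b.
Proof. by split=> [n x y|m x y|r m n]; [exact: bDl|exact: bDr|exact: bZ]. Qed.
Lemma biliftE u v : bilift (bitens u v) = b u v.
Proof. exact: (tens_liftE _ _ bilift_balanced). Qed.
Lemma biliftD : additive_fun bilift.
Proof. exact: (tens_lift_additive bilift_balanced). Qed.
End BiLift.

Definition bimod_pure (a b : A) : bimod -> bimod :=
  bilift (fun u v => bitens (a *: u) ((b : A^c) *: v)).

Lemma bimod_pureP a b :
  [/\ forall u v, bimod_pure a b (bitens u v) = bitens (a *: u) ((b : A^c) *: v)
    & additive_fun (bimod_pure a b)].
Proof.
have Dl v : additive_fun (fun u => bitens (a *: u) ((b : A^c) *: v)).
  by move=> x y; rewrite scalerDr bitensDl.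
have Dr u : additive_fun (fun v => bitens (a *: u) ((b : A^c) *: v)).
  by move=> x y; rewrite scalerDr bitensDr.
have Z c u v : bitens (a *: (alg_scalar A c *: u)) ((b : A^c) *: v) =
               bitens (a *: u) ((b : A^c) *: ((alg_scalar A c : A^c) *: v)).
  rewrite scalerA -alg_central -scalerA bitensZ !scalerA; congr (bitens _ (_ *: _)).
  exact: (esym (alg_central c b)).
by split=> [u v|]; [exact: biliftE|exact: biliftD].
Qed.
Lemma bimod_pureE a b u v :
  bimod_pure a b (bitens u v) = bitens (a *: u) ((b : A^c) *: v).
Proof. by case: (bimod_pureP a b). Qed.
Lemma bimod_pureD a b : additive_fun (bimod_pure a b).
Proof. by case: (bimod_pureP a b). Qed.

Definition bimod_scale (r : env A) : bimod -> bimod :=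
  @tens_lift k (kright A) (kleft A) (bimod -> bimod) bimod_pure r.

Lemma bimod_scale_balanced :
  @balanced k (kright A) (kleft A) (bimod -> bimod) bimod_pure.
Proof.
split=> [b a a'|a b b'|r a b]; apply/funext; apply: bimod_ext.
- exact: bimod_pureD.
- by move=> x y; rewrite !addrfctE !bimod_pureD addrACA.
- by move=> u v; rewrite addrfctE !bimod_pureE -bitensDl -scalerDl.
- exact: bimod_pureD.
- by move=> x y; rewrite !addrfctE !bimod_pureD addrACA.
- by move=> u v; rewrite addrfctE !bimod_pureE -bitensDr -scalerDl.
- exact: bimod_pureD.
- exact: bimod_pureD.
- move=> u v; rewrite !bimod_pureE.
  have -> : ((r : k^c) *: a : kright A) = (a : A) * alg_scalar A r :> A by [].
  have -> : (r *: b : kleft A) = alg_scalar A r * (b : A) :> A by [].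
  rewrite -alg_central -scalerA bitensZ scalerA; congr (bitens _ (_ *: _)).
  exact: (esym (alg_central r (b : A))).
Qed.

Lemma bimod_scaleE a b u v :
  bimod_scale (etens a b) (bitens u v) = bitens (a *: u) ((b : A^c) *: v).
Proof. by rewrite /bimod_scale (tens_liftE _ _ bimod_scale_balanced) bimod_pureE. Qed.
Fact bimod_scaleDl z : {morph bimod_scale^~ z : r s / r + s}.
Proof. by move=> r s; rewrite /bimod_scale (tens_liftD _ _ bimod_scale_balanced). Qed.
Lemma bimod_scale0 z : bimod_scale 0 z = 0.
Proof. by apply: (addIr (bimod_scale 0 z)); rewrite -bimod_scaleDl !add0r. Qed.
Fact bimod_scaleDr : right_distributive bimod_scale +%R.
Proof.
move=> r x y; elim/env_ind: r => [|r s IHr IHs|a b].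
- by rewrite !bimod_scale0 addr0.
- by rewrite !bimod_scaleDl IHr IHs addrACA.
- by rewrite /bimod_scale (tens_liftE _ _ bimod_scale_balanced) bimod_pureD.
Qed.
Fact bimod_scaleA r s z : bimod_scale r (bimod_scale s z) = bimod_scale (r * s) z.
Proof.
have l0 w : bimod_scale w 0 = 0 by exact: (additive_fun0 (bimod_scaleDr w)).
elim/env_ind: r => [|r r' IH IH'|a b].
- by rewrite mul0r !bimod_scale0.
- by rewrite mulrDl !bimod_scaleDl IH IH'.
elim/env_ind: s => [|r r' IH IH'|c d].
- by rewrite mulr0 !bimod_scale0 l0.
- by rewrite mulrDr !bimod_scaleDl bimod_scaleDr IH IH'.
move: z; apply: bimod_ext => [x y|x y|u v]; rewrite ?bimod_scaleDr //.
rewrite [_ * _]env_mulE !bimod_scaleE !scalerA; congr (bitens _ (_ *: _)).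
Qed.
Fact bimod_scale1 : left_id 1 bimod_scale.
Proof.
apply: bimod_ext => [x y|//|u v]; first exact: bimod_scaleDr.
by rewrite bimod_scaleE !scale1r.
Qed.
HB.instance Definition _ := GRing.Zmodule_isLmodule.Build (env A) bimod
  bimod_scaleA bimod_scale1 bimod_scaleDr bimod_scaleDl.

Lemma env_linear (W W' : lmodType (env A)) (f : W -> W') :
  additive_fun f -> (forall a b x, f (etens a b *: x) = etens a b *: f x) ->
  linear_fun f.
Proof.
move=> fD fZ; split=> // r x; elim/env_ind: r => [|r s IHr IHs|a b].
- by rewrite !scale0r (additive_fun0 fD).
- by rewrite !scalerDl fD IHr IHs.
- exact: fZ.
Qed.

Lemma bimod_linear (W : lmodType (env A)) (f : bimod -> W) : additive_fun f ->
  (forall a b u v, f (bitens (a *: u) ((b : A^c) *: v)) = etens a b *: f (bitens u v)) ->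
  linear_fun f.
Proof.
move=> fD fZ; apply: env_linear => // a b; apply: bimod_ext => [x y|x y|u v].
- by rewrite scalerDr fD.
- by rewrite fD scalerDr.
- by rewrite [etens a b *: bitens u v]bimod_scaleE fZ.
Qed.
End Scalars.
End Bimodule.

Section BimodMaps.
Variables (k : fieldType) (A : algebra k).

Let kdiv (a : k) : a != 0 -> exists b, b * a = 1.
Proof. by move=> a0; exists a^-1; rewrite mulVf. Qed.
Let kcdiv (a : k^c) : a != 0 -> exists b, b * a = 1.
Proof. by move=> a0; exists ((a : k)^-1); exact: (@mulfV k a a0). Qed.

Section Map.
Variables (U U' : lmodType A) (V V' : lmodType A^c) (f : U -> U') (g : V -> V').
Hypotheses (fP : linear_fun f) (gP : linear_fun g).

Lemma kmodr_linear : linear_fun (f : kmodr U -> kmodr U').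
Proof. by have [fD fZ] := fP; split=> // a x; exact: fZ. Qed.
Lemma kmodl_linear : linear_fun (g : kmodl V -> kmodl V').
Proof. by have [gD gZ] := gP; split=> // a x; exact: gZ. Qed.

Definition bimod_map : bimod U V -> bimod U' V' :=
  tmap (f : kmodr U -> kmodr U') (g : kmodl V -> kmodl V').

Lemma bimod_mapE u v : bimod_map (bitens u v) = bitens (f u) (g v).
Proof. exact: (@tmapE k k id _ _ _ _ _ _ kmodr_linear kmodl_linear). Qed.
Lemma bimod_mapD : additive_fun bimod_map.
Proof. exact: (@tmapD k k id _ _ _ _ _ _ kmodr_linear kmodl_linear). Qed.
Lemma bimod_map_linear : linear_fun bimod_map.
Proof.
apply: bimod_linear bimod_mapD _ => a b u v; rewrite !bimod_mapE.
by have [[_ fZ] [_ gZ]] := (fP, gP); rewrite fZ gZ [RHS]bimod_scaleE.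
Qed.
End Map.

(** Here the field is used: a k-linear splitting of [i] survives the tensor product, which gives
    injectivity. *)
Lemma bimod_ses_left (U' U U'' : lmodType A) (V : lmodType A^c)
    (i : U' -> U) (p : U -> U'') :
  ses i p -> ses (bimod_map i (@id V)) (bimod_map p (@id V)).
Proof.
move=> e; have [iP pP] := (ses_i e, ses_p e).
have e' : ses (i : kmodr U' -> kmodr U) (p : kmodr U -> kmodr U'').
  split; [exact: kmodr_linear|exact: kmodr_linear|exact: (ses_mono e)|
          exact: (ses_pi e)|exact: (ses_ker e)|exact: (ses_surj e)].
split.
- exact: bimod_map_linear iP (linear_fun_id V).
- exact: bimod_map_linear pP (linear_fun_id V).
- have [r [rP rK]] := split_mono kcdiv (ses_i e') (ses_mono e').
  apply: (eq_retract_mono (g := tmap r (@id (kmodl V)))); first exact: (tmaplD rP).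
  move=> z; rewrite /bimod_map (tmapl_comp (ses_i e') rP).
  by rewrite (eq_tmap (f' := id) (g' := id)) ?tmap_id.
- exact: (tensl_pi e').
- exact: (tensl_ker e').
- exact: (tensl_surj e').
Qed.

Lemma bimod_ses_right (U : lmodType A) (V' V V'' : lmodType A^c)
    (i : V' -> V) (p : V -> V'') :
  ses i p -> ses (bimod_map (@id U) i) (bimod_map (@id U) p).
Proof.
move=> e; have [iP pP] := (ses_i e, ses_p e).
have e' : ses (i : kmodl V' -> kmodl V) (p : kmodl V -> kmodl V'').
  split; [exact: kmodl_linear|exact: kmodl_linear|exact: (ses_mono e)|
          exact: (ses_pi e)|exact: (ses_ker e)|exact: (ses_surj e)].
split.
- exact: bimod_map_linear (linear_fun_id U) iP.
- exact: bimod_map_linear (linear_fun_id U) pP.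
- have [r [rP rK]] := split_mono kdiv (ses_i e') (ses_mono e').
  apply: (eq_retract_mono (g := tmap (@id (kmodr U)) r)); first exact: (tmaprD rP).
  move=> z; rewrite /bimod_map (tmapr_comp (ses_i e') rP).
  by rewrite (eq_tmap (f' := id) (g' := id)) ?tmap_id.
- exact: (tensr_pi e').
- exact: (tensr_ker e').
- exact: (tensr_surj e').
Qed.

Lemma bimod_local_left (U' U : lmodType A) (V : lmodType A^c) :
  local_retract U' U -> local_retract (bimod U' V) (bimod U V).
Proof.
move=> [I [j [q [jP qP jqE]]]].
exists I, (fun i => bimod_map (j i) (@id V)), (fun i => bimod_map (q i) (@id V)).
have jD i := bimod_mapD (jP i) (linear_fun_id V).
have qD i := bimod_mapD (qP i) (linear_fun_id V).
split=> [i|i|]; try exact: (bimod_map_linear _ (linear_fun_id V)).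
apply: tens_ind => [|w w' [s1 E1] [s2 E2]|u v].
- exists [::] => t _ _; rewrite big1 // => i _.
  by rewrite (additive_fun0 (qD i)) (additive_fun0 (jD i)).
- exists (s1 ++ s2) => t ut st.
  have h1 : {subset s1 <= t} by move=> x xs; apply: st; rewrite mem_cat xs.
  have h2 : {subset s2 <= t} by move=> x xs; apply: st; rewrite mem_cat xs orbT.
  rewrite {1}(E1 t ut h1) {1}(E2 t ut h2) -big_split.
  by apply: eq_bigr => i _; rewrite qD jD.
- have [s sE] := jqE u; exists s => t ut st.
  rewrite -[tens u v]/(bitens u v) {1}(sE t ut st).
  rewrite (additive_fun_sum (fun a b => bitensDl v a b)).
  apply: eq_bigr => i _.
  by rewrite (bimod_mapE (qP i) (linear_fun_id V)) (bimod_mapE (jP i) (linear_fun_id V)).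
Qed.

Lemma bimod_local_right (U : lmodType A) (V' V : lmodType A^c) :
  local_retract V' V -> local_retract (bimod U V') (bimod U V).
Proof.
move=> [I [j [q [jP qP jqE]]]].
exists I, (fun i => bimod_map (@id U) (j i)), (fun i => bimod_map (@id U) (q i)).
have jD i := bimod_mapD (linear_fun_id U) (jP i).
have qD i := bimod_mapD (linear_fun_id U) (qP i).
split=> [i|i|]; try exact: (bimod_map_linear (linear_fun_id U)).
apply: tens_ind => [|w w' [s1 E1] [s2 E2]|u v].
- exists [::] => t _ _; rewrite big1 // => i _.
  by rewrite (additive_fun0 (qD i)) (additive_fun0 (jD i)).
- exists (s1 ++ s2) => t ut st.
  have h1 : {subset s1 <= t} by move=> x xs; apply: st; rewrite mem_cat xs.
  have h2 : {subset s2 <= t} by move=> x xs; apply: st; rewrite mem_cat xs orbT.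
  rewrite {1}(E1 t ut h1) {1}(E2 t ut h2) -big_split.
  by apply: eq_bigr => i _; rewrite qD jD.
- have [s sE] := jqE v; exists s => t ut st.
  rewrite -[tens u v]/(bitens u v) {1}(sE t ut st).
  rewrite (additive_fun_sum (fun a b => bitensDr u a b)).
  apply: eq_bigr => i _.
  by rewrite (bimod_mapE (linear_fun_id U) (qP i)) (bimod_mapE (linear_fun_id U) (jP i)).
Qed.

Lemma bimod_regular : local_retract (bimod A^o (A^c)^o) (env A)^o.
Proof.
have Dl v : additive_fun (fun u => etens u v : env A) by move=> x y; exact: tensDl.
have Dr u : additive_fun (fun v => etens u v : env A) by move=> x y; exact: tensDr.
have Z c (u : A^o) (v : (A^c)^o) :
    etens (alg_scalar A c *: u : A^o) v
      = etens u ((alg_scalar A c : A^c) *: v : (A^c)^o) :> env A.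
  have -> : (alg_scalar A c *: u : A^o) = (u : A) * alg_scalar A c :> A.
    exact: alg_central.
  have -> : ((alg_scalar A c : A^c) *: v : (A^c)^o) = alg_scalar A c * (v : A) :> A.
    exact: (esym (alg_central c (v : A))).
  exact: (@tensZ k (kright A) (kleft A) c u v).
pose q : bimod A^o (A^c)^o -> (env A)^o := bilift (U := A^o) (V := (A^c)^o) (@etens _ A).
pose one : bimod A^o (A^c)^o := bitens (1 : A^o) (1 : (A^c)^o).
have qE u v : q (bitens u v) = etens u v.
  exact: (@biliftE k A A^o (A^c)^o (env A) _ Dl Dr Z).
have qD : additive_fun q := @biliftD k A A^o (A^c)^o (env A) _ Dl Dr Z.
apply: (retract_local (j := fun r : (env A)^o => (r : env A) *: one) (q := q)).
- by split=> [x y|a x]; rewrite ?scalerDl ?scalerA.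
- apply: bimod_linear qD _ => a b u v; rewrite !qE.
  exact: (esym (env_mulE _ _ _ _)).
- apply: bimod_ext => [x y|//|u v]; first by rewrite qD scalerDl.
  rewrite qE [LHS]bimod_scaleE; congr (bitens _ _); first exact: (@mulr1 A).
  exact: (@mul1r A).
Qed.
End BimodMaps.

(* Tor^{A^e}(A, U (x)_k V) is Tor^A(V, U): in degree 0 this is the isomorphism
   [bt_to], and higher degrees follow by shifting first in V, then in U. *)
Section BimodTor.
Variables (k : fieldType) (A : algebra k).
Local Notation AR := (env_right A : lmodType (env A)^c).

Section Iso.
Variables (U : lmodType A) (V : lmodType A^c).

Let inner (x : AR) : bimod U V -> tensor V U :=
  bilift (fun u v => tens v ((x : A) *: u)).

Let innerP x : (forall u v, inner x (bitens u v) = tens v ((x : A) *: u))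
  /\ additive_fun (inner x).
Proof.
have Dl v : additive_fun (fun u : U => tens (v : V) ((x : A) *: u)).
  by move=> y z; rewrite scalerDr tensDr.
have Dr (u : U) : additive_fun (fun v : V => tens v ((x : A) *: u)).
  by move=> y z; rewrite tensDl.
have Z c (u : U) (v : V) : tens v ((x : A) *: (alg_scalar A c *: u)) =
                           tens ((alg_scalar A c : A^c) *: v) ((x : A) *: u).
  by rewrite tensZ !scalerA alg_central.
pose b (u : U) (v : V) := tens v ((x : A) *: u).
by split=> [u v|]; [exact: (@biliftE _ _ U V _ b Dl Dr Z)|exact: (@biliftD _ _ U V _ b Dl Dr Z)].
Qed.

Let inner_balanced : balanced inner.
Proof.
split=> [w x y|x|r x w].
- move: w; apply: bimod_ext => [|u v|u v].
  + exact: (proj2 (innerP _)).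
  + by rewrite !(proj2 (innerP _)) addrACA.
  + by rewrite !(proj1 (innerP _)) scalerDl tensDr.
- exact: (proj2 (innerP x)).
elim/env_ind: r => [|r s IHr IHs|a b].
- have -> : (0 : (env A)^c) *: x = 0 by rewrite scale0r.
  rewrite scale0r (additive_fun0 (proj2 (innerP x))); move: w.
  apply: bimod_ext => [|u v|u v]; rewrite ?addr0 //.
    exact: (proj2 (innerP _)).
  by rewrite (proj1 (innerP _)) scale0r tens0r.
- have -> : ((r + s : env A) : (env A)^c) *: x
           = ((r : (env A)^c) *: x) + ((s : (env A)^c) *: x) by rewrite -scalerDl.
  rewrite scalerDl (proj2 (innerP x)) -IHr -IHs; move: w {IHr IHs}.
  apply: bimod_ext => [|u v|u v].
  + exact: (proj2 (innerP _)).
  + by rewrite !(proj2 (innerP _)) addrACA.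
  + by rewrite !(proj1 (innerP _)) scalerDl tensDr.
have -> : (etens a b : (env A)^c) *: x = (b * (x : A) * a : A) by exact: env_ractE.
move: w; apply: bimod_ext => [|u v|u v].
- exact: (proj2 (innerP _)).
- by rewrite scalerDr (proj2 (innerP x)).
- by rewrite [_ *: bitens u v]bimod_scaleE !(proj1 (innerP _)) tensZ !scalerA.
Qed.

Definition bt_to : tensor AR (bimod U V) -> tensor V U := tens_lift inner.

Lemma bt_toE x u v : bt_to (tens x (bitens u v)) = tens v ((x : A) *: u).
Proof. by rewrite /bt_to (tens_liftE _ _ inner_balanced) (proj1 (innerP x)). Qed.
Lemma bt_toD : additive_fun bt_to.
Proof. exact: tens_lift_additive inner_balanced. Qed.

Let outer (v : V) (u : U) : tensor AR (bimod U V) := tens ((1 : A) : AR) (bitens u v).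

Let outer_balanced : balanced outer.
Proof.
split=> [u v v'|v u u'|a v u].
- by rewrite /outer bitensDr tensDr.
- by rewrite /outer bitensDl tensDr.
have -> : outer ((a : A^c) *: v) u = tens ((a : A) : AR) (bitens u v).
  rewrite /outer; have -> : bitens u ((a : A^c) *: v) = etens 1 a *: bitens u v.
    by rewrite [RHS]bimod_scaleE scale1r.
  rewrite -(tensZ (etens 1 a)); congr tens.
  by rewrite [LHS]env_ractE !mulr1.
rewrite /outer; have <- : etens a 1 *: bitens u v = bitens (a *: u) v.
  by rewrite [LHS]bimod_scaleE scale1r.
rewrite -[RHS](tensZ (etens a 1)); congr tens.
by rewrite [RHS]env_ractE !mul1r.
Qed.

Definition bt_of : tensor V U -> tensor AR (bimod U V) := tens_lift outer.

Lemma bt_ofD : additive_fun bt_of.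
Proof. exact: tens_lift_additive outer_balanced. Qed.

Lemma bt_toK : cancel bt_to bt_of.
Proof.
apply: tens_ext => [x y|//|x w]; first by rewrite bt_toD bt_ofD.
move: w; apply: bimod_ext => [w w'|w w'|u v].
- by rewrite tensDr bt_toD bt_ofD.
- exact: tensDr.
rewrite bt_toE /bt_of (tens_liftE _ _ outer_balanced) /outer.
have <- : etens (x : A) 1 *: bitens u v = bitens ((x : A) *: u) v.
  by rewrite [LHS]bimod_scaleE scale1r.
rewrite -[LHS](tensZ (etens (x : A) 1)); congr tens.
by rewrite [LHS]env_ractE !mul1r.
Qed.

Lemma bt_to_mono : mono bt_to.
Proof. exact: eq_retract_mono bt_ofD bt_toK. Qed.
End Iso.

Lemma bt_mono_left (U' U : lmodType A) (V : lmodType A^c) (i : U' -> U) :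
  linear_fun i -> mono (tmap (@id V) i) -> mono (tmap (@id AR) (bimod_map i (@id V))).
Proof.
move=> iP m; have bP := bimod_map_linear iP (linear_fun_id V).
apply: (mono_factor (@bt_toD U V) _ (@bt_to_mono U' V) m) => z.
move: z; apply: tens_ext => [x y|x y|x w].
- by rewrite (tmaprD bP) bt_toD.
- by rewrite bt_toD (tmaprD iP).
rewrite (tmaprE bP); move: w; apply: bimod_ext => [w w'|w w'|u v].
- by rewrite bimod_mapD // tensDr bt_toD.
- by rewrite tensDr bt_toD (tmaprD iP).
rewrite (bimod_mapE iP (linear_fun_id V)) !bt_toE (tmaprE iP).
by have [_ iZ] := iP; rewrite iZ.
Qed.

Lemma bt_mono_right (U : lmodType A) (V' V : lmodType A^c) (i : V' -> V) :
  rsemilinear_fun id i -> mono (tmap i (@id U)) ->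
  mono (tmap (@id AR) (bimod_map (@id U) i)).
Proof.
move=> iP m; have bP := bimod_map_linear (linear_fun_id U) iP.
apply: (mono_factor (@bt_toD U V) _ (@bt_to_mono U V') m) => z.
move: z; apply: tens_ext => [x y|x y|x w].
- by rewrite (tmaprD bP) bt_toD.
- by rewrite bt_toD (tmaplD iP).
rewrite (tmaprE bP); move: w; apply: bimod_ext => [w w'|w w'|u v].
- by rewrite bimod_mapD // tensDr bt_toD.
- by rewrite tensDr bt_toD (tmaplD iP).
by rewrite (bimod_mapE (linear_fun_id U) iP) !bt_toE (tmaplE iP).
Qed.

Lemma TorV_bimod_free n (I J : choiceType) :
  TorV n AR (bimod (free_module A I) (free_module A^c J)).
Proof.
apply: TorV_local_right (bimod_local_left _ (free_local A I)) _.
apply: TorV_local_right (bimod_local_right _ (free_local A^c J)) _.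
exact: TorV_local_right (bimod_regular A) (TorV_regular_right _ _).
Qed.

Lemma TorV_bimod_free_left n (I : choiceType) (V : lmodType A^c) :
  TorV n AR (bimod (free_module A I) V).
Proof.
elim: n V => [|n IH] V.
  apply: (mono_TorV0_right (bimod_ses_right _ (ses_cover V))) (TorV_bimod_free 0 _ _).
  apply: bt_mono_right (ses_i (ses_cover V)) _.
  exact: free_mono_right (ses_i (ses_cover V)) (ses_mono (ses_cover V)).
exact: (TorV_ses_right (bimod_ses_right _ (ses_cover V)) (TorV_bimod_free _ _ _) (IH _)).
Qed.

Lemma TorV_bimod n (U : lmodType A) (V : lmodType A^c) :
  (forall j, TorV j V U) -> TorV n AR (bimod U V).
Proof.
elim: n U => [|n IH] U h.
  apply: (mono_TorV0_right (bimod_ses_left V (ses_cover U))) (TorV_bimod_free_left 0 _ _).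
  apply: bt_mono_left (ses_i (ses_cover U)) _.
  exact: TorV0_mono_right (ses_cover U) _ (h 0%N).
apply: (TorV_ses_right (bimod_ses_left V (ses_cover U)) (TorV_bimod_free_left _ _ _)).
by apply: IH => j; apply/TorV_shift.
Qed.
End BimodTor.

(** * Enveloping algebras and Hochschild homology *)

(** The involution of R carries R psi(1) to psi(1) R compatibly with that of S, so acyclicity of
    right modules can be deduced from the case of left modules. *)
Lemma swap_regular (S R : pzRingType) (sgS : nuhom S S^c) (sgR : nuhom R R^c)
    (psi : nuhom S R) :
  (forall x, sgS (sgS x : S) = x) -> (forall x, sgR (sgR x : R) = x) ->
  (forall x, sgR (psi x) = psi (sgS x : S)) ->
  local_retract (res sgS (res (nu_conv psi) (R^c)^o)) (res psi R^o).
Proof.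
move=> SK RK comm.
have sM x y : sgR (x * y) = (sgR y : R) * (sgR x : R) :> R by exact: (nuM sgR).
apply: (retract_local
  (j := fun x : res psi R^o =>
     to_res sgS (to_res (nu_conv psi) (sgR (res_val x : R) : (R^c)^o)))
  (q := fun x : res sgS (res (nu_conv psi) (R^c)^o) =>
     to_res psi ((sgR (res_val (res_val x) : R) : R) : R^o))).
- split=> [x y|a x].
    rewrite -[RHS]to_resD; congr (to_res _ _); rewrite -[RHS]to_resD; congr (to_res _ _).
    exact: (nuD sgR (res_val x) (res_val y)).
  rewrite -to_resZ -(to_resZ (nu_conv psi)); congr (to_res _ (to_res _ _)).
  change (sgR (psi a * (res_val x : R))
    = (sgR (res_val x : R) : R) * psi (sgS a : S) :> R).
  by rewrite sM comm.
- split=> [x y|a x].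
    rewrite -[RHS]to_resD; congr (to_res _ _).
    exact: (nuD sgR (res_val (res_val x)) (res_val (res_val y))).
  rewrite -to_resZ; congr (to_res _ _).
  have -> : res_val (res_val (a *: x)) = ((res_val (res_val x) : R) * psi (sgS a : S) : R).
    by [].
  by rewrite sM comm SK.
- move=> x; rewrite -[RHS]to_resK -[X in _ = to_res _ X]to_resK.
  congr (to_res _ _); apply: val_inj.
  change ((sgR (psi 1 * (sgR (res_val (res_val x) : R) : R)) : R) * psi 1
    = (res_val (res_val x) : R) * psi 1 :> R).
  rewrite sM RK comm (sg1 SK).
  by rewrite -mulrA -nuM mulr1.
Qed.

(** * Functoriality of the enveloping algebra along non-unital maps *)

Section EnvMap.
Variables (k : fieldType) (A E : algebra k) (phi : nuhom A E).

(** Compatibility with scalars cannot be stated on scalars alone, since phi(c) is c phi(1) and not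
    c. *)
Definition klinear_hom : Prop :=
  forall c x, phi (alg_scalar A c * x) = alg_scalar E c * phi x.
Hypothesis phik : klinear_hom.

Let kl : linear_fun (phi : kleft A -> kleft E).
Proof. by split; [exact: nuD|exact: phik]. Qed.
Let kr : linear_fun (phi : kright A -> kright E).
Proof.
split=> [|c x]; first exact: nuD.
change (phi ((x : A) * alg_scalar A c) = phi x * alg_scalar E c).
by rewrite -!alg_central phik.
Qed.

Definition env_fun : env A -> env E :=
  tmap (phi : kright A -> kright E) (phi : kleft A -> kleft E).

Lemma env_funE a b : env_fun (etens a b) = etens (phi a) (phi b).
Proof. exact: (@tmapE k k id _ _ _ _ _ _ kr kl). Qed.
Lemma env_funD : additive_fun env_fun.
Proof. exact: (@tmapD k k id _ _ _ _ _ _ kr kl). Qed.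
Lemma env_funM x y : env_fun (x * y) = env_fun x * env_fun y.
Proof.
have f0 := additive_fun0 env_funD.
elim/env_ind: x => [|u v IHu IHv|a b].
- by rewrite mul0r f0 mul0r.
- by rewrite mulrDl !env_funD mulrDl IHu IHv.
elim/env_ind: y => [|u v IHu IHv|c d].
- by rewrite mulr0 f0 mulr0.
- by rewrite mulrDr !env_funD mulrDr IHu IHv.
by rewrite [_ * _]env_mulE !env_funE [RHS]env_mulE !nuM.
Qed.
Definition env_map : nuhom (env A) (env E) := NuHom env_funD env_funM.

Lemma env_left_semilinear :
  semilinear_fun env_map (phi : env_left A -> env_left E).
Proof.
split=> [|u x]; first exact: nuD.
elim/env_ind: u => [|u v IHu IHv|a b].
- by rewrite (additive_fun0 (nuD env_map)) !scale0r (additive_fun0 (nuD phi)).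
- by rewrite (nuD env_map) !scalerDl -IHu -IHv; exact: nuD.
- rewrite [env_map _]env_funE.
  rewrite [LHS](congr1 phi (env_lactE a b x)) [RHS]env_lactE.
  by rewrite !nuM.
Qed.

Lemma env_right_semilinear :
  rsemilinear_fun env_map (phi : env_right A -> env_right E).
Proof.
split=> [|u x]; first exact: nuD.
elim/env_ind: u => [|u v IHu IHv|a b].
- rewrite (additive_fun0 (nuD env_map)).
  transitivity (phi 0); last by rewrite (additive_fun0 (nuD phi)) [RHS]scale0r.
  by congr (phi _); exact: (scale0r x).
- rewrite (nuD env_map) [RHS](scalerDl (R := (env E)^c)) -IHu -IHv.
  by rewrite -[RHS](nuD phi); congr (phi _); exact: (@scalerDl (env A)^c (env_right A) x u v).
- rewrite [env_map _]env_funE.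
  rewrite [LHS](congr1 phi (env_ractE a b x)) [RHS]env_ractE.
  by rewrite !nuM.
Qed.

Section Regular.
Local Notation U := (res phi E^o).
Local Notation V := (res (nu_conv phi) (E^c)^o).

Let toU (x : E) : U := to_res phi (x : E^o).
Let toV (x : E) : V := to_res (nu_conv phi) (x : (E^c)^o).

Let phi1k c (x : E) : phi 1 * (alg_scalar E c * x) = phi (alg_scalar A c) * x.
Proof.
by rewrite -[alg_scalar A c]mulr1 phik mulrA -alg_central.
Qed.

Let toUZ c x : toU (alg_scalar E c * x) = alg_scalar A c *: toU x.
Proof.
rewrite /toU -to_resZ; apply: val_inj.
change (phi 1 * (alg_scalar E c * x) = phi 1 * (phi (alg_scalar A c) * x)).
by rewrite phi1k mulrA -nuM mul1r.
Qed.

Let toVZ c x : toV (x * alg_scalar E c) = (alg_scalar A c : A^c) *: toV x.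
Proof.
rewrite /toV -to_resZ; apply: val_inj.
change ((x * alg_scalar E c) * phi 1 = (x * phi (alg_scalar A c)) * phi 1).
rewrite -!mulrA -nuM mulr1; congr (x * _).
by rewrite -[alg_scalar A c]mulr1 phik.
Qed.

Let qb : @balanced k (kright E) (kleft E) (bimod U V)
  (fun a b => bitens (toU a) (toV b)).
Proof.
split=> [b a a'|a b b'|c a b].
- by rewrite /toU to_resD bitensDl.
- by rewrite /toV to_resD bitensDr.
have -> : ((c : k^c) *: a : kright E) = alg_scalar E c * (a : E) :> E.
  exact: (esym (alg_central c (a : E))).
have -> : (c *: b : kleft E) = (b : E) * alg_scalar E c :> E by exact: alg_central.
by rewrite toUZ toVZ bitensZ.
Qed.

(** Cutting E^e by phi(1) (x) phi(1) leaves phi(1)E (x)_k E phi(1), so [TorV_bimod] reduces Tor of A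
    against restricted free E^e-modules to Tor^A(E phi(1), phi(1)E). *)
Lemma bimod_regular_res :
  local_retract (res env_map (env E)^o) (bimod U V).
Proof.
pose j0 (u : U) (v : V) : res env_map (env E)^o :=
  to_res env_map (etens (res_val u : E) (res_val v : E) : (env E)^o).
have etDl (v : E) : additive_fun (fun u : E => etens u v : env E).
  by move=> x y; exact: tensDl.
have etDr (u : E) : additive_fun (fun v : E => etens u v : env E).
  by move=> x y; exact: tensDr.
have j0Dl v : additive_fun (j0^~ v).
  by move=> x y; rewrite /j0 -to_resD; congr to_res; exact: etDl.
have j0Dr u : additive_fun (j0 u).
  by move=> x y; rewrite /j0 -to_resD; congr to_res; exact: etDr.
have j0Z a b u v : j0 (a *: u) ((b : A^c) *: v) = etens a b *: j0 u v.
  rewrite /j0 -to_resZ; congr to_res; rewrite [env_map _]env_funE.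
  exact: (esym (env_mulE _ _ _ _)).
have j0k c u v : j0 (alg_scalar A c *: u) v = j0 u ((alg_scalar A c : A^c) *: v).
  rewrite -[v in LHS](scale1r v) -[u in RHS](scale1r u) !j0Z; congr (_ *: _).
  rewrite -[X in etens X 1]mul1r -[X in _ = etens _ X]mulr1.
  exact: (@tensZ k (kright A) (kleft A) c 1 1).
pose j := bilift j0.
have jE u v : j (bitens u v) = j0 u v by exact: biliftE.
have jD : additive_fun j by exact: biliftD.
pose q0 := @tens_lift k (kright E) (kleft E) (bimod U V)
  (fun a b => bitens (toU a) (toV b)).
have q0E a b : q0 (etens a b) = bitens (toU a) (toV b) by exact: (tens_liftE _ _ qb).
have q0D : additive_fun q0 := tens_lift_additive qb.
apply: (retract_local (j := j) (q := fun x => q0 (res_val x))).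
- by apply: bimod_linear => // a b u v; rewrite !jE j0Z.
- apply: env_linear => [x y|a b x].
    exact: (q0D (res_val x) (res_val y)).
  change (q0 (env_map (etens a b) * (res_val x : env E))
          = etens a b *: q0 (res_val x)).
  rewrite [env_map _]env_funE; move: (res_val x : env E).
  elim/env_ind => [|u v IHu IHv|c d].
  + by rewrite mulr0 (additive_fun0 q0D) scaler0.
  + by rewrite mulrDr !q0D scalerDr IHu IHv.
  rewrite [_ * _]env_mulE !q0E [RHS]bimod_scaleE; congr bitens.
    exact: (to_resZ phi a (c : E^o)).
  exact: (to_resZ (nu_conv phi) b (d : (E^c)^o)).
- move=> x; rewrite -[RHS]to_resK; move: (res_val x : env E).
  elim/env_ind => [|u v IHu IHv|a b].
  + by rewrite (additive_fun0 q0D) (additive_fun0 jD) (additive_fun0 (to_resD env_map (X := (env E)^o))).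
  + by rewrite q0D jD IHu IHv -to_resD.
  rewrite q0E jE /j0; apply: val_inj.
  change (env_fun (etens 1 1) * etens (phi 1 * a) (b * phi 1)
          = env_fun (etens 1 1) * etens a b :> env E).
  rewrite env_funE [LHS]env_mulE [RHS]env_mulE mulrA -nuM mul1r.
  by rewrite -mulrA -nuM mul1r.
Qed.
End Regular.
End EnvMap.

Lemma env_map_cancel (k : fieldType) (A E : algebra k) (phi : nuhom A E)
    (psi : nuhom E A) (phik : klinear_hom phi) (psik : klinear_hom psi) :
  cancel phi psi -> cancel (env_map phik) (env_map psik).
Proof.
move=> phiK x; elim/env_ind: x => [|u v IHu IHv|a b].
- by rewrite (additive_fun0 (nuD _)) (additive_fun0 (nuD _)).
- by rewrite !nuD IHu IHv.
- by rewrite [env_map phik _](env_funE phik) [LHS](env_funE psik) !phiK.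
Qed.

Section EnvSwap.
Variables (k : fieldType) (A : algebra k).

Let sb : @balanced k (kright A) (kleft A) (env A) (fun a b => etens (b : A) (a : A)).
Proof.
split=> [b a a'|a b b'|c a b].
- exact: tensDr.
- exact: tensDl.
- have -> : ((c : k^c) *: a : kright A) = alg_scalar A c * (a : A) :> A.
    exact: (esym (alg_central c (a : A))).
  have -> : (c *: b : kleft A) = (b : A) * alg_scalar A c :> A by exact: alg_central.
  exact: (esym (@tensZ k (kright A) (kleft A) c b a)).
Qed.

Definition env_sw : env A -> env A :=
  @tens_lift k (kright A) (kleft A) (env A) (fun a b => etens (b : A) (a : A)).
Lemma env_swE a b : env_sw (etens a b) = etens b a.
Proof. exact: (tens_liftE _ _ sb). Qed.
Lemma env_swD : additive_fun env_sw.
Proof. exact: tens_lift_additive sb. Qed.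
Lemma env_swM x y : env_sw (x * y) = env_sw y * env_sw x.
Proof.
have f0 := additive_fun0 env_swD.
elim/env_ind: x => [|u v IHu IHv|a b].
- by rewrite mul0r f0 mulr0.
- by rewrite mulrDl !env_swD mulrDr IHu IHv.
elim/env_ind: y => [|u v IHu IHv|c d].
- by rewrite mulr0 f0 mul0r.
- by rewrite mulrDr !env_swD mulrDl IHu IHv.
by rewrite [_ * _]env_mulE !env_swE [RHS]env_mulE.
Qed.
Lemma env_swK : involutive env_sw.
Proof.
move=> x; elim/env_ind: x => [|u v IHu IHv|a b].
- by rewrite !(additive_fun0 env_swD).
- by rewrite !env_swD IHu IHv.
- by rewrite !env_swE.
Qed.

Definition env_sg : nuhom (env A) (env A)^c :=
  @NuHom (env A) (env A)^c env_sw env_swD env_swM.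

Lemma env_left_right (x : env A) (y : A) :
  (env_sw x : (env A)^c) *: (y : env_right A) = x *: (y : env_left A) :> A.
Proof.
elim/env_ind: x => [|u v IHu IHv|a b].
- by rewrite (additive_fun0 env_swD) [LHS]scale0r [RHS]scale0r.
- by rewrite env_swD [LHS](scalerDl (R := (env A)^c)) [RHS]scalerDl IHu IHv.
- by rewrite env_swE [LHS]env_ractE [RHS]env_lactE.
Qed.
End EnvSwap.

(** * Vanishing of Hochschild homology in terms of [TorV] *)

Section Hochschild.
Variables (k : fieldType).
Local Notation AR A := (env_right A : lmodType (env A)^c).
Local Notation AL A := (env_left A : lmodType (env A)).

Lemma HH_finiteP (A : algebra k) :
  HH_finite A <-> exists N, forall n, (N <= n)%N -> TorV n (AR A) (AL A).
Proof.
split=> -[N h]; exists N => n Nn; first exact/Tor_TorV/h.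
by case: n Nn => // n Nn; apply/Tor_TorV/h.
Qed.

Lemma HH_retract (A E : algebra k) (phi : nuhom A E) (psi : nuhom E A) :
  klinear_hom phi -> klinear_hom psi -> cancel phi psi -> forall n,
  TorV n (AR E) (AL E) -> TorV n (AR A) (AL A).
Proof.
move=> phik psik phiK n; apply: TorV_retract (env_map_cancel phik psik phiK) _ _ _ _ _ _.
- exact: (phiK : cancel (phi : AR A -> AR E) psi).
- exact: (phiK : cancel (phi : AL A -> AL E) psi).
- exact: env_right_semilinear.
- exact: env_right_semilinear.
- exact: env_left_semilinear.
- exact: env_left_semilinear.
Qed.

Section Acyclic.
Variables (A E : algebra k) (phi : nuhom A E) (phik : klinear_hom phi).
Hypothesis acyc : forall j, TorV j (res (nu_conv phi) (E^c)^o) (res phi E^o).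

Lemma TorV_env_free_right (I : choiceType) n :
  TorV n (AR A) (res (env_map phik) (free_module (env E) I)).
Proof.
apply: TorV_local_right (res_local (env_map phik) (free_local _ I)) _.
apply: TorV_local_right (bimod_regular_res phik) _.
exact: TorV_bimod.
Qed.

(** The involution a (x) b |-> b (x) a exchanges the two bimodule structures on A and turns this
    into a statement about restricted free left modules in the second argument. *)
Lemma TorV_env_free_left (I : choiceType) n :
  TorV n (res (nu_conv (env_map phik)) (free_module (env E)^c I)) (AL A).
Proof.
apply: (@TorV_swap _ (env_sg A) (@env_swK k A)).
apply: (@TorV_local_left _ _ _ (AR A)).
  apply: (retract_local (j := fun x : AR A => to_res (sg_conv (env_sg A)) (x : AL A))
            (q := fun x => res_val x : AR A)).
  - split=> [x y|a x]; first exact: to_resD.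
    rewrite -to_resZ; congr to_res.
    have := env_left_right (env_sw a) x; rewrite env_swK => ->; exact: erefl.
  - split=> // a x.
    have := env_left_right (env_sw a) (res_val x); rewrite env_swK => ->; exact: erefl.
  - by move=> x; exact: to_resK.
apply: TorV_local_right (res_local _ (res_local _ (free_local (env E)^c I))) _.
apply: (TorV_local_right (Y := res (env_map phik) (env E)^o)); last first.
  apply: TorV_local_right (bimod_regular_res phik) _; exact: TorV_bimod.
have swmap x : env_sw (env_map phik x) = env_map phik (env_sw x).
  elim/env_ind: x => [|u v IHu IHv|a b].
  - by rewrite (additive_fun0 (nuD _)) !(additive_fun0 (@env_swD _ _)) (additive_fun0 (nuD _)).
  - by rewrite (nuD (env_map phik)) !env_swD IHu IHv -(nuD (env_map phik)).
  - by rewrite [env_map phik _](env_funE phik) !env_swE [RHS](env_funE phik).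
exact: (@swap_regular _ _ (env_sg A) (env_sg E) (env_map phik) (@env_swK k A) (@env_swK k E) swmap).
Qed.
End Acyclic.
End Hochschild.

(** * Projective dimension *)

Section ProjectiveDimension.
Variable R : pzRingType.
Implicit Types U V W X P K : lmodType R.

Lemma projective_lift P U V (g : U -> V) (h : P -> V) : projective P ->
  linear_fun g -> linear_fun h -> (forall v, exists u, g u = v) ->
  exists h' : P -> U, linear_fun h' /\ forall x, g (h' x) = h x.
Proof.
move=> Pp /linear_fun_bundle[g' gE] /linear_fun_bundle[h' hE] gs.
have [|l lE] := Pp _ _ g' h'; first by move=> v; have [u <-] := gs v; exists u.
exists l; split=> [|x]; first exact: linear_fun_linear.
by rewrite -gE lE hE.
Qed.

Lemma lift_projective P :
  (forall U V (g : U -> V) (h : P -> V), linear_fun g -> linear_fun h ->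
     (forall v, exists u, g u = v) ->
     exists h' : P -> U, linear_fun h' /\ forall x, g (h' x) = h x) ->
  projective P.
Proof.
move=> lift U V g h gs.
have [l [lP lE]] := lift _ _ _ _ (linear_fun_linear g) (linear_fun_linear h) gs.
have [l' l'E] := linear_fun_bundle lP.
by exists l' => x; rewrite l'E.
Qed.

Lemma projective_local P : projective P -> local_retract P (free_module R P).
Proof.
move=> Pp; have [l [lP lE]] := projective_lift Pp (ses_p (ses_cover P))
  (linear_fun_id P) (ses_surj (ses_cover P)).
exact: retract_local (ses_p (ses_cover P)) lP lE.
Qed.

Lemma trivial_projective X : trivial_group X -> projective X.
Proof.
move=> X0 U V g h gs; have [z zE] : exists z : {linear X -> U}, z =1 (fun=> 0).
  by apply: linear_fun_bundle; split=> [x y|a x]; rewrite ?addr0 ?scaler0.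
by exists z => x; rewrite zE (X0 x) !linear0.
Qed.

Lemma prod_projective P Q : projective P -> projective Q ->
  projective (P * Q : lmodType R)%type.
Proof.
move=> Pp Qp; apply: lift_projective => U V g h gP [hD hZ] gs.
have fstP : linear_fun (fun x : P => h (x, 0)).
  split=> [x y|a x]; first by rewrite -hD; congr h; congr pair; rewrite addr0.
  by rewrite -hZ; congr h; congr pair; rewrite scaler0.
have sndP : linear_fun (fun x : Q => h (0, x)).
  split=> [x y|a x]; first by rewrite -hD; congr h; congr pair; rewrite addr0.
  by rewrite -hZ; congr h; congr pair; rewrite scaler0.
have [l [[lD lZ] lE]] := projective_lift Pp gP fstP gs.
have [m [[mD mZ] mE]] := projective_lift Qp gP sndP gs.
exists (fun x => l x.1 + m x.2); split=> [|x].
  split=> [x y|a x] /=; first by rewrite lD mD addrACA.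
  by rewrite lZ mZ scalerDr.
rewrite (proj1 gP) lE mE -hD; congr h; case: x => x y.
by congr pair; rewrite ?addr0 ?add0r.
Qed.

(* The cover in the definition is existential, so no comparison of different
   resolutions (Schanuel's lemma) is needed below. *)
Fixpoint pd_le (d : nat) (X : lmodType R) : Prop :=
  if d is d'.+1 then
    exists (K P : lmodType R) (i : K -> P) (p : P -> X),
      [/\ projective P, ses i p & pd_le d' K]
  else projective X.

Lemma pd_leS d X : pd_le d X -> pd_le d.+1 X.
Proof.
elim: d X => [|d IH] X; last first.
  by move=> [K [P [i [p [Pp e /IH h]]]]]; exists K, P, i, p.
move=> Xp; pose f : {linear X -> X} := idfun.
exists (lker f), X, (@lker_val _ _ _ f), f; split=> //.
  by apply: ses_lker => x; exists x.
by apply: trivial_projective => -[x x0]; apply: val_inj => /=; exact: (eqP x0).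
Qed.

Lemma pd_le_leq d d' X : (d <= d')%N -> pd_le d X -> pd_le d' X.
Proof.
by move=> /subnK <-; elim: (d' - d)%N => // n IH h; rewrite addSn; exact/pd_leS/IH.
Qed.

Section Extension.
Variables (U V W : lmodType R) (i : U -> V) (p : V -> W) (e : ses i p).

Lemma ses_projective : projective U -> projective W -> projective V.
Proof.
move=> Up Wp; apply: lift_projective => E F g h gP hP gs.
have [iP pP] := (ses_i e, ses_p e); have [[iD iZ] [pD pZ]] := (iP, pP).
have iI := mono_injective iD (ses_mono e).
have [s [sP sK]] := projective_lift Wp pP (linear_fun_id W) (ses_surj e).
have [[sD sZ] [hD hZ]] := (sP, hP).
have [r rE] : exists r : V -> U, forall v, i (r v) = v - s (p v).
  have ex v : exists u, i u = v - s (p v).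
    by apply: (ses_ker e); rewrite (additive_funB pD) sK subrr.
  by have [r rE] := choice ex; exists r.
have [l [[lD lZ] lE]] := projective_lift Up gP (linear_fun_comp iP hP) gs.
have [m [[mD mZ] mE]] := projective_lift Wp gP (linear_fun_comp sP hP) gs.
exists (fun v => l (r v) + m (p v)); split=> [|v]; last first.
  by rewrite (proj1 gP) lE mE /= -hD rE subrK.
have rD : additive_fun r.
  by move=> x y; apply: iI; rewrite iD !rE pD sD opprD addrACA.
have rZ a x : r (a *: x) = a *: r x.
  by apply: iI; rewrite iZ !rE pZ sZ scalerBr.
by split=> [x y|a x]; rewrite ?rD ?pD ?lD ?mD ?rZ ?pZ ?lZ ?mZ ?scalerDr // addrACA.
Qed.
End Extension.

(* Horseshoe lemma. *)
Lemma ses_pd_le d U V W (i : U -> V) (p : V -> W) : ses i p ->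
  pd_le d U -> pd_le d W -> pd_le d V.
Proof.
elim: d U V W i p => [|d IH] U V W i p e; first exact: ses_projective e.
move=> [K' [P' [i' [p' [Pp' e' h']]]]] [K'' [P'' [i'' [p'' [Pp'' e'' h'']]]]].
have [iP pP] := (ses_i e, ses_p e); have [[iD iZ] [pD pZ]] := (iP, pP).
have [[iD' iZ'] [pD' pZ']] := (ses_i e', ses_p e').
have [[iD'' iZ''] [pD'' pZ'']] := (ses_i e'', ses_p e'').
have [l [[lD lZ] lE]] := projective_lift Pp'' pP (ses_p e'') (ses_surj e).
have [q qE] : exists q : {linear (P' * P'')%type -> V},
    q =1 (fun x => i (p' x.1) + l x.2).
  apply: linear_fun_bundle; split=> [x y|a x] /=.
    by rewrite pD' iD lD addrACA.
  by rewrite pZ' iZ lZ scalerDr.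
have qs v : exists x, q x = v.
  have [b bE] := ses_surj e'' (p v).
  have [u uE] : exists u, i u = v - l b.
    by apply: (ses_ker e); rewrite (additive_funB pD) lE bE subrr.
  have [a aE] := ses_surj e' u.
  by exists (a, b); rewrite qE /= aE uE subrK.
exists (lker q), (P' * P'')%type, (@lker_val _ _ _ q), q; split.
- exact: prod_projective.
- exact: ses_lker.
have ja x : in_lker q (i' x, 0).
  by rewrite /in_lker qE /= (ses_pi e') (additive_fun0 iD) (additive_fun0 lD) addr0.
pose j x : lker q := LKer (ja x).
have pq (x : lker q) : p'' (\val x).2 = 0.
  case: x => x /= /eqP; rewrite qE -lE => /(congr1 p).
  by rewrite pD (ses_pi e) add0r => ->; rewrite (additive_fun0 pD).
have [r rE] : exists r : lker q -> K'', forall x, i'' (r x) = (\val x).2.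
  by have [r rE] := choice (fun x => ses_ker e'' (pq x)); exists r.
have iI'' := mono_injective iD'' (ses_mono e'').
(* The kernel of [q] is again an extension, of K'' by K', as in the snake lemma. *)
apply: (IH _ _ _ j r) => //; split.
- split=> [x y|a x]; apply: val_inj => /=; congr pair.
  + exact: iD'. + by rewrite addr0. + exact: iZ'. + by rewrite scaler0.
- by split=> [x y|a x]; apply: iI''; rewrite ?iD'' ?iZ'' !rE.
- by move=> x /(congr1 (fun y : lker q => (\val y).1)) /= /(ses_mono e').
- by move=> x; apply: iI''; rewrite rE (additive_fun0 iD'').
- move=> x rx; have x2 : (\val x).2 = 0 by rewrite -rE rx (additive_fun0 iD'').
  have [y yE] : exists y, i' y = (\val x).1.
    apply: (ses_ker e'); apply: (ses_mono e).
    case: x x2 {rx} => x /= /eqP; rewrite qE => + x2.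
    by rewrite x2 (additive_fun0 lD) addr0.
  exists y; apply: val_inj => /=; rewrite yE -x2.
  exact: (esym (surjective_pairing _)).
- move=> y; have [u uE] : exists u, i u = l (i'' y).
    by apply: (ses_ker e); rewrite lE (ses_pi e'').
  have [a aE] := ses_surj e' u.
  have x0 : in_lker q (- a, i'' y).
    by rewrite /in_lker qE /= (additive_funN pD') (additive_funN iD) aE uE addNr.
  by exists (LKer x0); apply: iI''; rewrite rE.
Qed.

(** A projective P onto V with kernel K also maps onto W, and the kernel there is an extension of U
    by K, to which the horseshoe lemma applies. For d = 0 the sequence itself is the resolution. *)
Lemma ses_pd_le_quot d U V W (i : U -> V) (p : V -> W) : ses i p ->
  pd_le d U -> pd_le d V -> pd_le d.+1 W.
Proof.
case: d => [|d] e hU; first by move=> hV; exists U, V, i, p.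
move=> [K [P [j [q [Pp e' h]]]]].
have [[pD pZ] [qD qZ]] := (ses_p e, ses_p e').
have iI := mono_injective (proj1 (ses_i e)) (ses_mono e).
have [w wE] := linear_fun_bundle (linear_fun_comp (ses_p e') (ses_p e)).
have ws v : exists x, w x = v.
  have [v' <-] := ses_surj e v; have [x <-] := ses_surj e' v'.
  by exists x; rewrite wE.
exists (lker w), P, (@lker_val _ _ _ w), w; split=> //; first exact: ses_lker.
have ja x : in_lker w (j x).
  by rewrite /in_lker wE /= (ses_pi e') (additive_fun0 pD).
have [r rE] : exists r : lker w -> U, forall x, i (r x) = q (\val x).
  have ex (x : lker w) : exists u, i u = q (\val x).
    by apply: (ses_ker e); case: x => x x0; rewrite -[LHS]wE; exact: (eqP x0).
  by have [r rE] := choice ex; exists r.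
have [[iD iZ] [jD jZ]] := (ses_i e, ses_i e').
apply: (@ses_pd_le d.+1 K _ U (fun x => LKer (ja x)) r) => //; last exact: pd_leS.
split.
- by split=> [x y|a x]; apply: val_inj => /=; rewrite ?jD ?jZ.
- by split=> [x y|a x]; apply: iI; rewrite ?iD ?iZ !rE /= ?qD ?qZ.
- by move=> x /(congr1 (@lker_val _ _ _ w)) /= /(ses_mono e').
- by move=> x; apply: iI; rewrite rE /= (ses_pi e') (additive_fun0 iD).
- move=> x rx; have [y yE] : exists y, j y = \val x.
    by apply: (ses_ker e'); rewrite -rE rx (additive_fun0 iD).
  by exists y; apply: val_inj.
- move=> u; have [x xE] := ses_surj e' (i u).
  have x0 : in_lker w x by rewrite /in_lker wE /= xE (ses_pi e).
  by exists (LKer x0); apply: iI; rewrite rE.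
Qed.

Fixpoint Omega_iter (n : nat) (X : lmodType R) : lmodType R :=
  if n is m.+1 then Omega (Omega_iter m X) else X.

Lemma pd_le_Omega_iter d n X : pd_le d (Omega_iter n X) -> pd_le (n + d) X.
Proof.
elim: n X d => [|n IH] X d h; first exact: h.
rewrite addSnnS; apply: IH.
exists (Omega (Omega_iter n X)), (free_module R (Omega_iter n X)).
exists (@Omega_incl _ _), (cover _); split=> //; first exact: free_projective.
exact: ses_cover.
Qed.

Lemma TorV_projective n (X : lmodType R^c) P : projective P -> TorV n X P.
Proof.
move=> /projective_local h; apply: TorV_local_right h _; exact: TorV_free_right.
Qed.

Lemma TorV_pd_le d n (X : lmodType R^c) (Y : lmodType R) :
  pd_le d Y -> (d <= n)%N -> TorV n X Y.
Proof.
elim: d n Y => [|d IH] n Y; first by move=> Yp _; exact: TorV_projective.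
move=> [K [P [i [p [Pp e h]]]]]; case: n => // n dn.
exact: (TorV_ses_right e (TorV_projective _ _ Pp) (IH _ _ h dn)).
Qed.

(** * Projective dimension and resolutions of finite length *)

Section OfResolution.
Variables (M : lmodType R) (P : proj_resolution M).

(** Treating the augmentation as the differential out of degree 0 gives all cycle modules one
    form. *)
Let res_cod n : lmodType R := if n is m.+1 then (P m : lmodType R) else M.
Let res_out n : {linear P n -> res_cod n} :=
  match n return {linear P n -> res_cod n} with
  | 0%N => res_aug P
  | m.+1 => res_d P m
  end.

Let res_outP n x : res_out n x = 0 <-> exists y, res_d P n y = x.
Proof. by case: n x => [|n] x; [exact: res_exact0|exact: res_exact]. Qed.

Let pd_le_cycles d j n : (forall m, (d < m)%N -> trivial_group (P m)) ->
  (d <= n + j)%N -> pd_le j (lker (res_out n)).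
Proof.
move=> P0; elim: j n => [|j IH] n dn.
  apply: trivial_projective => -[x x0]; have /res_outP[y yE] := eqP x0.
  apply: val_inj; rewrite /= -yE (P0 _ _ y) ?linear0 //.
  by rewrite ltnS -[n]addn0.
have ca x : in_lker (res_out n) (res_d P n x).
  by apply/eqP/res_outP; exists x.
exists (lker (res_out n.+1)), (P n.+1), (@lker_val _ _ _ (res_out n.+1)).
exists (fun x => LKer (ca x)); split; [exact: res_proj| |apply: IH; by rewrite addSnnS].
split.
- by [].
- by split=> [x y|a x]; apply: val_inj; rewrite /= ?linearD ?linearZ.
- by move=> x x0; apply: val_inj.
- by case=> x /= /eqP x0; apply: val_inj.
- by move=> x /(congr1 (@lker_val _ _ _ (res_out n)))/eqP x0; exists (LKer x0).
- by case=> x x0; have /res_outP[y yE] := eqP x0; exists y; apply: val_inj.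
Qed.

(** The descent through the cycle modules ends at the cycles in degree d, which vanish as the image
    of a zero module; this costs one in the bound, and only finiteness matters later. *)
Lemma resolution_pd_le d :
  (forall m, (d < m)%N -> trivial_group (P m)) -> pd_le d.+1 M.
Proof.
move=> P0; exists (lker (res_out 0)), (P 0%N), (@lker_val _ _ _ (res_out 0)).
exists (res_aug P); split; first exact: res_proj.
  exact: (ses_lker (f := res_out 0) (@res_aug_surj _ _ P)).
exact: (pd_le_cycles P0).
Qed.
End OfResolution.

Section Cons.
Variables (K P X : lmodType R) (i : {linear K -> P}) (p : {linear P -> X}).
Variables (Pp : projective P) (e : ses i p) (Q : proj_resolution K).

Let cons_obj n : lmodType R := if n is m.+1 then (Q m : lmodType R) else P.
Let cons_d n : {linear cons_obj n.+1 -> cons_obj n} :=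
  match n return {linear cons_obj n.+1 -> cons_obj n} with
  | 0%N => i \o res_aug Q
  | m.+1 => res_d Q m
  end.

Lemma cons_resolution : exists Q' : proj_resolution X,
  forall n, trivial_group (Q n) -> trivial_group (Q' n.+1).
Proof.
suff h : exists Q' : proj_resolution X, res_obj Q' = cons_obj.
  by have [Q' Q'E] := h; exists Q' => n; rewrite Q'E.
have pr n : projective (cons_obj n) by case: n => // n; exact: res_proj.
have ex0 x : p x = 0 <-> exists y, cons_d 0 y = x.
  split=> [/(ses_ker e)[k <-]|[y <-]]; last exact: (ses_pi e).
  by have [y <-] := res_aug_surj Q k; exists y.
have ex n x : cons_d n x = 0 <-> exists y, cons_d n.+1 y = x.
  case: n x => [|n] x; last exact: res_exact.
  rewrite -res_exact0; split=> [|x0]; first exact: (ses_mono e).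
  by rewrite /= x0 linear0.
by exists (@ProjResolution R X cons_obj cons_d p pr (ses_surj e) ex0 ex).
Qed.
End Cons.

Lemma projective_resolution X : projective X -> exists Q : proj_resolution X,
  forall n, (0 < n)%N -> trivial_group (Q n).
Proof.
move=> Xp; pose f : {linear X -> X} := idfun; pose Z : lmodType R := lker f.
have Z0 : trivial_group Z by case=> x x0; apply: val_inj => /=; exact: (eqP x0).
pose ob n : lmodType R := if n is m.+1 then Z else X.
pose d n : {linear ob n.+1 -> ob n} := \0.
have pr n : projective (ob n) by case: n => // n; exact: trivial_projective.
have ex0 x : f x = 0 <-> exists y, d 0 y = x.
  by split=> [x0|[y <-]] //; exists 0; exact: (esym x0).
have ex n x : d n x = 0 <-> exists y, d n.+1 y = x.
  by split=> // _; exists 0; rewrite (Z0 x).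
exists (@ProjResolution R X ob d f pr (fun x => ex_intro _ x erefl) ex0 ex).
by case=> // n _; exact: Z0.
Qed.

Lemma pd_le_resolution d X : pd_le d X -> exists Q : proj_resolution X,
  forall n, (d < n)%N -> trivial_group (Q n).
Proof.
elim: d X => [|d IH] X; first exact: projective_resolution.
move=> [K [P [i [p [Pp e /IH[Q Q0]]]]]].
have [i' i'E] := linear_fun_bundle (ses_i e).
have [p' p'E] := linear_fun_bundle (ses_p e).
have e' : ses i' p' by move: e; rewrite -(funext i'E) -(funext p'E).
have [Q' Q'0] := cons_resolution Pp e' Q.
by exists Q'; case=> // n dn; exact/Q'0/Q0.
Qed.
End ProjectiveDimension.

Lemma finite_global_dimP (R : pzRingType) :
  finite_global_dim R <-> exists d, forall X : lmodType R, pd_le d X.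
Proof.
split=> -[d h]; last by exists d => X; exact/pd_le_resolution/h.
by exists d.+1 => X; have [P P0] := h X; exact: resolution_pd_le P0.
Qed.

(** * Recollement by a stratifying idempotent *)

Section Stratified.
Variables (R S T : pzRingType) (phi : nuhom S R) (iota : nuhom T R) (pi : nuhom R T).
Local Notation e := (phi 1).
Local Notation f := (iota 1).

(* The last field is the vanishing of fRe (x)_S eRf, stated by the universal property. *)
Record recollement : Prop := Recollement {
  rec_phi : forall x, exists s, phi s = e * x * e;
  rec_iotaK : cancel iota pi;
  rec_pi : forall x, iota (pi x) = f * x * f;
  rec_ef : e + f = 1;
  rec_MN : forall (G : zmodType) (b : R -> R -> G),
    (forall y, additive_fun (b^~ y)) -> (forall x, additive_fun (b x)) ->
    (forall s x y, b (x * phi s) y = b x (phi s * y)) ->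
    forall x y, b (f * x * e) (e * y * f) = 0
}.
Hypothesis rec : recollement.

Lemma rec_ee : e * e = e. Proof. by rewrite -nuM mul1r. Qed.
Lemma rec_ff : f * f = f. Proof. by rewrite -nuM mul1r. Qed.
Lemma rec_fE : f = 1 - e. Proof. by rewrite -(rec_ef rec) addrAC subrr add0r. Qed.
Lemma rec_efM : e * f = 0. Proof. by rewrite rec_fE mulrBr mulr1 rec_ee subrr. Qed.
Lemma rec_pi1 : pi 1 = 1.
Proof. by apply: (can_inj (rec_iotaK rec)); rewrite (rec_pi rec) mulr1 rec_ff. Qed.
Lemma rec_pie : pi e = 0.
Proof.
rewrite -[LHS](rec_iotaK rec) (rec_pi rec) -mulrA rec_efM mulr0.
exact: additive_fun0 (nuD pi).
Qed.

Lemma rec_split (X : lmodType R) (x : X) : x = e *: x + f *: x.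
Proof. by rewrite -scalerDl (rec_ef rec) scale1r. Qed.

Lemma rec_pi0 x : pi x = 0 -> f * x * f = 0.
Proof. by move=> x0; rewrite -(rec_pi rec) x0 (additive_fun0 (nuD iota)). Qed.

Section Counit.
Variable X : lmodType R.

Definition counit : ind_mod phi (res phi X) -> X :=
  ind_lift (@res_val _ _ phi X).

Let vP := res_val_semilinear phi X.

Lemma counit_linear : linear_fun counit. Proof. exact: ind_lift_linear vP. Qed.
Lemma counitE r y : counit (tens r y) = (res_val r : R) *: res_val y.
Proof. exact: ind_liftE vP _ _. Qed.
Lemma counit_gen y : counit (ind_gen phi y) = res_val y.
Proof. exact: ind_lift_gen vP _. Qed.

(** Since eRe is the image of [phi], elements of eRe move across the tensor sign. Hence e kills the
    kernel of the counit, and only the f-part of an element is left to control. *)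
Lemma counit_e z : e *: z = ind_gen phi (to_res phi (counit z)).
Proof.
have [cD _] := counit_linear; have [gD gZ] := ind_gen_semilinear phi (res phi X).
move: z; apply: ind_ext => [u v|u v|r y].
- exact: scalerDr.
- by rewrite cD to_resD gD.
have [s sE] := rec_phi rec (res_val r).
have rE : (res_val r : R) = (res_val r : R) * e by exact: (esym (res_valP r)).
rewrite counitE ind_modE scalerA.
have -> : ind_gen phi y = e *: ind_gen phi y by rewrite -gZ scale1r.
rewrite scalerA -sE -gZ; congr (ind_gen _ _); apply: val_inj.
change (phi s *: res_val y = e *: ((res_val r : R) *: res_val y)).
rewrite sE -[in RHS](res_valP y) !scalerA.
by [].
Qed.

Lemma counit_image_e x : counit (ind_gen phi (to_res phi x)) = e *: x.
Proof. exact: counit_gen. Qed.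

Lemma counit_image r x : counit (r *: ind_gen phi (to_res phi x)) = (r * e) *: x.
Proof. by rewrite (proj2 counit_linear) counit_gen scalerA. Qed.
End Counit.

Lemma counit_map (X X' : lmodType R) (g : X -> X') : linear_fun g -> forall z,
  counit (ind_map phi (res_map g) z) = g (counit z).
Proof.
move=> gP; have mP := ind_map_linear phi (res_map_linear phi gP).
have [[mD _] [gD gZ]] := (mP, gP).
have [cD _] := counit_linear X; have [cD' _] := counit_linear X'.
apply: ind_ext => [u v|u v|r y].
- by rewrite mD cD'.
- by rewrite cD gD.
rewrite [ind_map _ _ _](tmaprE (res_map_linear phi gP)) !counitE gZ.
by rewrite res_mapE.
Qed.

Lemma counit_local_mono (X' X : lmodType R) : local_retract X' X ->
  mono (@counit X) -> mono (@counit X').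
Proof.
move=> [I [j [q [jP qP jqE]]]] m z z0.
have jR i := res_map_linear phi (jP i); have qR i := res_map_linear phi (qP i).
have jI i := ind_map_linear phi (jR i); have qI i := ind_map_linear phi (qR i).
have jqD i : additive_fun (fun z : ind_mod phi (res phi X') =>
    ind_map phi (res_map (j i)) (ind_map phi (res_map (q i)) z)).
  move=> x y; rewrite -(proj1 (jI i)); congr (ind_map phi _ _).
  exact: (proj1 (qI i)).
have [s sP] : exists s : seq I, forall t, uniq t -> {subset s <= t} ->
    z = \sum_(i <- t) ind_map phi (res_map (j i)) (ind_map phi (res_map (q i)) z).
  elim/tens_ind: z {z0} => [|u v [s1 E1] [s2 E2]|r y].
  - by exists [::] => t _ _; rewrite big1 // => i _; exact: (additive_fun0 (jqD i)).
  - exists (s1 ++ s2) => t ut st.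
    have h1 : {subset s1 <= t} by move=> x xs; apply: st; rewrite mem_cat xs.
    have h2 : {subset s2 <= t} by move=> x xs; apply: st; rewrite mem_cat xs orbT.
    rewrite {1}(E1 t ut h1) {1}(E2 t ut h2).
    by rewrite -big_split; apply: eq_bigr => i _; rewrite jqD.
  - have [s sE] := jqE (res_val y); exists s => t ut st.
    have {1}-> : y = \sum_(i <- t) res_map (j i) (res_map (q i) y).
      apply: val_inj; have [vD _] := res_val_semilinear phi X'.
      rewrite [LHS](sE t ut st) [RHS](additive_fun_sum vD).
      by apply: eq_bigr => i _; rewrite [RHS]res_mapE // res_mapE.
    rewrite (additive_fun_sum (fun a b => tensDr r a b)); apply: eq_bigr => i _.
    by rewrite [ind_map _ _ (tens _ _)](tmaprE (qR i)) [RHS](tmaprE (jR i)).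
rewrite (sP (undup s)) ?undup_uniq // => [|x]; last by rewrite mem_undup.
rewrite big1 // => i _; have -> : ind_map phi (res_map (q i)) z = 0.
  by apply: m; rewrite counit_map // z0 (additive_fun0 (proj1 (qP i))).
exact: (additive_fun0 (proj1 (jI i))).
Qed.

(** Right multiplication by e and f splits z in Re (x)_S eR. The part in Re (x) eRe is determined by
    the counit, because r (x) ye = (rye) (x) e. For the other part, e kills z by [counit_e], and its
    f-component lies in fRe (x)_S eRf = 0. *)
Lemma counit_regular_mono : mono (@counit R^o).
Proof.
have [gD gZ] := ind_gen_semilinear phi (res phi R^o).
pose mr (a : R) : R^o -> R^o := fun x => (x : R) * a.
have mrP a : linear_fun (mr a).
  by split=> [x y|b x]; [exact: mulrDl|exact: (esym (mulrA _ _ _))].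
have mP a := ind_map_linear phi (res_map_linear phi (mrP a)).
have mE a (r : ind_ring phi) (y : res phi R^o) :
    ind_map phi (res_map (mr a)) (tens r y) = tens r (res_map (mr a) y).
  exact: (tmaprE (res_map_linear phi (mrP a))).
have split_z (z : ind_mod phi (res phi R^o)) : z = ind_map phi (res_map (mr e)) z + ind_map phi (res_map (mr f)) z.
  move: z; apply: ind_ext => [//|u v|r y].
    by rewrite !(proj1 (mP _)) addrACA.
  rewrite !mE -tensDr; congr tens; apply: val_inj.
  change (res_val y = e * (res_val y * e) + e * (res_val y * f) :> R).
  by rewrite -mulrDr -mulrDr (rec_ef rec) mulr1; exact: (esym (res_valP y)).
have ze (z : ind_mod phi (res phi R^o)) : ind_map phi (res_map (mr e)) z
    = (counit z : R) *: ind_gen phi (to_res phi (1 : R^o)).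
  have [cD _] := counit_linear R^o.
  move: z; apply: ind_ext => [|u v|r y]; first exact: (proj1 (mP _)).
    by rewrite cD scalerDl.
  rewrite mE counitE.
  have [s sE] := rec_phi rec (res_val y).
  have -> : res_map (mr e) y = s *: to_res phi (1 : R^o).
    apply: val_inj; rewrite [LHS]res_mapE //.
    change (res_val y * e = phi s * (e * 1) :> R).
    rewrite mulr1 sE; have yE : e * (res_val y : R) = res_val y := res_valP y.
    by rewrite yE -mulrA rec_ee.
  have yE : e * (res_val y : R) = res_val y := res_valP y.
  rewrite ind_modE gZ scalerA sE yE.
  have {2}-> : to_res phi (1 : R^o) = 1 *: to_res phi (1 : R^o) by rewrite scale1r.
  rewrite gZ scalerA; congr (_ *: _).
  by rewrite mulrA.
have zf (z : ind_mod phi (res phi R^o)) : f *: ind_map phi (res_map (mr f)) z = 0.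
  have fmD : additive_fun (fun z : ind_mod phi (res phi R^o) =>
      f *: ind_map phi (res_map (mr f) : _ -> res phi R^o) z).
    by move=> x y; rewrite (proj1 (mP _)) scalerDr.
  move: z; apply: ind_ext => [//|u v|r y]; first by rewrite addr0.
  rewrite mE ind_modE scalerA.
  (* This is the natural pairing of fRe and eRf with values in Re (x)_S eR; being balanced over S,
     it vanishes by [rec_MN]. *)
  pose b x y := (f * x * e) *: ind_gen phi (to_res phi (e * y * f : R^o)).
  have := rec_MN rec (b := b) _ _ _ (res_val r) (res_val y).
  have -> : b (f * (res_val r : R) * e) (e * (res_val y : R) * f)
      = (f * (res_val r : R)) *: ind_gen phi (res_map (mr f) y).
    rewrite /b -[res_map (mr f) y]scale1r gZ scalerA; congr (_ *: ind_gen _ _).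
      by rewrite !mulrA rec_ff -[LHS]mulrA rec_ee.
    apply: val_inj.
    change (e * (e * (e * (res_val y : R) * f) * f) = e * ((res_val y : R) * f) :> R).
    by rewrite -!mulrA rec_ff !mulrA !rec_ee.
  apply=> [y' x x'|x y' y''|s x y'].
  - by rewrite /b mulrDr mulrDl scalerDl.
  - by rewrite /b mulrDr mulrDl to_resD gD scalerDr.
  rewrite /b.
  have -> : to_res phi (e * (phi s * y') * f : R^o) = s *: to_res phi (e * y' * f : R^o).
    rewrite -to_resZ; congr to_res.
    change (e * (phi s * y') * f = phi s * (e * y' * f)).
    by rewrite !mulrA -!nuM mul1r mulr1.
  by rewrite gZ scalerA; congr (_ *: _); rewrite -!mulrA -!nuM mul1r mulr1.
move=> z z0.
have e0 : e *: z = 0.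
  rewrite counit_e z0 (additive_fun0 (to_resD phi (X := R^o))).
  exact: (additive_fun0 gD).
rewrite [z](rec_split z) e0 add0r (split_z z) scalerDr zf addr0 ze z0.
by rewrite scale0r scaler0.
Qed.

Lemma counit_free_mono (I : choiceType) : mono (@counit (free_module R I)).
Proof. exact: counit_local_mono (free_local R I) counit_regular_mono. Qed.

Lemma pi_counit (X : lmodType R) (Y : lmodType T) (g : X -> Y) :
  semilinear_fun pi g -> forall z, g (counit z) = 0.
Proof.
move=> [gD gZ]; have [cD _] := counit_linear X.
apply: ind_ext => [u v|u v|r y]; rewrite ?addr0 //; first by rewrite cD gD.
by rewrite counitE -(res_valP y) scalerA gZ nuM rec_pie mulr0 scale0r.
Qed.

(* 0 -> ReR -> R -> R/ReR -> 0 *)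
Lemma rec_ses : ses (@counit R^o) (fun x : R^o => to_res pi (pi x : T^o)).
Proof.
have pP : semilinear_fun pi (fun x : R^o => pi x : T^o).
  by split=> [x y|a x]; [exact: (nuD pi x y)|exact: (nuM pi a x)].
split.
- exact: counit_linear.
- split=> [x y|a x]; first by rewrite (proj1 pP) to_resD.
  by rewrite (proj2 pP) to_resZ.
- exact: counit_regular_mono.
- move=> z; rewrite (pi_counit pP).
  exact: (additive_fun0 (to_resD pi (X := T^o))).
- move=> x /(congr1 (@res_val _ _ pi T^o)) x0.
  have {}x0 : pi (x : R) = 0.
    by move: x0; rewrite /= rec_pi1 scale1r.
  have fxf := rec_pi0 x0.
  (* When fxf = 0, x is ex + fxe; the two summands of [z] are preimages of these. *)
  pose z := ind_gen phi (to_res phi x) + (f * (x : R)) *: ind_gen phi (to_res phi (1 : R^o)).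
  exists z; rewrite /z (proj1 (counit_linear R^o)) counit_image_e counit_image.
  change (e * x + f * x * e * 1 = x :> R).
  rewrite mulr1 -[RHS]mul1r -(rec_ef rec) mulrDl; congr (_ + _).
  by rewrite -[RHS]mulr1 -(rec_ef rec) mulrDr fxf addr0.
- move=> y; exists (iota (res_val y : T)); rewrite (rec_iotaK rec).
  exact: to_resK.
Qed.

Hypothesis acyc : forall j, TorV j (ind_ring phi) (res phi R^o).

Lemma acyc_free_right (I : choiceType) j :
  TorV j (ind_ring phi) (res phi (free_module R I)).
Proof. exact: TorV_local_right (res_local phi (free_local R I)) (acyc j). Qed.

Lemma acyc_free_left (I : choiceType) j :
  TorV j (res (nu_conv phi) (free_module R^c I)) (res phi R^o).
Proof. exact: TorV_local_left (res_local (nu_conv phi) (free_local R^c I)) (acyc j). Qed.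

(* pi is a homological epimorphism. *)
Lemma TorV_epi_regular n : TorV n (res (nu_conv pi) (T^c)^o) (res pi T^o).
Proof.
set V := res _ _.
(* [V] is T as a right R-module, and Ve = 0 because pi(e) = 0. By [corner_of], V tensored with Re
   (x)_S eR is Ve (x)_S eR = 0. *)
have V0 (x : res (nu_conv phi) V) : x = 0.
  apply: val_inj; rewrite -[LHS]res_valP; apply: val_inj.
  change ((res_val (res_val x) : T) * pi e = 0 :> T).
  by rewrite rec_pie mulr0.
have t0 (z : tensor V (ind_mod phi (res phi R^o))) : z = 0.
  rewrite -(corner_ofK z); suff -> : corner_of z = 0.
    exact: (additive_fun0 (@corner_toD _ _ _ _ _)).
  elim/tens_ind: (corner_of z) => [//|u v -> ->|x y]; first by rewrite addr0.
  by rewrite (V0 x) tens0l.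
case: n => [|n].
  by apply: (mono_TorV0_right rec_ses) (TorV_regular_right _ _) => z _; exact: t0.
apply: (TorV_ses_right rec_ses (TorV_regular_right _ _)).
(* The same vanishing in higher degrees: Tor of [V] against the induced module is Tor over S of the
   zero module Ve. *)
apply: (proj1 (TorV_corner n V acyc_free_left)).
apply: TorV_local_left (TorV_regular_left n (res phi R^o)).
apply: (retract_local (j := fun=> 0) (q := fun=> 0)).
- by split=> [x y|a x]; rewrite ?addr0 ?scaler0.
- by split=> [x y|a x]; rewrite ?addr0 ?scaler0.
- by move=> x; rewrite (V0 x).
Qed.
End Stratified.

(** * Projective dimension and global dimension in a recollement *)

Section InducedProjective.
Variables (S R : pzRingType) (phi : nuhom S R).

(** Induction is left adjoint to restriction, which is exact. *)
Lemma ind_projective (P : lmodType S) : projective P -> projective (ind_mod phi P).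
Proof.
move=> Pp; apply: lift_projective => U V g h gP hP gs.
have [[gD gZ] [hD hZ]] := (gP, hP).
have [iD iZ] := ind_gen_semilinear phi P.
have uP : linear_fun (fun y => to_res phi (h (ind_gen phi y))).
  by split=> [x y|a x]; rewrite ?iD ?hD ?to_resD ?iZ ?hZ ?to_resZ.
have rgs (v : res phi V) : exists u, res_map g u = v.
  have [u uE] := gs (res_val v); exists (to_res phi u).
  by apply: val_inj; rewrite [LHS]res_mapE //= gZ uE; exact: res_valP.
have [l [[lD lZ] lE]] := projective_lift Pp (res_map_linear phi gP) uP rgs.
have vP : semilinear_fun phi (fun y => res_val (l y)).
  by split=> [x y|a x]; rewrite ?lD ?lZ.
exists (ind_lift (fun y => res_val (l y))); split; first exact: ind_lift_linear.
have [kD _] := ind_lift_linear vP.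
apply: ind_ext => [u v|//|r y]; first by rewrite kD gD.
rewrite (ind_liftE vP) gZ ind_modE hZ; congr (_ *: _).
rewrite -res_mapE // lE; change (phi 1 *: h (ind_gen phi y) = h (ind_gen phi y)).
by rewrite -hZ -iZ scale1r.
Qed.

Lemma pd_le_ind d (Y : lmodType S) : pd_le d Y ->
  (forall j, TorV j (ind_ring phi) Y) -> pd_le d (ind_mod phi Y).
Proof.
elim: d Y => [|d IH] Y; first by move=> Yp _; exact: ind_projective.
move=> [K [P [i [p [Pp e h]]]]] t.
exists (ind_mod phi K), (ind_mod phi P), (ind_map phi i), (ind_map phi p); split.
- exact: ind_projective.
- exact: ind_ses e (t 0%N).
- apply: IH h _ => j; exact: (TorV_ses_left e (TorV_projective _ _ Pp) (t j.+1)).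
Qed.
End InducedProjective.

Section StratifiedGlobalDim.
Variables (R S T : pzRingType) (phi : nuhom S R) (iota : nuhom T R) (pi : nuhom R T).
Hypothesis rec : recollement phi iota pi.
Hypothesis acyc : forall j, TorV j (ind_ring phi) (res phi R^o).
Local Notation e := (phi 1).
Local Notation f := (iota 1).

Section Inflation.
Variable Q : lmodType T.
Local Notation P := (ind_mod iota Q).

Let uP : semilinear_fun iota (@to_res _ _ pi Q).
Proof.
split=> [x y|a x]; first exact: to_resD.
by rewrite -{1}[a](rec_iotaK rec) to_resZ.
Qed.

(** For a projective T-module Q, the module P = Rf (x)_T Q is R-projective with fP = Q. Its map to Q
    has kernel Re (x)_S eP, whose projective dimension is bounded through S. *)
Definition inflate : P -> res pi Q := ind_lift (@to_res _ _ pi Q).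

Lemma inflate_linear : linear_fun inflate. Proof. exact: ind_lift_linear. Qed.

Lemma inflate_f (z : P) : f *: z = ind_gen iota (res_val (inflate z)).
Proof.
have [iD iZ] := ind_gen_semilinear iota Q; have [gD _] := inflate_linear.
move: z; apply: ind_ext => [u v|u v|r q]; first exact: scalerDr.
  by rewrite gD; exact: iD.
rewrite /inflate (ind_liftE uP) ind_modE scalerA.
have -> : ind_gen iota q = f *: ind_gen iota q by rewrite -iZ scale1r.
rewrite scalerA -(rec_pi rec) -iZ; congr (ind_gen _ _).
change (pi (res_val r : R) *: q = pi (res_val r : R) *: (pi 1 *: q)).
by rewrite (rec_pi1 rec) scale1r.
Qed.

(** The kernel is killed by e as in [counit_e], and the f-part of Re (x)_S eP is a quotient of fRe
    (x)_S eRf (x)_T Q = 0. *)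
Lemma inflate_counit_mono : mono (@counit _ _ phi P).
Proof.
move=> z z0; have [gD gZ] := ind_gen_semilinear phi (res phi P).
have [iD iZ] := ind_gen_semilinear iota Q.
have e0 : e *: z = 0.
  rewrite (counit_e rec) z0 (additive_fun0 (to_resD phi (X := P))).
  exact: (additive_fun0 gD).
rewrite [z](rec_split rec z) e0 add0r {e0 z0}.
move: z; apply: ind_ext => [u v|u v|r p]; rewrite ?addr0 //; first exact: scalerDr.
rewrite ind_modE scalerA -[p]to_resK; move: (res_val p : P) => {}p.
elim/tens_ind: p => [|u v IHu IHv|r' q].
- rewrite (additive_fun0 (to_resD phi (X := P))) (additive_fun0 gD); exact: scaler0.
- have -> : to_res phi (u + v : P) = to_res phi (u : P) + to_res phi (v : P).
    exact: to_resD.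
  by rewrite gD scalerDr IHu IHv addr0.
pose c (y : R) := to_res phi ((e * y * f) *: ind_gen iota q).
pose b x y := (f * x * e) *: ind_gen phi (c y).
have cD : additive_fun c.
  by move=> y y'; rewrite /c mulrDr mulrDl scalerDl to_resD.
have := rec_MN rec (b := b) _ _ _ (res_val r) (res_val r').
have -> : b (f * (res_val r : R) * e) (e * (res_val r' : R) * f)
    = (f * (res_val r : R)) *: ind_gen phi (to_res phi (tens r' q : P)).
  rewrite /b /c.
  rewrite -[to_res phi (tens r' q : P)]scale1r gZ scalerA; congr (_ *: ind_gen _ _).
    by rewrite !mulrA (rec_ff iota) -[LHS]mulrA (rec_ee phi).
  apply: val_inj; rewrite ind_modE.
  change (e *: ((e * (e * (res_val r' : R) * f) * f) *: ind_gen iota q)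
          = e *: ((res_val r' : R) *: ind_gen iota q)).
  have -> : ind_gen iota q = f *: ind_gen iota q by rewrite -iZ scale1r.
  rewrite !scalerA; congr (_ *: _).
  by rewrite -!mulrA !(rec_ff iota) !mulrA !(rec_ee phi).
apply=> [y x x'|x y y'|s x y].
- by rewrite /b mulrDr mulrDl scalerDl.
- by rewrite /b cD gD scalerDr.
have -> : b x (phi s * y) = (f * x * e) *: ind_gen phi (s *: c y).
  rewrite /b; congr (_ *: ind_gen _ _); rewrite /c -to_resZ scalerA; congr (to_res _ (_ *: _)).
  by rewrite !mulrA -!nuM mul1r mulr1.
by rewrite /b gZ scalerA; congr (_ *: _); rewrite -!mulrA -!nuM mul1r mulr1.
Qed.

Lemma inflate_ses : ses (@counit _ _ phi P) inflate.
Proof.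
have rP := inflate_linear; split=> //.
- exact: counit_linear.
- exact: inflate_counit_mono.
- move=> z; apply: val_inj.
  have vP : semilinear_fun pi (fun z => res_val (inflate z)).
    by split=> [x y|a x]; rewrite ?(proj1 rP) ?(proj2 rP).
  exact: (pi_counit rec vP).
- move=> z z0; exists (ind_gen phi (to_res phi z)).
  rewrite counit_image_e [RHS](rec_split rec z) inflate_f z0.
  by rewrite (additive_fun0 (proj1 (ind_gen_semilinear iota Q))) addr0.
- move=> q; exists (ind_gen iota (res_val q)); rewrite /inflate (ind_lift_gen uP).
  exact: to_resK.
Qed.

Lemma pd_le_inflate a : (forall Y : lmodType S, pd_le a Y) -> projective Q ->
  pd_le a.+1 (res pi Q).
Proof.
move=> hS Qp; have Pp : projective P := ind_projective Qp.
apply: (ses_pd_le_quot inflate_ses); last exact: (@pd_le_leq _ 0 a).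
apply: pd_le_ind (hS _) _ => j.
apply: TorV_local_right (res_local phi (projective_local Pp)) _.
exact: acyc_free_right.
Qed.
End Inflation.

(** A projective T-module costs a + 1 over R by [pd_le_inflate], and each step of a T-resolution
    adds one. *)
Lemma pd_le_res_pi a d (X : lmodType T) : (forall Y : lmodType S, pd_le a Y) ->
  pd_le d X -> pd_le (a.+1 + d) (res pi X).
Proof.
move=> hS; elim: d X => [|d IH] X; first by rewrite addn0; exact: pd_le_inflate.
move=> [K [P [i [p [Pp e /IH hK]]]]]; rewrite addnS.
apply: (ses_pd_le_quot (res_ses pi e) hK).
exact: (pd_le_leq (leq_addr d a.+1) (pd_le_inflate hS Pp)).
Qed.

Section Cokernel.
Variable X : lmodType R.

Let image (x : X) := exists z, @counit _ _ phi X z = x.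

Let image_e r x : image ((r * e) *: x).
Proof. by exists (r *: ind_gen phi (to_res phi x)); exact: counit_image. Qed.

Let imageB x y : image x -> image y -> image (x - y).
Proof.
have [cD _] := counit_linear phi X.
by move=> [z <-] [w <-]; exists (z - w); rewrite (additive_funB cD).
Qed.

Let imageD x y : image x -> image y -> image (x + y).
Proof.
have [cD _] := counit_linear phi X.
by move=> [z <-] [w <-]; exists (z + w); rewrite cD.
Qed.

(** Identifies the kernel of X -> T (x)_R X with ReX. The map (t, y) |-> iota(t) y is balanced
    modulo ReX, because iota(t) frf and iota(t) r differ by iota(t) re. *)
Lemma cokernel_image x : ind_gen pi x = 0 -> image x.
Proof.
have [||Q [q [qD qP]]] := @zmod_quotient _ image.
- by exists 0; rewrite (additive_fun0 (proj1 (counit_linear phi X))).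
- exact: imageB.
pose b (t : ind_ring pi) (y : X) := q (iota (res_val t : T) *: y).
have qeq u v : image (u - v) -> q u = q v.
  by move=> /qP; rewrite (additive_funB qD) => /eqP; rewrite subr_eq0 => /eqP.
have bb : balanced b.
  split=> [y t t'|t y y'|r t y]; rewrite /b.
  - by rewrite -qD -scalerDl -nuD.
  - by rewrite scalerDr qD.
  have -> : iota (res_val ((r : R^c) *: t) : T) = iota ((res_val t : T) * pi r) by [].
  apply: qeq; rewrite nuM (rec_pi rec) scalerA -scalerBl.
  have -> : iota (res_val t : T) * (f * r * f) - iota (res_val t : T) * r
      = - (iota (res_val t : T) * r) * e.
    rewrite !mulrA -nuM mulr1 -[X in _ - X]mulr1 -(rec_ef rec) mulrDr opprD.
    by rewrite addrCA subrr addr0 mulNr.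
  exact: image_e.
move=> x0; have : tens_lift b (ind_gen pi x) = 0 by rewrite x0 (tens_lift_zero bb).
rewrite (tens_liftE _ _ bb) /b.
change (q (iota (1 * pi 1) *: x) = 0 -> image x).
rewrite mul1r (rec_pi1 rec) => /qP fx.
rewrite (rec_split rec x) -[e]mul1r; exact: imageD.
Qed.

Lemma cokernel_ses : mono (@counit _ _ phi X) ->
  ses (@counit _ _ phi X) (fun x => to_res pi (ind_gen pi x)).
Proof.
have [iD iZ] := ind_gen_semilinear pi X; move=> m; split=> //.
- exact: counit_linear.
- by split=> [x y|a x]; rewrite ?iD ?to_resD ?iZ ?to_resZ.
- move=> z; rewrite (pi_counit rec (ind_gen_semilinear pi X)).
  exact: (additive_fun0 (to_resD pi (X := ind_mod pi X))).
- move=> x /(congr1 (@res_val _ _ pi _)) x0; apply: cokernel_image.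
  by rewrite -[x]scale1r iZ; exact: x0.
- move=> w; suff [x xE] : exists x, ind_gen pi x = res_val w.
    by exists x; rewrite xE; exact: to_resK.
  elim/tens_ind: (res_val w : ind_mod pi X) => [|u v [x xE] [y yE]|t x].
  + by exists 0; rewrite (additive_fun0 iD).
  + by exists (x + y); rewrite iD xE yE.
  + exists (iota (res_val t : T) *: x).
    by rewrite iZ (rec_iotaK rec) ind_modE.
Qed.
End Cokernel.

(** The syzygy lies in a free module F, whose counit is injective. Vanishing of Tor_1(Re, eX) keeps
    Re (x)_S e(Omega X) -> Re (x)_S eF injective. *)
Lemma counit_Omega_mono (X : lmodType R) :
  TorV 0 (ind_ring phi) (res phi X) -> mono (@counit _ _ phi (Omega X)).
Proof.
move=> t; have m := ses_mono (ind_ses (res_ses phi (ses_cover X)) t).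
have cm : mono (@counit _ _ phi (free_module R X)) := counit_free_mono rec (I := X).
have iP := ses_i (ses_cover X).
apply: (mono_factor (proj1 iP) _ m cm) => z.
by rewrite (counit_map iP).
Qed.

Lemma TorV_Omega_iter n j (X : lmodType R) :
  TorV (j + n) (ind_ring phi) (res phi X) ->
  TorV j (ind_ring phi) (res phi (Omega_iter n X)).
Proof.
elim: n j => [|n IH] j; first by rewrite addn0.
rewrite addnS => /(IH j.+1) h.
exact: (TorV_ses_left (res_ses phi (ses_cover _)) (acyc_free_right acyc _ _) h).
Qed.

Lemma stratified_global_dim :
  finite_global_dim S -> finite_global_dim T -> finite_global_dim R.
Proof.
move=> /finite_global_dimP[a hS] /finite_global_dimP[b hT].
(* After [a] syzygies the groups Tor(Re, e-) vanish, as [a] bounds projective dimensions over S; one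
   more makes the counit injective. The cokernel then has dimension at most a + 1 + b by
   [pd_le_res_pi], and the a + 1 syzygies are added back. *)
apply/finite_global_dimP; exists (a.+1 + (a.+1 + b))%N => X.
apply: pd_le_Omega_iter; set K := Omega_iter a.+1 X.
have t n j : (a <= n)%N -> TorV j (ind_ring phi) (res phi (Omega_iter n X)).
  move=> an; apply: TorV_Omega_iter; apply: (TorV_pd_le _ (hS _)).
  exact: leq_trans an (leq_addl j n).
have m : mono (@counit _ _ phi K) by apply: counit_Omega_mono; exact: t.
apply: (ses_pd_le (cokernel_ses m)); last exact: pd_le_res_pi.
apply: (@pd_le_leq _ a); first by rewrite addSnnS leq_addr.
by apply: pd_le_ind (hS _) _ => j; exact: t.
Qed.
End StratifiedGlobalDim.

(** * Hochschild homology in a recollement *)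

Section HochschildStep.
Variables (k : fieldType) (L A B : algebra k).
Variables (phi : nuhom A L) (iota : nuhom B L) (pi : nuhom L B).
Hypotheses (phik : klinear_hom phi) (iotak : klinear_hom iota) (pik : klinear_hom pi).
Hypothesis rec : recollement phi iota pi.
Hypothesis phiI : injective phi.
Hypothesis acyc : forall j, TorV j (ind_ring phi) (res phi L^o).
Local Notation e := (phi 1).
Local Notation f := (iota 1).
Local Notation AR A := (env_right A : lmodType (env A)^c).
Local Notation AL A := (env_left A : lmodType (env A)).
Local Notation W := (ind_mod (env_map phik) (AL A)).
Local Notation gen := (ind_gen (env_map phik) (Y := AL A)).

(** [W] is Le (x)_A eL written as a module induced from A^e, the form required by [TorV_corner]. In
    it [one] is e (x) e, and [gen_l] and [gen_r] together move elements of A across the tensor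
    sign. *)
Let one : W := gen (1 : A).

Let genZ (u : env A) (a : AL A) : gen (u *: a) = env_map phik u *: gen a.
Proof. exact: (proj2 (ind_gen_semilinear _ _)). Qed.

Let actM (a b c d : L) (w : W) :
  etens a b *: (etens c d *: w) = etens (a * c) (d * b) *: w.
Proof. by rewrite scalerA; congr (_ *: w); exact: env_mulE. Qed.

Let gen_e (x y : L) (a : AL A) : etens (x * e) (e * y) *: gen a = etens x y *: gen a.
Proof. by rewrite -actM -[in RHS](scale1r a) genZ [env_map phik _](env_funE phik). Qed.

Let gen_l (s : A) (x y : L) :
  etens x y *: gen (s : A) = etens (x * phi s) y *: one.
Proof.
have sE : (s : AL A) = etens s 1 *: ((1 : A) : AL A).
  by rewrite [RHS]env_lactE !mulr1.
rewrite [in LHS]sE genZ [env_map phik _](env_funE phik) actM /one -[RHS]gen_e.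
by rewrite -!mulrA -!nuM mulr1.
Qed.

Let gen_r (s : A) (x y : L) :
  etens x y *: gen (s : A) = etens x (phi s * y) *: one.
Proof.
have sE : (s : AL A) = etens 1 s *: ((1 : A) : AL A).
  by rewrite [RHS]env_lactE !mul1r.
rewrite [in LHS]sE genZ [env_map phik _](env_funE phik) actM /one -[RHS]gen_e.
by rewrite !mulrA -!nuM mul1r.
Qed.

Let etDl (y : L) (a b : L) : etens (a + b) y = etens a y + etens b y.
Proof. exact: tensDl. Qed.
Let etDr (x : L) (a b : L) : etens x (a + b) = etens x a + etens x b.
Proof. exact: tensDr. Qed.

Definition env_counit : W -> AL L := ind_lift (phi : AL A -> AL L).

Let uP : semilinear_fun (env_map phik) (phi : AL A -> AL L).
Proof. exact: env_left_semilinear. Qed.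

Let cP : linear_fun env_counit := ind_lift_linear uP.

Let cE (x y : L) (a : A) : env_counit (etens x y *: gen a) = (x * phi a * y : L).
Proof. by rewrite (proj2 cP) /env_counit (ind_lift_gen uP) [LHS]env_lactE. Qed.

Let W_ext (G : zmodType) (F H : W -> G) : additive_fun F -> additive_fun H ->
  (forall x y a, F (etens x y *: gen a) = H (etens x y *: gen a)) -> F =1 H.
Proof.
move=> FD HD FH; apply: ind_ext => // r a; rewrite ind_modE.
move: (res_val r : env L); elim/env_ind => [|u v IHu IHv|x y]; last exact: FH.
- by rewrite scale0r !additive_fun0.
- by rewrite scalerDl FD HD IHu IHv.
Qed.

Let one_l (x y : L) : etens (x * e) y *: one = etens x y *: one.
Proof. by rewrite -[LHS]gen_e -[RHS]gen_e -mulrA (rec_ee phi). Qed.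
Let one_r (x y : L) : etens x (e * y) *: one = etens x y *: one.
Proof. by rewrite -[LHS]gen_e -[RHS]gen_e mulrA (rec_ee phi). Qed.

Let phi_e (a : A) : phi a * e = phi a. Proof. by rewrite -nuM mulr1. Qed.
Let e_phi (a : A) : e * phi a = phi a. Proof. by rewrite -nuM mul1r. Qed.

(** For x in Le, ex lies in eLe and crosses the tensor sign: ex (x) y = e (x) exy. The counit thus
    determines eW, and by the mirror argument We. *)
Let W_e1 (z : W) : etens e 1 *: z = etens 1 (env_counit z : L) *: one.
Proof.
have [cD _] := cP.
move: z; apply: W_ext => [u v|u v|x y a]; first exact: scalerDr.
  by rewrite cD etDr scalerDl.
rewrite cE actM mulr1 gen_l -one_l.
have [s sE] := rec_phi rec (x * phi a).
have -> : e * x * phi a * e = 1 * phi s by rewrite sE mul1r !mulrA.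
rewrite -gen_l gen_r sE -[RHS]one_r; congr (etens _ _ *: _).
by rewrite -!mulrA; congr (_ * (_ * _)); rewrite mulrA phi_e.
Qed.

Let W_1e (z : W) : etens 1 e *: z = etens (env_counit z : L) 1 *: one.
Proof.
have [cD _] := cP.
move: z; apply: W_ext => [u v|u v|x y a]; first exact: scalerDr.
  by rewrite cD etDl scalerDl.
rewrite cE actM mul1r gen_r -one_r.
have [s sE] := rec_phi rec (phi a * y).
have -> : e * (phi a * (y * e)) = phi s * 1 by rewrite sE mulr1 !mulrA.
rewrite -gen_r gen_l sE -[RHS]one_l; congr (etens _ _ *: _).
by rewrite !mulrA; congr (_ * _ * _); rewrite -mulrA e_phi.
Qed.

Let W_ff (z : W) : etens f f *: z = 0.
Proof.
move: z; apply: W_ext => [u v|u v|x y a]; rewrite ?addr0 //; first exact: scalerDr.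
rewrite actM gen_l -one_l -one_r.
pose b x y := etens x y *: one.
have := rec_MN rec (b := b) _ _ _ (x * phi a) y.
rewrite /b !mulrA; apply=> [y' u v|x' u v|s u v].
- by rewrite etDl scalerDl.
- by rewrite etDr scalerDl.
- by rewrite -gen_l gen_r.
Qed.

(** By 1 = e + f on both sides, z is the sum of ez, fze and fzf. The counit determines ez and ze,
    and fWf = fLe (x)_A eLf vanishes. *)
Let env_counit_mono : mono env_counit.
Proof.
move=> z z0; have e0 (x : L) : etens (0 : L) x = 0 :> env L.
  exact: (additive_fun0 (etDl x)).
have e0' (x : L) : etens x (0 : L) = 0 :> env L.
  exact: (additive_fun0 (etDr x)).
have zE : etens e 1 *: z = 0 by rewrite W_e1 z0 e0' scale0r.
have zE' : etens 1 e *: z = 0 by rewrite W_1e z0 e0 scale0r.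
have h : etens e 1 + (etens f e + etens f f) = 1 :> env L.
  by rewrite -etDr (rec_ef rec) -etDl (rec_ef rec).
rewrite -[z]scale1r -h !scalerDl zE W_ff add0r addr0.
have -> : etens f e = etens f 1 * etens 1 e :> env L.
  by rewrite [RHS]env_mulE mulr1 mulr1.
by rewrite -scalerA zE' scaler0.
Qed.

Let pi_phi (a : A) : pi (phi a) = 0.
Proof. by rewrite -e_phi nuM (rec_pie rec) mul0r. Qed.

Let env_ses : ses env_counit
  (fun x : AL L => to_res (env_map pik) (pi (x : L) : AL B)).
Proof.
have [pD pZ] := env_left_semilinear pik.
split; [exact: cP| |exact: env_counit_mono| | |].
- split=> [x y|a x]; first by rewrite [pi _]pD to_resD.
  by rewrite [pi _]pZ to_resZ.
- have rD := to_resD (env_map pik) (X := AL B).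
  apply: W_ext => [u v|u v|x y a]; rewrite ?addr0 //.
    by rewrite (proj1 cP) -rD; congr to_res; exact: pD.
  by rewrite cE !nuM pi_phi mulr0 mul0r (additive_fun0 rD).
- move=> x /(congr1 (@res_val _ _ (env_map pik) (AL B))) x0.
  have pi1 : env_map pik 1 = 1.
    by rewrite -[LHS]/(env_fun pi (etens 1 1)) (env_funE pik) (rec_pi1 rec).
  have {}x0 : pi (x : L) = 0.
    by rewrite -[LHS](scale1r (pi (x : L) : AL B)) -pi1; exact: x0.
  have fxf := rec_pi0 rec x0.
  exists (etens 1 (x : L) *: one + etens (f * (x : L)) 1 *: one).
  rewrite (proj1 cP) !cE mul1r mulr1.
  rewrite -[RHS]mul1r -(rec_ef rec) mulrDl; congr (_ + _).
  by rewrite -[RHS]mulr1 -(rec_ef rec) mulrDr fxf addr0.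
- move=> y; exists (iota (res_val y : B)); rewrite (rec_iotaK rec).
  exact: to_resK.
Qed.

(** The restriction of L to a right A^e-module is eLe, onto which [phi] maps A bijectively. *)
Let AR_local : local_retract (AR A) (res (nu_conv (env_map phik)) (AR L)).
Proof.
have [pD pZ] := env_right_semilinear phik.
have act1 (y : L) : nu_conv (env_map phik) 1 *: (y : AR L) = e * y * e :> L.
  exact: etrans (congr1 (fun u => env_ract u y) (env_funE phik 1 1)) (env_ractE _ _ _).
have valE (x : res (nu_conv (env_map phik)) (AR L)) :
    e * (res_val x : L) * e = res_val x.
  by rewrite -act1; exact: res_valP x.
have [r rE] : exists r : res (nu_conv (env_map phik)) (AR L) -> A,
    forall x, phi (r x) = res_val x :> L.
  have ex (x : res (nu_conv (env_map phik)) (AR L)) : exists s, phi s = res_val x :> L.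
    by have [s sE] := rec_phi rec (res_val x); exists s; rewrite sE valE.
  by have [r rE] := choice ex; exists r.
apply: (retract_local (j := fun x => r x : AR A)
  (q := fun x : AR A => to_res (nu_conv (env_map phik)) (phi (x : A) : AR L))).
- split=> [x y|a x]; apply: phiI; first by rewrite [RHS]pD !rE.
  by rewrite [RHS]pZ !rE.
- split=> [x y|a x]; first by rewrite [phi _]pD to_resD.
  by rewrite [phi _]pZ -to_resZ.
- move=> x; apply: phiI; rewrite rE.
  by rewrite [LHS]act1 e_phi phi_e.
Qed.

Lemma HH_finite_idem : HH_finite L -> HH_finite B.
Proof.
move=> /HH_finiteP[N h]; apply/HH_finiteP; exists N => n Nn.
exact: (HH_retract iotak pik (rec_iotaK rec) (h n Nn)).
Qed.

Lemma HH_finite_corner : HH_finite L -> HH_finite A.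
Proof.
move=> hL; have /HH_finiteP[M hB] := HH_finite_idem hL.
have /HH_finiteP[N {}hL] := hL; apply/HH_finiteP; exists (maxn M N) => n.
rewrite geq_max => /andP[Mn Nn].
apply: TorV_local_left AR_local _.
apply: (proj2 (TorV_corner n (AR L) (TorV_env_free_left phik acyc))).
(* Tor_{n+1}(L, W) lies between Tor_{n+2}(L, B) and Tor_{n+1}(L, L); the first is moved to B^e by
   [TorV_epi], where j(p(x)) = fxf is the action of f (x) f. *)
apply: (TorV_ses_left env_ses (hL n Nn)).
apply: (TorV_epi (env_map_cancel iotak pik (rec_iotaK rec))
  (env_right_semilinear pik) (env_right_semilinear iotak)).
- move=> x; rewrite [LHS](rec_pi rec).
  apply: esym.
  exact: etrans (congr1 (fun u => env_ract u x) (env_funE iotak 1 1)) (env_ractE _ _ _).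
- by move=> I m; apply: TorV_env_free_right => j; exact: TorV_epi_regular rec acyc j.
- exact/hB/leqW.
Qed.

Lemma verifies_Han_step : verifies_Han A -> verifies_Han B -> verifies_Han L.
Proof.
move=> hA hB hL; apply: (stratified_global_dim rec acyc).
  exact/hA/HH_finite_corner.
exact/hB/HH_finite_idem.
Qed.
End HochschildStep.

(** * Corners and chains *)

Section AlgebraIso.
Variables (k : fieldType) (A E : algebra k) (phi : nuhom A E) (psi : nuhom E A).
Hypotheses (phik : klinear_hom phi) (psik : klinear_hom psi).
Hypotheses (phiK : cancel phi psi) (psiK : cancel psi phi).

Let phi1 : phi 1 = 1.
Proof. by rewrite -[LHS]mulr1 -[X in _ * X]psiK -nuM mul1r psiK. Qed.
Let psi1 : psi 1 = 1.
Proof. by rewrite -[LHS]mulr1 -[X in _ * X]phiK -nuM mul1r phiK. Qed.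

Let res_projective (P : lmodType E) : projective P -> projective (res phi P).
Proof.
move=> Pp; apply: lift_projective => U V g h gP [hD hZ] gs.
have hP : linear_fun (fun x : P => to_res psi (h (to_res phi x))).
  split=> [x y|a x]; first by rewrite to_resD hD to_resD.
  by rewrite -{1}[a]psiK to_resZ hZ to_resZ.
have rgs (v : res psi V) : exists u, res_map g u = v.
  have [u uE] := gs (res_val v); exists (to_res psi u).
  by apply: val_inj; rewrite [LHS]res_mapE //= (proj2 gP) uE; exact: res_valP.
have [l [[lD lZ] lE]] := projective_lift Pp (res_map_linear psi gP) hP rgs.
exists (fun x => res_val (l (res_val x))); split=> [|x].
  split=> [x y|a x]; first by rewrite lD.
  by rewrite lZ /= phiK.
rewrite -res_mapE // lE to_resK.
change (psi 1 *: h x = h x).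
by rewrite psi1 scale1r.
Qed.

Let res_pd_le d (X : lmodType E) : pd_le d X -> pd_le d (res phi X).
Proof.
elim: d X => [|d IH] X; first exact: res_projective.
move=> [K [P [i [p [Pp e /IH h]]]]].
exists (res phi K), (res phi P), (res_map i), (res_map p); split=> //.
  exact: res_projective.
exact: res_ses.
Qed.

(** X is compared with its double restriction through a short exact sequence with zero kernel;
    treating X as a quotient accounts for the extra one in the bound. *)
Lemma finite_global_dim_iso : finite_global_dim E -> finite_global_dim A.
Proof.
move=> /finite_global_dimP[d h]; apply/finite_global_dimP; exists d.+1 => X.
pose Z := res phi (res psi X).
have [q qE] : exists q : {linear Z -> X}, q =1 (fun z => res_val (res_val z)).
  by apply: linear_fun_bundle; split=> [x y|a x] //=; rewrite phiK.
have qs x : exists z, q z = x.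
  exists (to_res phi (to_res psi x)); rewrite qE /=.
  by rewrite !psi1 phi1 psi1 !scale1r.
apply: (ses_pd_le_quot (ses_lker qs)); last exact/res_pd_le/h.
apply: (@pd_le_leq _ 0 d) => //; apply: trivial_projective => -[z z0].
apply: val_inj; apply: val_inj; apply: val_inj => /=.
by move: z0; rewrite /in_lker qE => /eqP.
Qed.

Lemma verifies_Han_iso : verifies_Han E -> verifies_Han A.
Proof.
move=> hE /HH_finiteP[N hA]; apply: finite_global_dim_iso; apply: hE.
apply/HH_finiteP; exists N => n Nn.
exact: (HH_retract psik phik psiK (hA n Nn)).
Qed.
End AlgebraIso.

Section CornerHoms.
Variables (k : fieldType) (L : algebra k).
Implicit Type e : idem L.

Definition corner_incl e : nuhom (corner_algebra e) L :=
  @NuHom (corner_algebra e) L (@peirce_val L e e)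
    (fun x y => erefl) (fun x y => erefl).

Lemma corner_incl_klinear e : klinear_hom (corner_incl e).
Proof. by move=> c x; rewrite /= -mulrA peirce_mull. Qed.

Fact corner_proj_subproof e (x : L) : in_peirce e e (idem_val e * x * idem_val e).
Proof. by rewrite /in_peirce !mulrA idemP -mulrA idemP. Qed.
Definition corner_proj e (x : L) : corner_algebra e := Peirce (corner_proj_subproof e x).

Lemma corner_projD e : additive_fun (corner_proj e).
Proof. by move=> x y; apply: val_inj; rewrite /= mulrDr mulrDl. Qed.

Lemma corner_proj_incl e : cancel (corner_incl e) (corner_proj e).
Proof. by move=> x; apply: val_inj; rewrite /= peirce_mull peirce_mulr. Qed.

Lemma corner_proj_klinear e c x :
  corner_proj e (alg_scalar L c * x) = alg_scalar (corner_algebra e) c * corner_proj e x.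
Proof.
apply: val_inj => /=.
by rewrite !mulrA -[idem_val e * alg_scalar L c]alg_central -[X in _ = X * _ * _]mulrA idemP.
Qed.
End CornerHoms.

Section StronglyStratifying.
Variables (k : fieldType) (L : algebra k) (e : idem L).
Hypothesis strat : strongly_stratifying e.
Local Notation f := (idem_compl e).

Let biadditive_zero (G : zmodType) (b : L -> L -> G) :
  (forall y, additive_fun (b^~ y)) -> (forall x, additive_fun (b x)) ->
  (forall (s : corner e) x y, b (x * peirce_val s) y = b x (peirce_val s * y)) ->
  forall x y, b (idem_val f * x * idem_val e) (idem_val e * y * idem_val f) = 0.
Proof.
move=> bDl bDr bZ x y; have [_ t0 _] := strat.
have ux : in_peirce f e (idem_val f * x * idem_val e).
  by rewrite /in_peirce !mulrA (idemP f) -mulrA idemP.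
have uy : in_peirce e f (idem_val e * y * idem_val f).
  by rewrite /in_peirce !mulrA idemP -[X in X == _]mulrA (idemP f).
pose c (u : rpeirce f e) (v : lpeirce e f) := b (peirce_val u) (peirce_val v).
have cb : balanced (R := corner e) c.
  by split=> [n u v|m u v|r m n]; [exact: bDl|exact: bDr|exact: bZ].
have := tens_liftE (Peirce ux : rpeirce f e) (Peirce uy : lpeirce e f) cb.
by rewrite (t0 (tens _ _)) (tens_lift_zero cb) => h; exact: (esym h).
Qed.

Let fef x y : idem_val f * x * idem_val e * (idem_val e * y * idem_val f) = 0.
Proof.
apply: (biadditive_zero (b := fun x y => x * y)) => [y' u v|x' u v|s u v].
- exact: mulrDl.
- exact: mulrDr.
- by rewrite mulrA.
Qed.

Let ef1 : idem_val e + idem_val f = 1. Proof. by rewrite addrC subrK. Qed.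

Fact strat_proj_mul (x y : L) : corner_proj f (x * y) = corner_proj f x * corner_proj f y.
Proof.
apply: val_inj.
change (idem_val f * (x * y) * idem_val f
  = idem_val f * x * idem_val f * (idem_val f * y * idem_val f)).
have xy : idem_val f * (x * y) * idem_val f
    = idem_val f * x * (idem_val e + idem_val f) * (y * idem_val f).
  by rewrite ef1 mulr1 !mulrA.
rewrite xy mulrDr mulrDl.
have -> : idem_val f * x * idem_val e * (y * idem_val f)
   = idem_val f * x * idem_val e * (idem_val e * y * idem_val f).
  by rewrite !mulrA -[in RHS](mulrA _ (idem_val e) (idem_val e)) idemP.
rewrite fef add0r !mulrA; congr (_ * _ * _).
by rewrite -[RHS]mulrA (idemP f).
Qed.

Definition strat_proj : nuhom L (corner_algebra f) :=
  @NuHom L (corner_algebra f) (corner_proj f) (@corner_projD _ _ f) strat_proj_mul.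

Lemma strat_recollement :
  recollement (corner_incl e) (corner_incl f) strat_proj.
Proof.
split.
- by move=> x; exists (corner_proj e x).
- exact: corner_proj_incl.
- by [].
- exact: ef1.
- exact: biadditive_zero.
Qed.

(** Condition (1) with its Peirce modules rewritten as restricted regular modules; [TorV j] is
    degree j + 1, so only positive degrees occur. *)
Lemma strat_acyclic j :
  TorV j (ind_ring (corner_incl e)) (res (corner_incl e) L^o).
Proof.
have [t _ _] := strat.
have /Tor_TorV h := t j.+1 isT.
have rP (x : ind_ring (corner_incl e)) :
    in_peirce (idem1 L) e (res_val x : L).
  by rewrite /in_peirce /= mul1r; apply/eqP; exact: (res_valP x).
have rP' (x : rpeirce (idem1 L) e) :
    in_res (nu_conv (corner_incl e)) (X := (L^c)^o) (peirce_val x).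
  by apply/eqP; exact: (peirce_mulr x).
have lP (x : res (corner_incl e) L^o) : in_peirce e (idem1 L) (res_val x : L).
  by rewrite /in_peirce /= mulr1; apply/eqP; exact: (res_valP x).
have lP' (x : lpeirce e (idem1 L)) : in_res (corner_incl e) (X := L^o) (peirce_val x).
  by apply/eqP; exact: (peirce_mull x).
apply: (TorV_local_left (X := (rpeirce (idem1 L) e : lmodType (corner e)^c))).
  apply: (retract_local (j := fun x : rpeirce (idem1 L) e => Res (rP' x))
            (q := fun x => Peirce (rP x) : rpeirce (idem1 L) e)).
  - by split=> [x y|a x]; apply: val_inj.
  - by split=> [x y|a x]; apply: val_inj.
  - by move=> x; apply: val_inj.
apply: (TorV_local_right (Y := (lpeirce e (idem1 L) : lmodType (corner e)))) h.
apply: (retract_local (j := fun x : lpeirce e (idem1 L) => Res (lP' x))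
          (q := fun x => Peirce (lP x) : lpeirce e (idem1 L))).
- by split=> [x y|a x]; apply: val_inj.
- by split=> [x y|a x]; apply: val_inj.
- by move=> x; apply: val_inj.
Qed.

Lemma verifies_Han_stratified : verifies_Han (corner_algebra e) ->
  verifies_Han (corner_algebra f) -> verifies_Han L.
Proof.
have pik : klinear_hom strat_proj by move=> c x; exact: corner_proj_klinear.
have inj : injective (corner_incl e) by exact: val_inj.
exact: (verifies_Han_step (@corner_incl_klinear _ _ e) (@corner_incl_klinear _ _ f)
  pik strat_recollement inj strat_acyclic).
Qed.
End StronglyStratifying.

Section Transport.
Variables (k : fieldType) (L : algebra k).

(** The chain leads to the corner at f_0 = 1, which is isomorphic to the algebra but is another
    type. *)
Lemma verifies_Han_corner1 (e : idem L) : idem_val e = 1 ->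
  verifies_Han (corner_algebra e) -> verifies_Han L.
Proof.
move=> e1.
have eM x y : corner_proj e (x * y) = corner_proj e x * corner_proj e y.
  by apply: val_inj; rewrite /= e1 !mul1r !mulr1.
apply: (@verifies_Han_iso _ _ _ (NuHom (@corner_projD _ _ e) eM) (corner_incl e)).
- exact: corner_proj_klinear.
- exact: corner_incl_klinear.
- by move=> x; rewrite /= e1 mul1r mulr1.
- exact: corner_proj_incl.
Qed.

(** h(gLg)h and eLe have the same elements inside L; nested corners produced by the chain are
    flattened in this way. *)
Lemma verifies_Han_corner_corner (g : idem L) (h : idem (corner_algebra g)) (e : idem L) :
  peirce_val (idem_val h) = idem_val e ->
  verifies_Han (corner_algebra e) -> verifies_Han (corner_algebra h).
Proof.
move=> he.
have ge : idem_val g * idem_val e = idem_val e by rewrite -he peirce_mull.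
have eg : idem_val e * idem_val g = idem_val e by rewrite -he peirce_mulr.
have toP (x : corner_algebra h) : in_peirce e e (peirce_val (peirce_val x)).
  rewrite /in_peirce -he; apply/eqP.
  by have := congr1 (@peirce_val _ _ _) (peirce_mulr x);
     rewrite -{1}(peirce_mull x).
have ofP (y : corner_algebra e) : in_peirce g g (peirce_val y).
  rewrite /in_peirce -(peirce_mull y) mulrA ge -mulrA -(peirce_mulr y).
  by rewrite -!mulrA eg.
have ofP' (y : corner_algebra e) : in_peirce h h (Peirce (ofP y) : corner_algebra g).
  rewrite /in_peirce; apply/eqP/val_inj; rewrite /= he.
  by rewrite peirce_mull peirce_mulr.
pose to (x : corner_algebra h) : corner_algebra e := Peirce (toP x).
pose of_ (y : corner_algebra e) : corner_algebra h := Peirce (ofP' y).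
have toD : additive_fun to by move=> x y; apply: val_inj.
have toM x y : to (x * y) = to x * to y by apply: val_inj.
have ofD : additive_fun of_ by move=> x y; apply: val_inj; apply: val_inj.
have ofM x y : of_ (x * y) = of_ x * of_ y by apply: val_inj; apply: val_inj.
apply: (@verifies_Han_iso _ _ _ (NuHom toD toM) (NuHom ofD ofM)).
- move=> c x; apply: val_inj => /=; rewrite -!mulrA; congr (_ * _).
  by rewrite mulrA he ge.
- move=> c x; apply: val_inj; apply: val_inj => /=; rewrite -!mulrA; congr (_ * _).
  by rewrite mulrA he ge.
- by move=> x; apply: val_inj; apply: val_inj.
- by move=> x; apply: val_inj.
Qed.
End Transport.

Lemma idem_inj (R : pzRingType) (e f : idem R) : idem_val e = idem_val f -> e = f.
Proof.
by case: e f => [e He] [f Hf] /= ef; subst f; congr Idem; exact: Prop_irrelevance.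
Qed.

(** The induction runs on the number [m] of idempotents after index i, the last corner being covered
    by the hypothesis on the e_i. *)
Lemma verifies_Han_tail (k : fieldType) (A : algebra k) (n : nat)
    (E : complete_idems A n) (m i : nat) :
  H_strongly_costratifying_chain E -> (i + m).+1 = n ->
  verifies_Han (corner_algebra (tail E i)).
Proof.
move=> [strat hE]; elim: m i => [|m IH] i.
  rewrite addn0 => ni.
  have lt_in : (i < n)%N by rewrite -ni.
  have -> : tail E i = cidem_idem E (Ordinal lt_in); last exact: hE.
  apply: idem_inj; rewrite /= /tail_sum (bigD1 (Ordinal lt_in)) //= big1 ?addr0 //.
  move=> j /andP[ij /negP[]]; apply/eqP/val_inj/eqP => /=.
  by rewrite eqn_leq ij -ltnS ni ltn_ord.
rewrite addnS => ni.
have lt_i1n : (i.+1 < n)%N by rewrite -ni !ltnS leq_addr.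
have lt_in := ltnW lt_i1n.
apply: (@verifies_Han_stratified _ (corner_algebra (tail E i)) (tail_corner E i)).
- exact: strat.
- apply: (@verifies_Han_corner_corner _ _ _ (tail_corner E i) (tail E i.+1)) => //.
  by apply: IH; rewrite addSn.
- apply: (@verifies_Han_corner_corner _ _ _ (idem_compl (tail_corner E i))
      (cidem_idem E (Ordinal lt_in))); last exact: hE.
  (* The complement of f_{i+1} in the corner at f_i is f_i - f_{i+1}, the single idempotent of
     shifted index i. *)
  change (tail_sum E i - tail_sum E i.+1 = E (Ordinal lt_in)).
  rewrite /tail_sum (bigD1 (Ordinal lt_in)) //=.
  rewrite (eq_bigl (fun j : 'I_n => (i < j)%N)) ?addrK // => j.
  by rewrite ltn_neqAle eq_sym andbC; congr andb.
Qed.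

Theorem theorem5p13 (k : fieldType) (A : algebra k) (A_fin : finite_dim A)
    (n : nat) :
  (exists E : complete_idems A n, H_strongly_costratifying_chain E) ->
  verifies_Han A.
Proof.
move=> [E chain]; case: n E chain => [|n] E chain.
  (* For n = 0 the empty sum equals 1, so the algebra and all its modules are zero. *)
  have A0 (x : A) : x = 0.
    by rewrite -[x]mulr1 -(cidem_sum E) big_ord0 mulr0.
  move=> _; apply/finite_global_dimP; exists 0%N => X.
  apply: trivial_projective => x.
  by rewrite -[x]scale1r (A0 1) scale0r.
apply: (@verifies_Han_corner1 _ _ (tail E 0)); last exact: (@verifies_Han_tail _ _ _ E n).
exact: cidem_sum.
Qed.
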